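(* Let $\mathbb{H}$ be a non-empty family of finite graphs, each with minimum degree at least $1$ and none isomorphic to a star, let $n$ be sufficiently large (depending on $\mathbb{H}$), let $G^*\in SPEX(n,\mathbb{H}_{minor})$, and let $L$ be the set of dominating vertices of $G^*$. Then the induced subgraph $G^*-L$ belongs to $SAT(n-\gamma_\mathbb{H},\Gamma(\mathbb{H})_{minor})$. Specifically, if $\mathbb{H}=\{H\}$, then $G^*-L\in SAT(n-\gamma_H,\Gamma^*_{\alpha_H+1}(H)_{minor})$.
   Context: All graphs are finite and simple; $|G|$ is the number of vertices of $G$ and $\rho(G)$ is its spectral radius (largest adjacency eigenvalue). A graph $H$ is a minor of $G$ if $H$ can be obtained from $G$ by a sequence of vertex deletions, edge deletions and edge contractions. For a graph family $\mathbb{F}$, $G$ is $\mathbb{F}$-minor-free if no member of $\mathbb{F}$ is a minor of $G$; $G$ is $\mathbb{F}$-minor-saturated if it is $\mathbb{F}$-minor-free but the addition of any edge (between two non-adjacent vertices) results in a graph containing some member of $\mathbb{F}$ as a minor. $SAT(m,\mathbb{F}_{minor})$ is the set of $m$-vertex $\mathbb{F}$-minor-saturated graphs. $SPEX(n,\mathbb{H}_{minor})$ is the set of $n$-vertex $\mathbb{H}$-minor-free graphs whose spectral radius is maximum among all $n$-vertex $\mathbb{H}$-minor-free graphs. $\alpha_H$ is the independence number of $H$; $\gamma_H=|H|-\alpha_H-1$ and $\gamma_\mathbb{H}=\min_{H\in\mathbb{H}}\gamma_H$ (which is at least $1$). $\Gamma_s(H)$ is the set of $s$-vertex induced subgraphs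 of $H$; a member $H[S]$ of $\Gamma_s(H)$ is irreducible if $\Gamma_s(H)$ contains no member isomorphic to a proper subgraph of $H[S]$; $\Gamma_s^*(H)$ is the set of irreducible members of $\Gamma_s(H)$; and $\Gamma(\mathbb{H})=\bigcup_{H\in\mathbb{H}}\Gamma^*_{|H|-\gamma_\mathbb{H}}(H)$. A dominating vertex is a vertex adjacent to all other vertices; for $n$ sufficiently large, $G^*$ has exactly $|L|=\gamma_\mathbb{H}$ dominating vertices. *)

(* Defs.v *)
From HB Require Import structures.
From mathcomp Require Import all_boot all_order all_algebra.
From mathcomp Require Import boolp classical_sets reals.

Set Implicit Arguments.
Unset Strict Implicit.
Unset Printing Implicit Defensive.

Import Order.TTheory GRing.Theory Num.Theory.

Local Open Scope nat_scope.

Record sgraph := SGraph {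
  vertex :> finType;
  edge : rel vertex;
  edge_sym : symmetric edge;
  edge_irrefl : irreflexive edge }.

Arguments edge {s}.
Notation "x -- y" := (edge x y) (at level 30, no associativity).

Definition graph_iso (G H : sgraph) : Prop :=
  exists2 f : G -> H, bijective f & forall x y, f x -- f y = x -- y.

Definition degree (G : sgraph) (x : G) : nat := #|[pred y | x -- y]|.

(* Every degree is less than #|G|, so the default value #|G| only matters for
   the graph without vertices, whose minimum degree is 0 by convention. *)
Definition min_degree (G : sgraph) : nat := \big[minn/#|G|]_(x : G) degree x.

Definition star_rel (k : nat) : rel 'I_k.+1 :=
  [rel i j | (i != j) && ((i == ord0) || (j == ord0))].

Lemma star_sym k : symmetric (@star_rel k).
Proof. by move=> i j; rewrite /star_rel /= eq_sym orbC. Qed.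

Lemma star_irrefl k : irreflexive (@star_rel k).
Proof. by move=> i; rewrite /star_rel /= eqxx. Qed.

Definition star (k : nat) : sgraph := SGraph (@star_sym k) (@star_irrefl k).

Definition independent (G : sgraph) (S : {set G}) : bool :=
  [forall x in S, forall y in S, ~~ x -- y].

Definition alpha (G : sgraph) : nat :=
  \max_(S : {set G} | independent S) #|S|.

Definition dominating (G : sgraph) (x : G) : bool :=
  [forall y, (y != x) ==> x -- y].

Definition dominating_set (G : sgraph) : {set G} := finset (@dominating G).

Section Induced.
Variables (G : sgraph) (S : {set G}).

Definition induced_rel : rel {x : G | x \in S} := [rel x y | val x -- val y].

Lemma induced_sym : symmetric induced_rel.
Proof. by move=> x y; rewrite /induced_rel /= edge_sym. Qed.

Lemma induced_irrefl : irreflexive induced_rel.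
Proof. by move=> x; rewrite /induced_rel /= edge_irrefl. Qed.

Definition induced : sgraph := SGraph induced_sym induced_irrefl.

End Induced.

Definition del_vertex (G : sgraph) (v : G) : sgraph := induced (~: [set v])%SET.

Section EdgeOperations.
Variables (G : sgraph) (u v : G).

Definition same_pair : rel G :=
  [rel x y | ((x == u) && (y == v)) || ((x == v) && (y == u))].

Lemma same_pair_sym : symmetric same_pair.
Proof. by move=> x y; rewrite /same_pair /= orbC andbC [X in _ || X]andbC. Qed.

Definition del_edge_rel : rel G := [rel x y | x -- y && ~~ same_pair x y].

Lemma del_edge_sym : symmetric del_edge_rel.
Proof. by move=> x y; rewrite /del_edge_rel /= -!/(same_pair _ _) edge_sym same_pair_sym. Qed.

Lemma del_edge_irrefl : irreflexive del_edge_rel.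
Proof. by move=> x; rewrite /del_edge_rel /= edge_irrefl. Qed.

Definition del_edge : sgraph := SGraph del_edge_sym del_edge_irrefl.

Definition add_edge_rel : rel G :=
  [rel x y | (x != y) && (x -- y || same_pair x y)].

Lemma add_edge_sym : symmetric add_edge_rel.
Proof.
by move=> x y; rewrite /add_edge_rel /= -!/(same_pair _ _) eq_sym edge_sym same_pair_sym.
Qed.

Lemma add_edge_irrefl : irreflexive add_edge_rel.
Proof. by move=> x; rewrite /add_edge_rel /= eqxx. Qed.

Definition add_edge : sgraph := SGraph add_edge_sym add_edge_irrefl.

(* The vertex [v] is merged into [u]; parallel edges and loops disappear. *)
Definition contract_rel : rel {x : G | x \in (~: [set v])%SET} :=
  [rel x y | (x != y) && [|| val x -- val y,
                             (val x == u) && v -- val y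
                           | (val y == u) && v -- val x]].

Lemma contract_sym : symmetric contract_rel.
Proof.
move=> x y; rewrite /contract_rel /= eq_sym edge_sym.
by congr (_ && (_ || _)); rewrite orbC.
Qed.

Lemma contract_irrefl : irreflexive contract_rel.
Proof. by move=> x; rewrite /contract_rel /= eqxx. Qed.

Definition contract : sgraph := SGraph contract_sym contract_irrefl.

End EdgeOperations.

Inductive minor (H : sgraph) : sgraph -> Prop :=
| minor_iso (G : sgraph) : graph_iso G H -> minor H G
| minor_del_vertex (G : sgraph) (v : G) : minor H (del_vertex v) -> minor H G
| minor_del_edge (G : sgraph) (u v : G) : u -- v -> minor H (del_edge u v) -> minor H G
| minor_contract (G : sgraph) (u v : G) : u -- v -> minor H (contract u v) -> minor H G.

(* [set sgraph] is rejected by the universe constraints of the library. *)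
Definition graph_family := sgraph -> Prop.

Definition minor_free (F : graph_family) (G : sgraph) : Prop :=
  forall H, F H -> ~ minor H G.

Definition minor_saturated (F : graph_family) (G : sgraph) : Prop :=
  minor_free F G /\
  forall u v : G, u != v -> ~~ u -- v ->
    exists2 H, F H & minor H (add_edge u v).

Definition SAT (m : nat) (F : graph_family) : graph_family :=
  fun G => #|G| = m /\ minor_saturated F G.

Definition adjacency (R : realType) (G : sgraph) : 'M[R]_#|G| :=
  (\matrix_(i, j) (enum_val i -- enum_val j)%:R)%R.

(* The largest eigenvalue; the default value 0 is used only for the graph
   without vertices, since a real symmetric matrix of positive size has a real
   eigenvalue. *)
Definition spectral_radius (R : realType) (G : sgraph) : R :=
  let spectrum := [set a : R | eigenvalue (adjacency R G) a]%classic in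
  xget 0%R (spectrum `&` ubound spectrum)%classic.

Definition SPEX (R : realType) (n : nat) (F : graph_family) : graph_family :=
  fun G => [/\ #|G| = n, minor_free F G &
    forall G' : sgraph, #|G'| = n -> minor_free F G' ->
      (spectral_radius R G' <= spectral_radius R G)%R].

(* [alpha H < #|H|] as soon as [H] has an edge, so that the subtraction is not
   truncated for the graphs of interest. *)
Definition gamma (H : sgraph) : nat := #|H| - alpha H - 1.

(* The minimum of [gamma] over [F]; the default value is used only if [F] is
   empty. *)
Definition gamma_family (F : graph_family) : nat :=
  let values := [set g | exists2 H, F H & gamma H = g]%classic in
  xget 0 (values `&` lbound values)%classic.

Definition Gamma_s (s : nat) (H : sgraph) : graph_family :=
  fun K => exists2 S : {set H}, #|S| = s & K = induced S.

(* [J] is isomorphic to the subgraph of [K] whose vertices and edges are the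
   images under [f] of those of [J], and this subgraph misses a vertex or an
   edge of [K]. *)
Definition iso_proper_subgraph (J K : sgraph) : Prop :=
  exists f : J -> K,
    [/\ injective f,
        forall x y, x -- y -> f x -- f y &
        (exists z : K, forall x, f x != z) \/
        (exists x y, f x -- f y /\ ~~ x -- y)].

Definition irreducible_in (s : nat) (H K : sgraph) : Prop :=
  forall J, Gamma_s s H J -> ~ iso_proper_subgraph J K.

Definition Gamma_star (s : nat) (H : sgraph) : graph_family :=
  fun K => Gamma_s s H K /\ irreducible_in s H K.

Definition Gamma_family (F : graph_family) : graph_family :=
  fun K => exists2 H, F H & Gamma_star (#|H| - gamma_family F) H K.

(* Main.v *)
Require Import Defs.
From mathcomp Require Import boolp classical_sets reals.
From mathcomp Require Import all_boot all_order all_fingroup all_algebra.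
From mathcomp Require Import zify ring lra.

(** Write [g] for [gamma_family HH] and [n] for the number of vertices. The
    heart of the matter is that, for large [n], an extremal graph [G] has
    exactly [g] dominating vertices ([dominating_hubs]); let [L] be their set.
    If a member of [Gamma_family HH] were a minor of [G - L], the vertices of
    [L] would supply the [g] missing branch sets ([mle_dominated]), and a member
    of [HH] would be a minor of [G]. Conversely, an edge added to [G - L]
    strictly increases the spectral radius ([add_edge_radius]), so it creates a
    minor [H] in [HH]; at most [g] of its branch sets meet [L]
    ([mle_restrict]), the others give an induced subgraph of [H] on [#|H| - g]
    vertices as a minor of [G - L] with the new edge, and this induced subgraph
    contains an irreducible one ([Gamma_star_below]).

    Here is why the dominating vertices exist. Fix a member [H0] of [HH] with
    [gamma H0 = g]. Excluding [H0] as a minor bounds the edge density of all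
    subgraphs of [G] ([clique_of_density]) and excludes complete bipartite
    subgraphs with [g + 1] and [#|H0|] vertices on the two sides
    ([minorless_biclique]). On the other hand, a clique on [g] vertices joined
    to an edgeless graph has no minor in [HH], whence
    [g * (n - g) <= rho ^+ 2] for the spectral radius [rho] of [G]
    ([extremal_radius]). These facts force the Perron vector to be close to
    [1] on a set [L] of [g] hubs and close to [0] elsewhere, while at least
    half of all vertices form the set [W] of common neighbours of [L]
    ([hub_structure]).

    Now [G] is compared with the join of a clique on [L] with the graph induced
    by [W :\: Z] and isolated vertices, where [Z] is a set of boundedly many
    vertices of small degree in [W]. Unless [L] is already a clique adjacent to
    everything else, the new edges at [L] outweigh the lost ones and the join
    has a larger spectral radius ([join_beats]), so it must have a minor in
    [HH]. This is refuted as follows ([join_minorless]). Dropping the branch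
    sets that meet [L] leaves an induced subgraph [J] of a member, with all but
    [g] of its vertices, as a minor of the graph induced by [W :\: Z] with
    isolated vertices added. That graph has no large star as a minor, because
    such a star and [L] would give [H0] as a minor of [G] ([starfree_join]).
    Graphs without large star minors are well-quasi-ordered ([starfree_wqo]),
    so below [J] there is another such induced subgraph of a member whose order
    is bounded in terms of [HH] only ([starfree_basis]); this is what makes it
    possible to fix the size of [Z] in advance although [HH] may be infinite.
    The isolated vertices of the smaller graph are moved into [Z], and [g]
    further vertices of [Z] complete the vertices of [L] to pairwise adjacent
    branch sets, so that a member of [HH] is a minor of [G] itself
    ([join_reroute]).

    The well-quasi-ordering rests on a description of connected graphs without
    large star minors: in a spanning tree given by levels there are few leaves,
    hence few branching vertices and few vertices with further edges, and the
    rest consists of paths ([code_exists]). Such graphs are compared by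
    Dickson's lemma, and their disjoint unions by a minimal bad sequence. *)

Set Implicit Arguments.
Unset Strict Implicit.
Unset Printing Implicit Defensive.

Import Order.TTheory GRing.Theory Num.Theory.

Local Open Scope nat_scope.

(** * Connected sets and minor models *)

Section Connectivity.
Variable (T : finType) (e : rel T).
Implicit Types X Y A : {set T}.

Definition link X Y := exists x y, [/\ x \in X, y \in Y & e x y].

(** Connectivity is phrased as an induction principle: a set that is closed
    under adjacency inside [X] and meets [X] contains [X]. *)
Definition conn X :=
  (exists x, x \in X) /\
  forall A, (exists2 x, x \in X & x \in A) ->
    (forall x y, x \in X -> y \in X -> e x y -> x \in A -> y \in A) ->
    X \subset A.

Lemma conn1 x : conn [set x].
Proof.
split; first by exists x; rewrite inE.
by move=> A [y /set1P-> Ay] _; apply/subsetP => z /set1P->.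
Qed.

Lemma connU X Y : symmetric e -> conn X -> conn Y -> link X Y -> conn (X :|: Y).
Proof.
move=> es [[x0 X0] cX] [_ cY] [x [y [Xx Yy xy]]].
split; first by exists x0; rewrite inE X0.
move=> A [z Zz Az] clA.
have clX u v : u \in X -> v \in X -> e u v -> u \in A -> v \in A.
  by move=> Xu Xv; apply: clA; rewrite inE ?Xu ?Xv.
have clY u v : u \in Y -> v \in Y -> e u v -> u \in A -> v \in A.
  by move=> Xu Xv; apply: clA; rewrite inE ?Xu ?Xv orbT.
have Axy : (x \in A) /\ (y \in A).
  case/setUP: Zz => Zz.
    have /subsetP XA := cX A (ex_intro2 _ _ z Zz Az) clX.
    by split; [exact: XA | apply: (clA x); rewrite ?inE ?Xx ?Yy ?orbT ?XA].
  have /subsetP YA := cY A (ex_intro2 _ _ z Zz Az) clY.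
  split; last exact: YA.
  by apply: (clA y); rewrite ?inE ?Xx ?Yy ?orbT ?YA // es.
rewrite subUset (cX A _ clX) ?(cY A _ clY) //.
  by exists y; case: Axy.
by exists x; case: Axy.
Qed.

Lemma conn2 x y : symmetric e -> e x y -> conn [set x; y].
Proof.
move=> es xy; apply: connU (conn1 x) (conn1 y) _ => //.
by exists x, y; rewrite !inE.
Qed.

Lemma conn_edge X x : conn X -> x \in X -> X != [set x] ->
  exists2 y, y \in X & e x y.
Proof.
move=> [_ cX] Xx nX; apply: contrapT => no.
case/negP: nX; rewrite eqEsubset sub1set Xx andbT; apply: cX.
  by exists x; rewrite ?inE.
by move=> u v _ Xv uv /set1P ux; case: no; exists v; rewrite -?ux.
Qed.

Lemma conn_iso X z : conn X -> z \in X -> (forall y, y \in X -> ~~ e z y) ->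
  X = [set z].
Proof.
move=> cX Xz no; case: (eqVneq X [set z]) => // nX.
by have [y /no/negP] := conn_edge cX Xz nX.
Qed.

End Connectivity.

Lemma link_mono (T : finType) (e e' : rel T) (X Y X' Y' : {set T}) :
  (forall x y, x \in X -> y \in Y -> e x y -> e' x y) ->
  X \subset X' -> Y \subset Y' -> link e X Y -> link e' X' Y'.
Proof.
move=> ee /subsetP XX /subsetP YY [x [y [Xx Yy xy]]].
by exists x, y; rewrite XX ?YY ?ee.
Qed.

Lemma conn_mono (T : finType) (e e' : rel T) (X : {set T}) :
  (forall x y, x \in X -> y \in X -> e x y -> e' x y) -> conn e X -> conn e' X.
Proof.
move=> ee [nX cX]; split=> // A mA clA; apply: cX => // x y Xx Xy xy.
by apply: clA => //; apply: ee.
Qed.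

(** Both the pattern and the host are given as a relation together with a set
    of vertices, so that induced subgraphs, joins and edge additions are
    handled without changing the vertex type. *)
Definition model (U : finType) (p : rel U) (S : {set U})
    (T : finType) (e : rel T) (D : {set T}) (B : U -> {set T}) :=
  [/\ forall h, h \in S -> conn e (B h),
      forall h, h \in S -> B h \subset D,
      forall h k, h \in S -> k \in S -> h != k -> [disjoint B h & B k] &
      forall h k, h \in S -> k \in S -> h != k -> p h k -> link e (B h) (B k)].

Definition mle (U : finType) (p : rel U) (S : {set U})
    (T : finType) (e : rel T) (D : {set T}) :=
  exists B : U -> {set T}, model p S e D B.

Lemma disjointP (T : finType) (A B : {set T}) :
  (forall x, x \in A -> x \in B -> False) <-> [disjoint A & B].
Proof.
split=> [AB|/disjointFl AB x Ax Bx]; last by have := AB x Bx; rewrite Ax.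
rewrite disjoint_subset; apply/subsetP => x Ax; rewrite inE.
by apply/negP => /(AB x Ax).
Qed.

Lemma model_inj (U : finType) (p : rel U) (S : {set U})
    (T : finType) (e : rel T) (D : {set T}) (B : U -> {set T}) h k x :
  model p S e D B -> h \in S -> k \in S -> x \in B h -> x \in B k -> h = k.
Proof.
move=> [_ _ dB _] Sh Sk xh xk; case: (eqVneq h k) => // hk.
by have /disjointP/(_ x xh xk) := dB h k Sh Sk hk.
Qed.

(** A closed set meeting the union contains every branch set that it meets, so
    the indices of the branch sets that it contains form a closed set. *)
Lemma model_bigcup_conn (U : finType) (p : rel U) (S X : {set U})
    (T : finType) (e : rel T) (D : {set T}) (B : U -> {set T}) :
  model p S e D B -> X \subset S -> conn p X -> conn e (\bigcup_(h in X) B h).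
Proof.
move=> [cB _ _ lB] /subsetP XS [[h Xh] cX].
have [[x Bx] _] := cB h (XS _ Xh).
split; first by exists x; apply/bigcupP; exists h.
move=> A [y /bigcupP [k Xk By] Ay] clA.
have clB u z : u \in X -> z \in B u -> z \in A -> B u \subset A.
  move=> Xu Bz Az; have [_ cu] := cB u (XS _ Xu); apply: cu; first by exists z.
  move=> v w Bv Bw; apply: clA; apply/bigcupP; exists u => //.
have /subsetP XA : X \subset [set u | B u \subset A].
  apply: cX; first by exists k; rewrite ?inE //; apply: clB Ay.
  move=> u v Xu Xv uv; rewrite !inE => /subsetP Bu.
  case: (eqVneq u v) => [<-|nuv]; first exact/subsetP.
  have [a [b [Ba Bb ab]]] := lB u v (XS _ Xu) (XS _ Xv) nuv uv.
  apply: (clB _ b) => //; apply: (clA a) => //; last exact: Bu.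
    by apply/bigcupP; exists u.
  by apply/bigcupP; exists v.
by apply/bigcupsP => u Xu; have := XA u Xu; rewrite inE.
Qed.

Lemma mle_trans (U : finType) (p : rel U) (S : {set U})
    (T : finType) (e : rel T) (D : {set T})
    (V : finType) (f : rel V) (E : {set V}) :
  mle p S e D -> mle e D f E -> mle p S f E.
Proof.
move=> [B [cB sB dB lB]] [C mC]; have [cC sC dC lC] := mC.
exists (fun h => \bigcup_(t in B h) C t); split.
- by move=> h Sh; apply: model_bigcup_conn mC _ _; auto.
- move=> h Sh; apply/bigcupsP => t Bt; apply: sC.
  exact: (subsetP (sB h Sh)).
- move=> h k Sh Sk hk; apply/disjointP => x /bigcupP [t Bt xt] /bigcupP [u Bu xu].
  have E1 := model_inj mC (subsetP (sB h Sh) t Bt) (subsetP (sB k Sk) u Bu) xt xu.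
  by have /disjointP/(_ t Bt) := dB h k Sh Sk hk; rewrite {1}E1; apply.
move=> h k Sh Sk hk hpk; have [t [u [Bt Bu tu]]] := lB h k Sh Sk hk hpk.
case: (eqVneq t u) => ntu.
  by have /disjointP/(_ t Bt) := dB h k Sh Sk hk; rewrite {1}ntu => /(_ Bu).
have := lC t u (subsetP (sB h Sh) t Bt) (subsetP (sB k Sk) u Bu) ntu tu.
by apply: link_mono => //; apply: bigcup_sup.
Qed.

Lemma mle_embed (U : finType) (p : rel U) (S : {set U})
    (T : finType) (e : rel T) (D : {set T}) (f : U -> T) :
  {in S &, injective f} -> (forall h, h \in S -> f h \in D) ->
  (forall h k, h \in S -> k \in S -> p h k -> e (f h) (f k)) -> mle p S e D.
Proof.
move=> fI fD fp; exists (fun h => [set f h]); split.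
- by move=> h _; apply: conn1.
- by move=> h Sh; rewrite sub1set fD.
- move=> h k Sh Sk hk; apply/disjointP => x /set1P-> /set1P /(fI _ _ Sh Sk) E.
  by rewrite E eqxx in hk.
by move=> h k Sh Sk _ hpk; exists (f h), (f k); rewrite !inE fp.
Qed.

Lemma mle_mono (U : finType) (p : rel U) (S S' : {set U})
    (T : finType) (e e' : rel T) (D D' : {set T}) :
  S' \subset S -> D \subset D' ->
  (forall x y, x \in D -> y \in D -> e x y -> e' x y) ->
  mle p S e D -> mle p S' e' D'.
Proof.
move=> /subsetP SS /subsetP DD ee [B [cB sB dB lB]].
have sB' h x : h \in S' -> x \in B h -> x \in D.
  by move=> Sh; apply: (subsetP (sB h (SS h Sh))).
exists B; split.
- move=> h Sh; apply: (@conn_mono _ e) (cB h (SS h Sh)) => x y Bx By.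
  by apply: ee; apply: sB' Sh _.
- by move=> h Sh; apply/subsetP => x Bx; apply/DD/(sB' h).
- by move=> h k /SS Sh /SS Sk; apply: dB.
move=> h k Sh Sk hk hpk.
apply: link_mono (lB h k (SS _ Sh) (SS _ Sk) hk hpk) => // x y Bx By.
by apply: ee; [apply: sB' Sh _ | apply: sB' Sk _].
Qed.

(** Together with [mle_induced], this moves between an induced subgraph and the
    corresponding set of vertices. *)
Lemma induced_mle (G : sgraph) (S : {set G}) :
  mle (@edge (induced S)) setT (@edge G) S.
Proof.
by apply: (@mle_embed _ _ _ _ _ _ val) => // [x y _ _ /val_inj //|x _]; apply: valP.
Qed.

Lemma mle_induced (G : sgraph) (S : {set G}) :
  mle (@edge G) S (@edge (induced S)) setT.
Proof.
have sub h : h \in S -> exists x : induced S, [set y : induced S | val y == h] = [set x].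
  move=> Sh; exists (exist _ h Sh); apply/setP => y; rewrite !inE.
  by apply/eqP/eqP => [E|->] //; apply: val_inj.
exists (fun h => [set y | val y == h]); split.
- by move=> h /sub [x ->]; apply: conn1.
- by move=> h _; apply: subsetT.
- move=> h k _ _ hk; apply/disjointP => x; rewrite !inE => /eqP-> /eqP E.
  by rewrite E eqxx in hk.
move=> h k Sh Sk _ hk; exists (exist _ h Sh), (exist _ k Sk).
by rewrite !inE /= !eqxx.
Qed.

Lemma card_induced (G : sgraph) (S : {set G}) : #|induced S| = #|S|.
Proof. by rewrite card_sig; apply: eq_card => x; rewrite inE. Qed.

(** The merged vertex [u] is expanded into the branch set of [u] and [v]. *)
Lemma contract_mle (G : sgraph) (u v : G) : u -- v ->
  mle (@edge (contract u v)) setT (@edge G) setT.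
Proof.
move=> uv.
pose B (x : contract u v) := if val x == u then [set u; v] else [set val x].
have inB x y : (y \in B x) = (y == val x) || ((val x == u) && (y == v)).
  by rewrite /B; case: eqP => [->|_]; rewrite !inE ?orbF.
exists B; split => [h _|h _|h k _ _ hk|h k _ _ hk]; last 1 first.
- rewrite /= /contract_rel /= => /andP [_ /or3P [E|/andP [/eqP E vk]|/andP [/eqP E vk]]].
  + by exists (val h), (val k); split; [rewrite inB eqxx | rewrite inB eqxx | exact: E].
  + have {}E : \val h = u := E.
    by exists v, (val k); split; [rewrite inB E !eqxx orbT | rewrite inB eqxx | exact: vk].
  + have {}E : \val k = u := E.
    exists (val h), v; split; [by rewrite inB eqxx | by rewrite inB E !eqxx orbT |].
    by rewrite edge_sym.
- by rewrite /B; case: eqP => _; [apply: conn2 => // x y; rewrite edge_sym | apply: conn1].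
- exact: subsetT.
have nv (x : contract u v) : val x <> v by move=> E; have := valP x; rewrite E !inE eqxx.
apply/disjointP => x; rewrite !inB.
case/orP=> [/eqP->|/andP [/eqP Eh /eqP->]] /orP [/eqP E|/andP [/eqP Ek /eqP E]] //.
- by case/eqP: hk; apply: val_inj.
- by case: (nv h).
- by case: (nv k).
by case/eqP: hk; apply: val_inj; rewrite Eh Ek.
Qed.

Lemma minor_mle (H G : sgraph) : minor H G -> mle (@edge H) setT (@edge G) setT.
Proof.
elim=> {G} [G [f [f' fK f'K] fe]|G v _ IH|G u v uv _ IH|G u v uv _ IH].
- apply: (@mle_embed _ _ _ _ _ _ f') => // [x y _ _ E|x y _ _].
    by rewrite -(f'K x) E f'K.
  by rewrite -fe !f'K.
- apply: (mle_trans IH); apply: mle_mono (induced_mle _) => //.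
- by apply: (mle_mono _ _ _ IH) => // x y _ _ /= /andP [].
- exact: mle_trans IH (contract_mle uv).
Qed.

Section ContractModel.
Variables (H G : sgraph) (B : H -> {set G}) (h0 : H) (u v : G).
Hypothesis mB : model (@edge H) setT (@edge G) setT B.
Hypotheses (uv : u -- v) (Bu : u \in B h0) (Bv : v \in B h0).

Let B' h : {set contract u v} := [set x | val x \in B h].

Lemma model_contract : model (@edge H) setT (@edge (contract u v)) setT B'.
Proof.
have [cB _ dB lB] := mB; have nuv : u != v by apply: contraTneq uv => ->; rewrite edge_irrefl.
have Vp x : x != v -> x \in (~: [set v])%SET by rewrite !inE.
pose u0 : {x : G | x \in (~: [set v])%SET} := exist _ u (Vp _ nuv).
pose pr x : contract u v := insubd u0 (if x == v then u else x).
have prE x : \val (pr x) = if x == v then u else x.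
  by rewrite val_insubd !inE; case: (eqVneq x v) => [_|->] //; rewrite nuv.
have inB' x h : x \in B h -> pr x \in B' h.
  rewrite inE prE; case: eqP => // -> Bh.
  by rewrite (model_inj mB (in_setT h) (in_setT h0) Bh Bv).
have prV x : pr (val x) = x.
  apply: val_inj; rewrite prE; case: eqP => // E.
  by have := valP x; rewrite E !inE eqxx.
have prE2 x y : pr x != pr y -> x -- y -> @edge (contract u v) (pr x) (pr y).
  move=> npr xy; rewrite /= /contract_rel /= npr !prE /=.
  case: (eqVneq x v) xy npr => [->|nx] xy npr; case: (eqVneq y v) xy npr => [->|ny] xy npr.
  - by rewrite edge_irrefl in xy.
  - by rewrite eqxx xy orbT.
  - by rewrite eqxx [v -- x]edge_sym xy !orbT.
  - by rewrite xy.
split=> [h _|h _|h k _ _ hk|h k _ _ hk hke].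
- have [[x Bx] cBh] := cB h (in_setT h); split; first by exists (pr x); apply: inB'.
  move=> A [y B'y Ay] clA; apply/subsetP => z B'z.
  have /subsetP/(_ (val z)) : B h \subset [set x | pr x \in A].
    apply: cBh => [|a b Ba Bb ab].
      by exists (val y); rewrite ?inE ?prV //; move: B'y; rewrite inE.
    rewrite !inE => Aa; case: (eqVneq (pr a) (pr b)) => [<- //|npr].
    by apply: (clA (pr a)); rewrite ?inB' ?prE2.
  by rewrite inE prV; apply; move: B'z; rewrite inE.
- exact: subsetT.
- apply/disjointP => x; rewrite !inE => xh xk; move/eqP: hk; apply.
  exact: (model_inj mB (in_setT h) (in_setT k) xh xk).
have [x [y [Bx By xy]]] := lB h k (in_setT _) (in_setT _) hk hke.
exists (pr x), (pr y); split; [exact: inB'|exact: inB'|apply: prE2 => //].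
apply: contraNneq hk => E; apply/eqP.
apply: (model_inj mB (in_setT h) (in_setT k) (x := val (pr x))).
  by have := inB' _ _ Bx; rewrite inE.
by rewrite E; have := inB' _ _ By; rewrite inE.
Qed.

End ContractModel.

(** As long as the branch sets are not singletons covering the host, a vertex
    outside them can be deleted or an edge inside one of them contracted; once
    they are, the surplus edges can be deleted. *)
Lemma mle_minor (H G : sgraph) : mle (@edge H) setT (@edge G) setT -> minor H G.
Proof.
have [m] := ubnP #|G|; elim: m G => // m IHv G ltm.
have [q] := ubnP #|[pred xy : G * G | xy.1 -- xy.2]|.
elim: q G ltm => // q IHe G ltm ltq [B mB]; have [cB _ dB lB] := mB.
have card1 (v : G) : #|del_vertex v| < m.
  rewrite card_induced -ltnS; apply: leq_trans ltm; apply: proper_card.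
  by apply/properP; split; [apply/subsetP | exists v; rewrite ?inE ?eqxx].
case: (pselect (exists v, forall h, v \notin B h)) => [[v nv]|cov].
  apply: (@minor_del_vertex _ _ v); apply: IHv; first exact: card1.
  apply: mle_trans (mle_induced _); exists B; split=> // h _.
  apply/subsetP => x Bx; rewrite !inE; apply: contraNneq (nv h) => <-; exact: Bx.
case: (pselect (exists h x y, [/\ x \in B h, y \in B h & x != y])).
  move=> [h [x [y [Bx By nxy]]]].
  have [|z Bz xz] := conn_edge (cB h (in_setT h)) Bx.
    by apply: contraNneq nxy => E; move: By; rewrite E inE eq_sym.
  apply: (@minor_contract _ _ x z) => //; apply: IHv; first exact: (card1 z).
  by eexists; apply: model_contract mB xz Bx Bz.
move=> single.
have one h x y : x \in B h -> y \in B h -> x = y.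
  by move=> Bx By; case: (eqVneq x y) => // nxy; case: single; exists h, x, y.
have /choice [f fB] : forall v, exists h, v \in B h.
  by move=> v; apply: contrapT => no; case: cov; exists v => h; apply/negP => Bv; case: no; exists h.
have /choice [g gB] : forall h, exists v, v \in B h.
  by move=> h; case: (cB h (in_setT h)).
have fK : cancel f g by move=> v; apply: (one (f v)).
have gK : cancel g f by move=> h; apply: (model_inj mB (in_setT _) (in_setT _) (fB (g h)) (gB h)).
have fg h k : h -- k -> g h -- g k.
  move=> hk; have nhk : h != k by apply: contraTneq hk => ->; rewrite edge_irrefl.
  have [x [y [Bx By xy]]] := lB h k (in_setT _) (in_setT _) nhk hk.
  by rewrite (one _ _ _ (gB h) Bx) (one _ _ _ (gB k) By).
case: (pselect (exists x y, x -- y /\ ~~ f x -- f y)) => [[x [y [xy nxy]]]|all].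
  apply: (minor_del_edge xy); apply: IHe => //.
    rewrite -ltnS; apply: leq_trans ltq; apply: proper_card.
    apply/properP; split; first by apply/subsetP => -[a b]; rewrite !inE /= => /andP [].
    exists (x, y); first by rewrite inE.
    by rewrite inE /= /del_edge_rel /same_pair /= !eqxx andbF.
  apply: (@mle_embed _ _ _ _ _ _ g) => // [h k _ _ E|h k _ _ hk].
    by rewrite -(gK h) E gK.
  rewrite /= /del_edge_rel /= fg //=; apply: contraNN nxy.
  by case/orP=> /andP [/eqP<- /eqP<-]; rewrite !gK // edge_sym.
apply: minor_iso; exists f; first by exists g.
move=> x y; apply/idP/idP => [/fg|xy]; first by rewrite !fK.
by apply: contrapT => nxy; case: all; exists x, y; split=> //; apply/negP.
Qed.

(** * Dense graphs contain large cliques as minors *)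

Definition nbrs (T : finType) (e : rel T) (D X : {set T}) : {set T} :=
  [set y in D :\: X | [exists x in X, e x y]].

Definition deg (T : finType) (e : rel T) (D : {set T}) (x : T) : nat :=
  #|[set y in D | e x y]|.

Lemma nbrsP (T : finType) (e : rel T) (D X : {set T}) y :
  reflect [/\ y \in D, y \notin X & exists2 x, x \in X & e x y] (y \in nbrs e D X).
Proof.
rewrite !inE; apply: (iffP idP) => [/andP [/andP [-> ->]] /exists_inP //|[-> -> ex]].
by apply/exists_inP.
Qed.

Section Density.
Variables (T : finType) (e : rel T).
Hypotheses (es : symmetric e) (ei : irreflexive e).

Lemma deg_setID (D A : {set T}) x : A \subset D -> deg e D x = deg e A x + deg e (D :\: A) x.
Proof.
move=> AD; rewrite /deg -(cardsID A); congr (_ + _); apply: eq_card => y; rewrite !inE.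
  by rewrite andbC; case: (boolP (y \in A)) => //= /(subsetP AD) ->.
by rewrite andbA.
Qed.

Lemma sum_degD1 (D : {set T}) y : y \in D ->
  \sum_(x in D) deg e D x =
  \sum_(x in D :\ y) deg e (D :\ y) x + (deg e D y).*2.
Proof.
move=> Dy; have dE : deg e D y = \sum_(i in D :\ y) e i y.
  rewrite /deg -sum1_card [RHS](eq_bigr (fun i => if e i y then 1 else 0)).
    rewrite -big_mkcondr /=; apply: eq_bigl => i; rewrite !inE es.
    by case: eqP => [->|_] //=; rewrite ei !andbF.
  by move=> i _; case: (e i y).
rewrite (big_setD1 y) //= addnC -addnn addnA; congr (_ + _); rewrite dE.
rewrite -big_split /=; apply: eq_bigr => x; rewrite !inE => /andP [nxy Dx].
rewrite (@deg_setID D [set y]) ?sub1set // addnC; congr (_ + _).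
rewrite /deg; case exy: (e x y).
  rewrite (_ : [set _ in _ | _] = [set y]) ?cards1 //.
  by apply/setP => z; rewrite !inE; case: eqP => // ->.
by rewrite (_ : [set _ in _ | _] = set0) ?cards0 //;
  apply/setP => z; rewrite !inE; case: eqP => // ->.
Qed.

Lemma mle_clique_extend t (D U N : {set T}) :
  conn e U -> U \subset D -> N \subset nbrs e D U ->
  mle (fun i j : 'I_t => i != j) setT e N ->
  mle (fun i j : 'I_t.+1 => i != j) setT e D.
Proof.
move=> cU UD /subsetP NU [B [cB sB dB lB]].
have BN j z : z \in B j -> z \in nbrs e D U by move/(subsetP (sB j (in_setT _)))/NU.
have BU j : [disjoint B j & U].
  by apply/disjointP => z /BN/nbrsP [_ /negP].
have lBU j : link e U (B j).
  case: (cB j (in_setT _)) => [[z Bz] _]; have /nbrsP [_ _ [x Ux xz]] := BN _ _ Bz.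
  by exists x, z.
exists (fun i => if unlift ord0 i is Some j then B j else U); split.
- by move=> i _; case: unliftP => [j _|_] //; apply: cB.
- move=> i _; case: unliftP => [j _|_] //; apply/subsetP => z /BN/nbrsP [].
  by [].
- move=> i k _ _; case: unliftP => [j ->|->]; case: unliftP => [l ->|->] //.
  + by move=> jl; apply: dB; rewrite ?in_setT //; apply: contraNneq jl => ->.
  + by rewrite disjoint_sym.
move=> i k _ _ ik _; move: ik; case: unliftP => [j ->|->]; case: unliftP => [l ->|->] //.
- by move=> jl; apply: lB; rewrite ?in_setT //; apply: contraNneq jl => ->.
have [x [y [Ux By xy]]] := lBU j; exists y, x; split=> //.
by rewrite es.
Qed.

(** A connected set [U] plays the role of a contracted vertex, the quantity
    [\sum deg + 2 * #|nbrs D U|] being twice the number of edges after the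
    contraction. When [U] is maximal for keeping the density, moving any
    neighbour [y] into [U] loses too many edges, and these are the edges from
    [y] to the other neighbours of [U]: so the neighbourhood of [U] is dense
    enough for half of the constant. *)
Lemma clique_of_density t (D : {set T}) : D != set0 ->
  2 ^ t * #|D| <= \sum_(x in D) deg e D x ->
  mle (fun i j : 'I_t.+1 => i != j) setT e D.
Proof.
elim: t D => [|t IHt] D.
  case/set0Pn => x Dx _; apply: (@mle_embed _ _ _ _ _ _ (fun=> x)) => //.
  - by move=> i j _ _ _; rewrite !ord1.
  - by move=> i j _ _; rewrite !ord1.
have [m] := ubnP #|D|; elim: m D => // m IHm D ltm D0 dens.
pose good U := [/\ conn e U, U \subset D &
  2 ^ t.+1 * (#|D :\: U|).+1 <=
    \sum_(x in D :\: U) deg e (D :\: U) x + (#|nbrs e D U|).*2].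
have [x Dx] := set0Pn _ D0.
have gx : `[< good [set x] >].
  apply/asboolP; split; [exact: conn1 | by rewrite sub1set |].
  have cD : (#|D :\ x|).+1 = #|D| by rewrite (cardsD1 x D) Dx.
  rewrite cD; apply: leq_trans dens _; rewrite (sum_degD1 Dx) leq_add2l leq_double.
  rewrite /deg subset_leq_card //; apply/subsetP => y; rewrite inE => /andP [Dy xy].
  apply/nbrsP; split; rewrite ?inE //; last by exists x; rewrite ?inE.
  by apply: contraTneq xy => ->; rewrite ei.
pose U := [arg max_(U > [set x] | `[< good U >]) #|U|].
have [/asboolP [cU UD dU] mU] : `[< good U >] /\
    forall V : {set T}, `[< good V >] -> #|V| <= #|U|.
  by rewrite /U; case: arg_maxnP => // V gV mV; split.
set N := nbrs e D U in dU *.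
have [N0|N0] := eqVneq N set0.
  rewrite N0 cards0 addn0 in dU.
  have D'0 : D :\: U != set0.
    apply: contraTneq dU => ->; rewrite cards0 big_set0 -ltnNge muln1 expn_gt0 //.
  apply: (@mle_mono _ _ setT _ _ e e (D :\: U)) => //; first exact: subsetDl.
  apply: IHm => //; last by apply: leq_trans dU; rewrite leq_mul2l leqnSn orbT.
  rewrite -ltnS; apply: leq_trans ltm; rewrite ltnS; apply: proper_card.
  case: cU => [[u Uu] _]; apply/properP; split; first exact: subsetDl.
  by exists u; [apply: (subsetP UD) | rewrite inE Uu].
apply: (@mle_clique_extend _ D U N) => //; apply: IHt => //.
rewrite mulnC -sum_nat_const; apply: leq_sum => y Ny.
have /nbrsP [Dy nUy [u Uu uy]] := Ny.
have D'y : y \in D :\: U by rewrite inE nUy.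
have EU : D :\: (y |: U) = (D :\: U) :\ y.
  by apply/setP => z; rewrite !inE negb_or -andbA.
have ngood : ~~ `[< good (y |: U) >].
  apply: contraL (ltnSn #|U|) => /mU; rewrite cardsU1 nUy /= => h.
  by rewrite -leqNgt; exact: leq_trans h _.
have cU' : conn e (y |: U).
  apply: connU (conn1 e y) cU _ => //; exists y, u.
  by rewrite inE eqxx Uu es.
have ND : N \subset D :\: U by apply/subsetP => z; rewrite inE => /andP [].
have dy : deg e (D :\: U) y = deg e N y + deg e ((D :\: U) :\: N) y by exact: deg_setID.
have cN : #|nbrs e D (y |: U)| + 1 >= #|N| + deg e ((D :\: U) :\: N) y.
  have -> : #|N| = #|N :\ y| + 1 by rewrite (cardsD1 y N) Ny addnC.
  rewrite addnAC leq_add2r /deg -cardsUI [X in _ + #|pred_of_set X|](_ : _ = set0).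
    rewrite cards0 addn0 subset_leq_card //; apply/subsetP => z.
    case/setUP => [/setD1P [zy /nbrsP [Dz nUz [w Uw wz]]]|].
      apply/nbrsP; split=> //; first by rewrite !inE negb_or zy.
      by exists w; rewrite // inE Uw orbT.
    rewrite inE => /andP [/setDP [/setDP [Dz nUz] nNz] yz].
    apply/nbrsP; split=> //; last by exists y; rewrite ?inE ?eqxx.
    by rewrite !inE negb_or nUz andbT; apply: contraTneq yz => ->; rewrite ei.
  apply/setP => z; rewrite in_setI in_set0; apply/negP => /andP [/setD1P [_ Nz]].
  by rewrite in_set => /andP [/setDP [_ /negP]].
have cD' : #|D :\: U| = (#|(D :\: U) :\ y|).+1 by rewrite (cardsD1 y (D :\: U)) D'y.
have lt : \sum_(x in (D :\: U) :\ y) deg e ((D :\: U) :\ y) x + (#|nbrs e D (y |: U)|).*2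
   < 2 ^ t.+1 * #|D :\: U|.
  rewrite ltnNge; apply: contra ngood => ge; apply/asboolP; split => //.
    by rewrite subUset sub1set Dy.
  by rewrite EU -cD'.
rewrite (sum_degD1 D'y) dy in dU.
have arith c k s a b n n' : 2 * c * k.+1 <= s + (a + b).*2 + n.*2 ->
  s + n'.*2 < 2 * c * k -> n + b <= n' + 1 -> c <= a by clear; rewrite mulnS; lia.
by rewrite expnS in dU lt; exact: arith dU lt cN.
Qed.

(** A graph on [#|U|] vertices is a subgraph of a clique, so excluding it as a
    minor bounds the average degree of every vertex set. *)
Lemma sparse_of_not_mle (U : finType) (p : rel U) (D : {set T}) :
  ~ mle p setT e D -> \sum_(x in D) deg e D x <= 2 ^ #|U| * #|D|.
Proof.
move=> npD; rewrite leqNgt; apply/negP => lt; apply: npD.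
have D0 : D != set0 by apply: contraTneq lt => ->; rewrite big_set0.
apply: mle_trans (clique_of_density D0 (ltnW lt)).
have ltU (h : U) : enum_rank h < #|U|.+1 by rewrite ltnS ltnW.
pose f h : 'I_(#|U|.+1) := Ordinal (ltU h).
exists (fun h => [set f h]); split.
- by move=> h _; apply: conn1.
- by move=> h _; rewrite subsetT.
- move=> h k _ _ hk; apply/disjointP => z /set1P-> /set1P /(congr1 val) /= /val_inj.
  by move/enum_rank_inj => E; rewrite E eqxx in hk.
move=> h k _ _ hk _; exists (f h), (f k); rewrite !inE; split=> //.
by apply: contraNneq hk => /(congr1 val) /= /val_inj/enum_rank_inj ->.
Qed.

End Density.

(** * Cones over a set of dominating branch sets *)

Lemma inj_of_card (U T : finType) (t0 : T) (A : {set U}) (B : {set T}) :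
  #|A| <= #|B| -> exists f : U -> T, {in A &, injective f} /\ {in A, forall a, f a \in B}.
Proof.
move=> AB; pose f a := nth t0 (enum B) (index a (enum A)).
have ltf a : a \in A -> index a (enum A) < size (enum B).
  by move=> Aa; rewrite -cardE (leq_trans _ AB) // cardE index_mem mem_enum.
exists f; split=> [a b Aa Ab /eqP|a Aa]; last by rewrite -mem_enum mem_nth ?ltf.
rewrite nth_uniq ?ltf ?enum_uniq // => /eqP /(congr1 (nth a (enum A))).
by rewrite !nth_index ?mem_enum.
Qed.

(** Branch sets that are pairwise adjacent and adjacent to every vertex of [X]
    can play the role of any vertices missing from a model inside [X]. *)
Lemma mle_cone (U : finType) (p : rel U) (S : {set U}) (T : finType) (e : rel T)
    (X : {set T}) (P : U -> {set T}) :
  symmetric e ->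
  mle p S e X ->
  (forall a, a \notin S -> conn e (P a) /\ [disjoint P a & X]) ->
  (forall a b, a \notin S -> b \notin S -> a != b ->
     [disjoint P a & P b] /\ link e (P a) (P b)) ->
  (forall a x, a \notin S -> x \in X -> exists2 y, y \in P a & e y x) ->
  mle p setT e setT.
Proof.
move=> es [B [cB sB dB lB]] cP dP lP.
have dBP h a : h \in S -> a \notin S -> [disjoint P a & B h].
  move=> Sh Sa; apply/disjointP => x Px Bx; have [_ /disjointP] := cP a Sa.
  by move/(_ x Px); apply; apply: (subsetP (sB h Sh)).
have lBP h a : h \in S -> a \notin S -> exists x y, [/\ x \in P a, y \in B h & e x y].
  move=> Sh Sa; have [[y By] _] := cB h Sh.
  have [x Px xy] := lP a y Sa (subsetP (sB h Sh) y By).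
  by exists x, y.
exists (fun h => if h \in S then B h else P h); split.
- by move=> h _; case: (boolP (h \in S)) => [/cB //|/cP []].
- by move=> h _; apply: subsetT.
- move=> h k _ _ hk; case: (boolP (h \in S)) => Sh; case: (boolP (k \in S)) => Sk.
  + exact: dB.
  + by rewrite disjoint_sym dBP.
  + exact: dBP.
  + by case: (dP h k).
move=> h k _ _ hk hpk; case: (boolP (h \in S)) => Sh; case: (boolP (k \in S)) => Sk.
- exact: lB.
- have [x [y [Px By xy]]] := lBP h k Sh Sk; exists y, x; split=> //.
  by rewrite es.
- exact: lBP.
- by case: (dP h k).
Qed.

Lemma subset_of_card (U : finType) (S : {set U}) k :
  k <= #|S| -> exists2 S' : {set U}, S' \subset S & #|S'| = k.
Proof.
elim: k => [|k IH] lt; first by exists set0; rewrite ?sub0set ?cards0.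
have [S' SS cS] := IH (ltnW lt).
have : S :\: S' != set0.
  by rewrite -card_gt0 cardsD (setIidPr SS) cS subn_gt0.
case/set0Pn => x /setDP [Sx nx]; exists (x |: S').
  by rewrite subUset sub1set Sx.
by rewrite cardsU1 nx cS.
Qed.

(** At most [#|L|] branch sets meet [L]. *)
Lemma mle_restrict (U : finType) (p : rel U) (T : finType) (e : rel T) (L : {set T}) :
  mle p setT e setT -> exists S : {set U}, #|S| = #|U| - #|L| /\ mle p S e (~: L).
Proof.
move=> [B mB]; have [cB sB dB lB] := mB.
pose S := [set h | [disjoint B h & L]].
have mS : mle p S e (~: L).
  exists B; split=> [h _|h|h k _ _|h k _ _]; [by apply: cB| |by apply: dB|by apply: lB].
  rewrite inE => /disjointP dh; apply/subsetP => x Bx; rewrite inE.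
  by apply/negP => /(dh x Bx).
have leS : #|U| - #|L| <= #|S|.
  rewrite leq_subLR addnC -(cardC S) leq_add2l -(_ : #|~: S| = #|[predC S]|); last first.
    by apply: eq_card => h; rewrite !inE.
  have [->|[h0]] := set_0Vmem (~: S); first by rewrite cards0.
  have wit h : h \in ~: S -> exists x, (x \in B h) && (x \in L).
    rewrite !inE => nd; apply: contrapT => no; case/negP: nd; apply/disjointP => x Bx Lx.
    by apply: no; exists x; rewrite Bx.
  move=> /wit [x0 _]; pose f h := odflt x0 [pick x in B h | x \in L].
  have fP h : h \in ~: S -> (f h \in B h) && (f h \in L).
    by move=> /wit [x Px]; rewrite /f; case: pickP => [y //|/(_ x)]; rewrite Px.
  rewrite -(card_in_imset (f := f)) => [|h k Sh Sk E].
    by apply/subset_leq_card/subsetP => _ /imsetP [h /fP /andP [_ Lf] ->].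
  apply: (model_inj mB (in_setT h) (in_setT k) (x := f h)).
    by case/andP: (fP h Sh).
  by rewrite E; case/andP: (fP k Sk).
have [S' SS cS] := subset_of_card leS; exists S'; split=> //.
by apply: mle_mono mS.
Qed.

(** The [g + 1] vertices outside an independent set are represented by a
    connected set and by the vertices of [L], each completed by a common
    neighbour in order to make these branch sets pairwise adjacent. *)
Lemma mle_star_join (H : sgraph) (I : {set H}) (T : finType) (e : rel T)
    (L X Y : {set T}) :
  symmetric e -> independent I -> #|~: I| = #|L|.+1 -> conn e X ->
  [disjoint X & L] -> [disjoint Y & L] -> [disjoint X & Y] ->
  (forall l y, l \in L -> y \in Y -> e l y) ->
  (forall y, y \in Y -> exists2 x, x \in X & e x y) ->
  #|H| <= #|Y| -> mle (@edge H) setT e setT.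
Proof.
move=> es indI cI cX /disjointP XL /disjointP YL /disjointP XY eL eX cY.
have [[x0 Xx0] _] := cX.
have [a0 Ia0] : exists a0, a0 \in ~: I by apply/set0Pn; rewrite -card_gt0 cI.
have [f [fI fY]] : exists f : H -> T,
    {in [set: H] &, injective f} /\ {in [set: H], forall a, f a \in Y}.
  by apply: (inj_of_card x0); rewrite cardsT.
have {}fY a : f a \in Y by apply: fY; rewrite inE.
have {fI} fI a b : f a = f b -> a = b by apply: fI; rewrite inE.
have [l [lI lL]] : exists l : H -> T,
    {in (~: I) :\ a0 &, injective l} /\ {in (~: I) :\ a0, forall a, l a \in L}.
  apply: (inj_of_card x0); rewrite -ltnS -cI (cardsD1 a0 (~: I)) Ia0 //.
pose P a := f a |: (if a == a0 then X else [set l a]).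
have inN a : a \notin I -> a != a0 -> a \in (~: I) :\ a0.
  by rewrite !inE => -> ->.
have PE a z : a \notin I -> z \in P a ->
    [\/ z = f a, z \in X /\ a = a0 | [/\ z = l a, z \in L & a != a0]].
  move=> Ia; rewrite /P; case: (eqVneq a a0) => [->|na] /setU1P [->|].
  - by constructor 1.
  - by constructor 2.
  - by constructor 1.
  by move/set1P->; constructor 3; split=> //; apply/lL/inN.
have eP a y : a \notin I -> y \in Y -> exists2 x, x \in P a & e x y.
  move=> Ia Yy; rewrite /P; case: (eqVneq a a0) => [_|na].
    by have [x Xx xy] := eX y Yy; exists x; rewrite // inE Xx orbT.
  by exists (l a); rewrite ?inE ?eqxx ?orbT //; apply: eL => //; apply/lL/inN.
apply: (@mle_cone _ _ I _ _ (f @: I) P) => //.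
- apply: (@mle_embed _ _ _ _ _ _ f) => [a b _ _ /fI //|a Ia|a b Ia Ib ab].
    exact: imset_f.
  by have /forall_inP/(_ a Ia)/forall_inP/(_ b Ib) := indI; rewrite ab.
- move=> a Ia; split.
    rewrite /P; case: (eqVneq a a0) => [_|na]; apply: connU (conn1 _ _) _ _ => //.
    - have [x Xx xf] := eX _ (fY a).
      by exists (f a), x; rewrite inE eqxx es xf.
    - exact: conn1.
    - exists (f a), (l a); rewrite !inE !eqxx es; split=> //.
      by apply: eL => //; apply/lL/inN.
  apply/disjointP => x /(PE _ _ Ia) [->|[Xx _]|[_ Lx _]] /imsetP [b Ib E].
  - by rewrite (fI _ _ E) Ib in Ia.
  - by apply: (XY x) => //; rewrite E.
  - by apply: (YL x) => //; rewrite E.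
- move=> a b Ia Ib ab; split; last first.
    have [x Px xy] := eP a (f b) Ia (fY b).
    by exists x, (f b); split=> //; rewrite /P setU11.
  apply/disjointP => x /(PE _ _ Ia) [->|[Xx Ea]|[Ea Lx na]] /(PE _ _ Ib).
  + case=> [/fI E|[Xf _]|[_ Lf _]]; first by rewrite E eqxx in ab.
      exact: XY Xf (fY a).
    exact: YL (fY a) Lf.
  + case=> [E|[_ E]|[_ Lf _]]; last exact: XL Xx Lf.
      by apply: XY Xx _; rewrite E.
    by rewrite Ea E eqxx in ab.
  case=> [E|[Xf _]|[Eb _ nb]]; first by apply: YL Lx; rewrite E.
    exact: XL Xf Lx.
  by rewrite (lI a b (inN _ Ia na) (inN _ Ib nb)) ?eqxx // -Ea in ab.
move=> a x Ia /imsetP [b _ ->]; exact: eP.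
Qed.

(** * Independence numbers and the parameter gamma *)

Lemma alpha_witness (H : sgraph) : exists2 I : {set H}, independent I & #|I| = alpha H.
Proof.
rewrite /alpha; have [|I indI ->] := eq_bigmax_cond (fun S : {set H} => #|S|) (A := @independent H).
  apply/card_gt0P; exists set0; rewrite unfold_in.
  by apply/forall_inP => x; rewrite inE.
by exists I.
Qed.

Lemma card_le_alpha (H : sgraph) (I : {set H}) : independent I -> #|I| <= alpha H.
Proof. by move=> indI; rewrite /alpha; apply: leq_bigmax_cond. Qed.

Lemma degree_gt0 (H : sgraph) : 1 <= min_degree H -> forall x : H, exists y, x -- y.
Proof.
move=> md x; suff : min_degree H <= degree x.
  by move=> /(leq_trans md) /card_gt0P [y]; rewrite inE; exists y.
have : x \in index_enum H by rewrite mem_index_enum.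
rewrite /min_degree; elim: (index_enum _) => // y s IH.
by rewrite inE big_cons geq_min => /predU1P [->|/IH ->]; rewrite ?leqnn ?orbT.
Qed.

Lemma min_degree_card (H : sgraph) : 1 <= min_degree H -> 0 < #|H|.
Proof.
move=> md; rewrite lt0n; apply/eqP => H0; have H1 := card0_eq H0.
by move: md; rewrite /min_degree big_pred0 ?H0 // => x; have := H1 x; rewrite inE.
Qed.

(** An independent set missing a single vertex leaves only a star. *)
Lemma alpha_lt (H : sgraph) : 1 <= min_degree H ->
  (forall k, ~ graph_iso H (star k)) -> alpha H + 1 < #|H|.
Proof.
move=> md ns; rewrite ltnNge; apply/negP => le.
have [I /forall_inP indI cI] := alpha_witness H.
have [/card_gt0P [x0 _]] := min_degree_card md.
have [c Ic] : exists c, c \notin I.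
  apply: contrapT => no; have [y xy] := degree_gt0 md x0.
  have all z : z \in I by apply: contrapT => /negP nz; apply: no; exists z.
  by have /forall_inP/(_ y (all y)) := indI x0 (all x0); rewrite xy.
have sub1 z : z \notin I -> z = c.
  move=> Iz; apply/eqP; apply: contraLR le => nzc; rewrite -ltnNge addn1 -cI.
  have <- : #|c |: (z |: I)| = #|I|.+2.
    by rewrite !cardsU1 !inE negb_or eq_sym nzc Ic Iz.
  exact: max_card.
have adj x : x != c -> x -- c.
  move=> nxc; have [y xy] := degree_gt0 md x.
  have Ix : x \in I by apply: contraNT nxc => /sub1->.
  suff -> : c = y by [].
  apply/esym/sub1; apply/negP => Iy.
  by have /forall_inP/(_ y Iy) := indI x Ix; rewrite xy.
have eqE x y : x -- y = (x != y) && ((x == c) || (y == c)).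
  case: (eqVneq x y) => [->|nxy]; first by rewrite edge_irrefl.
  case: (eqVneq x c) => [Exc|nx] /=; first by rewrite Exc edge_sym adj // -Exc eq_sym.
  case: (eqVneq y c) => [->|ny] /=; first exact: adj.
  have Ix : x \in I by apply: contraNT nx => /sub1->.
  have Iy : y \in I by apply: contraNT ny => /sub1->.
  by have /forall_inP/(_ y Iy)/negbTE := indI x Ix.
have cH : #|H| = #|H|.-1.+1 by rewrite prednK // min_degree_card.
pose r0 : 'I_(#|H|.-1.+1) := cast_ord cH (enum_rank c).
pose f (x : H) : star #|H|.-1 := tperm r0 ord0 (cast_ord cH (enum_rank x)).
apply: (ns #|H|.-1); exists f.
  exists (fun i => enum_val (cast_ord (esym cH) (tperm r0 ord0 i))) => [x|i].
    by rewrite /f tpermK cast_ordK enum_rankK.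
  by rewrite /f enum_valK cast_ordKV tpermK.
have f0 x : (f x == ord0) = (x == c).
  rewrite -{1}(tpermL r0 ord0) (inj_eq perm_inj) /r0 (inj_eq (@cast_ord_inj _ _ _)).
  by rewrite (inj_eq enum_rank_inj).
move=> x y; rewrite eqE /= /star_rel /= !f0; congr (~~ _ && _).
by rewrite (inj_eq perm_inj) (inj_eq (@cast_ord_inj _ _ _)) (inj_eq enum_rank_inj).
Qed.

Lemma gamma_alpha (H : sgraph) : alpha H + 1 < #|H| ->
  0 < gamma H /\ alpha H + gamma H + 1 = #|H|.
Proof. by rewrite /gamma => lt; split; lia. Qed.

(** The minimum is attained because the natural numbers are well-ordered, so
    the default value of [xget] does not occur. *)
Lemma gamma_familyP (F : graph_family) : (exists H, F H) ->
  (exists2 H, F H & gamma H = gamma_family F) /\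
  (forall H, F H -> gamma_family F <= gamma H).
Proof.
move=> [H FH]; rewrite /gamma_family.
pose P := fun g => exists2 H, F H & gamma H = g.
have ex : exists n, `[< P n >] by exists (gamma H); apply/asboolP; exists H.
case: (ex_minnP ex) => m /asboolP Pm mmin.
case: xgetP => [x _ [[H' FH' gH'] lb]|/(_ m) no]; last first.
  case: no; split=> // n Pn; rewrite leEnat; apply: mmin; exact/asboolP.
split; first by exists H'.
by move=> K FK; have := lb (gamma K) (ex_intro2 _ _ K FK erefl); rewrite leEnat.
Qed.

(** * Joins of a clique with a graph *)

Definition join_rel (T : finType) (e : rel T) (L A : {set T}) : rel T :=
  fun u v => (u != v) && [|| u \in L, v \in L | [&& u \in A, v \in A & e u v]].

(** No star with [d] leaves is a minor of the graph induced by [S]: a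
    connected set is a branch set for the centre. *)
Definition starfree (d : nat) (T : finType) (e : rel T) (S : {set T}) :=
  forall X : {set T}, X \subset S -> conn e X -> #|nbrs e S X| < d.

Lemma starfree_sub d (T : finType) (e : rel T) (S S' : {set T}) :
  S' \subset S -> starfree d e S -> starfree d e S'.
Proof.
move=> SS sf X XS cX; apply: leq_ltn_trans (sf X (subset_trans XS SS) cX).
by apply/subset_leq_card/subsetP => y /nbrsP [Sy nXy ex]; apply/nbrsP; split=> //; apply: (subsetP SS).
Qed.

(** A neighbour of [X] in the pattern yields a neighbour of the union of the
    branch sets of [X], chosen in its own branch set. *)
Lemma starfree_mle d (U : finType) (p : rel U) (S : {set U})
    (T : finType) (e : rel T) (D : {set T}) :
  mle p S e D -> starfree d e D -> starfree d p S.
Proof.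
move=> [B mB] sf X XS cX; have [cB sB dB lB] := mB.
have cY := model_bigcup_conn mB XS cX.
have YD : \bigcup_(h in X) B h \subset D.
  by apply/bigcupsP => h Xh; apply/sB/(subsetP XS).
have /choice [f fP] : forall k, exists z, k \in nbrs p S X ->
    z \in B k /\ z \in nbrs e D (\bigcup_(h in X) B h).
  have [[t0 _] _] := cY; move=> k; case: (boolP (k \in _)) => [|_]; last by exists t0.
  case/nbrsP => Sk nXk [h Xh hk].
  have nhk : h != k by apply: contraNneq nXk => <-.
  have Sh := subsetP XS h Xh.
  have [x [y [Bx By xy]]] := lB h k Sh Sk nhk hk.
  exists y => _; split=> //; apply/nbrsP; split; first exact: (subsetP (sB k Sk)).
    apply/negP => /bigcupP [u Xu yu].
    by move: nXk; rewrite -(model_inj mB (subsetP XS u Xu) Sk yu By) Xu.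
  by exists x => //; apply/bigcupP; exists h.
apply: leq_ltn_trans (sf _ YD cY); rewrite -(card_in_imset (f := f)).
  by apply/subset_leq_card/subsetP => _ /imsetP [k /fP [_ ?] ->].
move=> k l Nk Nl E; have [fk _] := fP k Nk; have [fl _] := fP l Nl.
apply: (model_inj mB _ _ fk); last by rewrite E.
  by case/nbrsP: Nk.
by case/nbrsP: Nl.
Qed.

Section Join.
Variables (T : finType) (e : rel T) (L : {set T}).
Hypothesis es : symmetric e.

Lemma join_sym A : symmetric (join_rel e L A).
Proof.
move=> x y; rewrite /join_rel eq_sym es.
by case: (y \in L) (x \in L) (y \in A) (x \in A) => [] [] [] [].
Qed.

Lemma join_irrefl A : irreflexive (join_rel e L A).
Proof. by move=> x; rewrite /join_rel eqxx. Qed.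

Lemma join_isolated A X z : conn (join_rel e L A) X -> X \subset ~: L ->
  z \in X -> z \notin A -> X = [set z].
Proof.
move=> cX /subsetP XL Xz Az; apply: (conn_iso cX Xz) => y Xy.
have := XL y Xy; have := XL z Xz; rewrite !inE /join_rel => /negbTE-> /negbTE->.
by rewrite (negbTE Az) andbF.
Qed.

(** Outside [L] the join has no edge, so the pattern vertices whose branch
    sets avoid [L] form an independent set. *)
Lemma empty_join_not_minor (H : sgraph) : alpha H + #|L| < #|H| ->
  ~ mle (@edge H) setT (join_rel e L set0) setT.
Proof.
move=> lt /(mle_restrict L) [S [cS [B [cB sB dB lB]]]].
suff /card_le_alpha : independent S by rewrite cS leq_subLR addnC leqNgt lt.
apply/forall_inP => h Sh; apply/forall_inP => k Sk; apply/negP => hk.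
have nhk : h != k by apply: contraTneq hk => ->; rewrite edge_irrefl.
have [x [y [Bx By]]] := lB h k Sh Sk nhk hk.
have := subsetP (sB h Sh) x Bx; have := subsetP (sB k Sk) y By.
by rewrite !inE /join_rel => /negbTE-> /negbTE->; rewrite !inE andbF.
Qed.

Variable W : {set T}.
Hypotheses (WL : [disjoint W & L]) (eW : forall l w, l \in L -> w \in W -> e l w).

(** A connected set with many neighbours would serve, together with [L], as
    the [g + 1] vertices outside the independent set of [H]. *)
Lemma starfree_join (H : sgraph) (I : {set H}) (A : {set T}) : A \subset W ->
  independent I -> #|~: I| = #|L|.+1 -> ~ mle (@edge H) setT e setT ->
  starfree #|H| (join_rel e L A) (~: L).
Proof.
move=> /subsetP AW indI cI nm X XL cX; rewrite ltnNge; apply/negP => leH; apply: nm.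
have inA x y : x \in X -> y \in ~: L -> join_rel e L A x y -> [/\ x \in A, y \in A & e x y].
  move=> Xx; have := subsetP XL x Xx; rewrite !inE /join_rel => /negbTE-> /negbTE->.
  by case/andP => _ /and3P.
have XA : X \subset A.
  apply/subsetP => z Xz; apply: contrapT => /negP Az; move: leH; apply/negP.
  rewrite -ltnNge (_ : nbrs _ _ _ = set0) ?cards0.
    by apply: leq_trans (max_card (~: I)); rewrite cI.
  apply/setP => y; rewrite in_set0; apply/negP => /nbrsP [Ly _ [x Xx xy]].
  have [Ax _ _] := inA _ _ Xx Ly xy.
  by case/negP: (Az); move: Xx; rewrite (join_isolated cX XL Xz Az) inE => /eqP<-.
have NA y : y \in nbrs (join_rel e L A) (~: L) X ->
    y \in A /\ exists2 x, x \in X & e x y.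
  move=> /nbrsP [Ly _ [x Xx xy]]; have [_ Ay exy] := inA _ _ Xx Ly xy.
  by split=> //; exists x.
apply: (mle_star_join (L := L) (X := X) (Y := nbrs (join_rel e L A) (~: L) X) es indI cI) => //.
- by apply: (conn_mono _ cX) => x y Xx Xy xy; case: (inA x y) => //; apply: (subsetP XL).
- by apply/disjointP => x /(subsetP XL); rewrite inE => /negP.
- apply/disjointP => x /nbrsP []; rewrite inE => /negP //.
- by apply/disjointP => x Xx /nbrsP [_]; rewrite Xx.
- by move=> l y Ll /NA [Ay _]; apply: eW => //; apply: AW.
- by move=> y /NA [].
Qed.

(** Branch sets of the join that avoid [L] lie inside [A] or are isolated
    vertices; the latter can be moved into [Z], and the vertices of [Z] that
    remain complete the vertices of [L] to pairwise adjacent branch sets. *)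
Lemma join_reroute (H : sgraph) (S : {set H}) (A Z : {set T}) :
  A \subset W -> Z \subset W -> [disjoint A & Z] ->
  #|~: S| <= #|L| -> #|H| <= #|Z| ->
  mle (@edge H) S (join_rel e L A) (~: L) -> mle (@edge H) setT e setT.
Proof.
move=> /subsetP AW /subsetP ZW /disjointP AZ cS cZ [B mB]; have [cB sB dB lB] := mB.
have WL' := (disjointP W L).2 WL.
have [H0|[h0 _]] := set_0Vmem [set: H].
  have no (h : H) : False by have := in_setT h; rewrite H0 inE.
  by exists (fun=> finset.set0); split=> h; case: (no h).
have [t0 _] : exists t0, t0 \in Z.
  by apply/card_gt0P; apply: leq_trans cZ; apply/card_gt0P; exists h0.
have [f [fI fZ]] : exists f : H -> T,
    {in [set: H] &, injective f} /\ {in [set: H], forall a, f a \in Z}.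
  by apply: (inj_of_card t0); rewrite cardsT.
have {}fZ a : f a \in Z by apply: fZ; rewrite inE.
have {fI} fI a b : f a = f b -> a = b by apply: fI; rewrite inE.
have [l [lI lL]] : exists l : H -> T,
    {in ~: S &, injective l} /\ {in ~: S, forall a, l a \in L}.
  exact: (inj_of_card t0).
have inS a : a \notin S -> a \in ~: S by rewrite inE.
have lf a b : a \notin S -> e (l a) (f b) by move=> Sa; apply: eW; [apply/lL/inS | apply/ZW].
have nlf a b : a \notin S -> l a = f b -> False.
  by move=> Sa E; apply: (WL' (f b)); [apply: ZW | rewrite -E; apply/lL/inS].
pose X := A :|: f @: S.
have eX a x : a \notin S -> x \in X -> e (l a) x.
  move=> Sa /setUP [Ax|/imsetP [b _ ->]]; last exact: lf.
  by apply: eW; [apply/lL/inS | apply: AW].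
apply: (@mle_cone _ _ S _ _ X (fun a => [set l a; f a])) => //.
- exists (fun h => if B h \subset A then B h else [set f h]).
  have iso h k : h \in S -> k \in S -> h != k -> h -- k -> B h \subset A /\ B k \subset A.
    move=> Sh Sk hk ehk; have [x [y [Bx By xy]]] := lB h k Sh Sk hk ehk.
    have := subsetP (sB h Sh) x Bx; have := subsetP (sB k Sk) y By.
    move: (xy); rewrite !inE /join_rel => xy' /negbTE Ly /negbTE Lx.
    move: xy'; rewrite Lx Ly /= => /andP [_ /and3P [Ax Ay _]].
    have inA z u : z \in S -> u \in B z -> u \in A -> B z \subset A.
      move=> Sz Bu Au; apply/subsetP => v Bv; apply: contraLR Au => Av.
      by move: Bu; rewrite (join_isolated (cB z Sz) (sB z Sz) Bv Av) inE => /eqP->.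
    by split; [apply: (inA h x) | apply: (inA k y)].
  have eA h x y : h \in S -> x \in B h -> B h \subset A -> y \in A ->
      join_rel e L A x y -> e x y.
    move=> Sh Bx /subsetP BA Ay /andP [_].
    have := WL' _ (AW _ Ay); have := WL' _ (AW _ (BA _ Bx)).
    case: (x \in L) => [/(_ isT) //|_]; case: (y \in L) => [/(_ isT) //|_] /=.
    by case/and3P.
  split.
  + move=> h Sh; case: ifP => BA; last exact: conn1.
    apply: conn_mono (cB h Sh) => x y Bx By; apply: (eA h) => //.
    exact: (subsetP BA).
  + move=> h Sh; case: ifP => BA; first by apply: subset_trans BA (subsetUl _ _).
    by rewrite sub1set inE imset_f ?orbT.
  + move=> h k Sh Sk hk; case: ifP => BA; case: ifP => BA'; first exact: dB.
    * by apply/disjointP => x /(subsetP BA) Ax /set1P E; apply: (AZ x Ax); rewrite E.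
    * by apply/disjointP => x /set1P E /(subsetP BA') Ax; apply: (AZ x Ax); rewrite E.
    apply/disjointP => x /set1P-> /set1P /fI E; by rewrite E eqxx in hk.
  + move=> h k Sh Sk hk ehk; have [Ah Ak] := iso h k Sh Sk hk ehk; rewrite Ah Ak.
    apply: link_mono (lB h k Sh Sk hk ehk) => // x y Bx By; apply: (eA h) => //.
    exact: (subsetP Ak).
- move=> a Sa; split; first by apply: conn2 => //; apply: lf.
  apply/disjointP => x /set2P [->|->] /setUP [Ax|/imsetP [b Sb E]].
  + by apply: (WL' (l a)); [apply: AW | apply/lL/inS].
  + exact: nlf E.
  + exact: AZ Ax (fZ a).
  + by rewrite (fI _ _ E) Sb in Sa.
- move=> a b Sa Sb ab; split; last by exists (l a), (f b); rewrite !inE !eqxx orbT lf.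
  apply/disjointP => x /set2P [->|->] /set2P [] E.
  + by rewrite (lI a b (inS _ Sa) (inS _ Sb) E) eqxx in ab.
  + exact: nlf E.
  + exact: nlf (esym E).
  + by rewrite (fI _ _ E) eqxx in ab.
by move=> a x Sa Xx; exists (l a); rewrite ?inE ?eqxx // eX.
Qed.

End Join.

(** * Sequences with ascending subsequences *)

(** Ascending subsequences are asked for, instead of a single ascending pair,
    because this form passes directly to conjunctions. *)
Definition asc (A : Type) (le : A -> A -> Prop) :=
  forall f : nat -> A, exists2 phi : nat -> nat,
    (forall i j, i < j -> phi i < phi j) &
    (forall i j, i < j -> le (f (phi i)) (f (phi j))).

Lemma incr_iterate (mu : nat -> nat) : (forall n, n <= mu n) ->
  exists2 phi : nat -> nat, (forall i j, i < j -> phi i < phi j) &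
    (forall i, exists2 n, phi i = mu n & forall j, i < j -> n <= phi j).
Proof.
move=> ge; pose phi := fix phi k := if k is k'.+1 then mu (phi k').+1 else mu 0.
have incr i j : i < j -> phi i < phi j.
  have step k : phi k < phi k.+1 by apply: (ge (phi k).+1).
  elim: j => // j IH; rewrite ltnS leq_eqVlt => /predU1P [-> //|/IH lt].
  exact: ltn_trans lt (step j).
exists phi => //; move=> [|i]; first by exists 0.
by exists (phi i).+1 => // j lt; apply: incr; apply: ltnW.
Qed.

Lemma asc_nat : asc leq.
Proof.
move=> f; have /choice [mu muP] : forall n, exists m, n <= m /\ forall k, n <= k -> f m <= f k.
  move=> n; have ex : exists v, `[< exists2 k, n <= k & f k = v >].
    by exists (f n); apply/asboolP; exists n.
  case: (ex_minnP ex) => v /asboolP [m nm <-] mmin.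
  by exists m; split=> // k nk; apply: mmin; apply/asboolP; exists k.
have [phi incr phiP] := incr_iterate (fun n => (muP n).1).
exists phi => // i j ij; have [n -> le] := phiP i.
by case: (muP n) => _; apply; apply: le.
Qed.

Lemma asc_fin (F : finType) : asc (fun x y : F => x = y).
Proof.
move=> f; have [c inf] : exists c, forall n, exists2 k, n <= k & f k = c.
  apply: contrapT => no.
  have /choice [N NP] : forall c, exists n, forall k, n <= k -> f k <> c.
    move=> c; apply: contrapT => noc; apply: no; exists c => n.
    by apply: contrapT => nok; apply: noc; exists n => k nk fk; apply: nok; exists k.
  exact: (NP (f (\max_c N c)) (\max_c N c) (leq_bigmax _)).
have /choice [mu muP] : forall n, exists m, n <= m /\ f m = c.
  by move=> n; have [k nk fk] := inf n; exists k.
have [phi incr phiP] := incr_iterate (fun n => (muP n).1).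
exists phi => // i j _; have [n -> _] := phiP i; have [m -> _] := phiP j.
by rewrite (muP n).2 (muP m).2.
Qed.

Lemma asc_map (A B : Type) (g : A -> B) (le : B -> B -> Prop) :
  asc le -> asc (fun x y => le (g x) (g y)).
Proof. by move=> h f; apply: (h (g \o f)). Qed.

Lemma asc_and (A : Type) (le1 le2 : A -> A -> Prop) :
  asc le1 -> asc le2 -> asc (fun x y => le1 x y /\ le2 x y).
Proof.
move=> h1 h2 f; have [phi iphi phiP] := h1 f; have [psi ipsi psiP] := h2 (f \o phi).
exists (phi \o psi) => i j ij; first exact/iphi/ipsi.
by split; [apply/phiP/ipsi | apply: psiP].
Qed.

(** Dickson's lemma, obtained by adding the coordinates one at a time. *)
Lemma asc_ffun (I : finType) : asc (fun l m : I -> nat => forall i, l i <= m i).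
Proof.
suff H (s : seq I) : asc (fun l m : I -> nat => forall i, i \in s -> l i <= m i).
  move=> f; have [phi incr phiP] := H (enum I) f.
  by exists phi => // i j ij k; apply: phiP => //; rewrite mem_enum.
elim: s => [|i s IH]; first by move=> f; exists id => // i j.
have h := asc_and (asc_map (fun l : I -> nat => l i) asc_nat) IH.
move=> f; have [phi incr phiP] := h f; exists phi => // a b ab k.
by have [h1 h2] := phiP a b ab; rewrite inE => /predU1P [->|/h2].
Qed.

(** * Graphs obtained by subdividing a small graph *)

Section Codes.
Variable N : nat.

(** The combinatorial type of a rooted graph whose edges are those of a forest
    of paths hanging from a kernel indexed by [K] and edges inside the kernel:
    the root, the adjacency in the kernel, and for each kernel vertex the
    kernel vertex at which the path starting from it ends. *)
Definition code : finType :=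
  ({set 'I_N} * 'I_N * {ffun 'I_N * 'I_N -> bool} * {ffun 'I_N -> 'I_N})%type.

Variable c : code.
Let K := c.1.1.1.
Let r := c.1.1.2.
Let E := c.1.2.
Let t := c.2.

Definition code_adj (len : 'I_N -> nat) i j i' j' :=
  [\/ i' = i /\ j' = j.+1, [/\ i != r, j = len i, j' = 0 & i' = t i] |
      [/\ j = 0, j' = 0 & E (i, i')]].

Definition coded (len : 'I_N -> nat) (T : finType) (e : rel T) (S : {set T})
    (q : 'I_N -> nat -> T) :=
  [/\ forall i j, i \in K -> j <= len i -> q i j \in S,
      forall x, x \in S -> exists i j, [/\ i \in K, j <= len i & x = q i j],
      forall i j i' j', i \in K -> i' \in K -> j <= len i -> j' <= len i' ->
        q i j = q i' j' -> i = i' /\ j = j',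
      forall i j i' j', i \in K -> i' \in K -> j <= len i -> j' <= len i' ->
        e (q i j) (q i' j') -> code_adj len i j i' j' \/ code_adj len i' j' i j &
      forall i j i' j', i \in K -> i' \in K -> j <= len i -> j' <= len i' ->
        code_adj len i j i' j' -> e (q i j) (q i' j')].

Lemma conn_chain (T : finType) (e : rel T) (q : nat -> T) d : symmetric e ->
  (forall j, j < d -> e (q j) (q j.+1)) -> conn e [set y | [exists j : 'I_d.+1, y == q j]].
Proof.
move=> es; elim: d => [|d IH] adj.
  rewrite (_ : [set y | _] = [set q 0]); first exact: conn1.
  apply/setP => y; rewrite !inE; apply/existsP/eqP => [[j]|->]; last by exists ord0.
  by rewrite ord1 => /eqP.
rewrite (_ : [set y | _] = [set y | [exists j : 'I_d.+1, y == q j]] :|: [set q d.+1]).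
  apply: connU (conn1 _ _) _ => //; first by apply: IH => j /ltnW; apply: adj.
  exists (q d), (q d.+1); rewrite !inE eqxx adj //; split=> //.
  by apply/existsP; exists ord_max.
apply/setP => y; rewrite !inE; apply/existsP/orP => [[j /eqP->]|].
  case: (ltngtP j d.+1) => [lt|gt|->]; last by right.
    by left; apply/existsP; exists (Ordinal lt).
  by have := leq_trans gt (ltn_ord j); rewrite ltnn.
case=> [/existsP [j /eqP ->]|/eqP ->]; last by exists ord_max.
by exists (widen_ord (leqnSn _) j).
Qed.

(** Longer paths are shortened by contracting their initial segments into the
    kernel: with truncated subtraction, position [j] goes to [j - d i], where
    [d i] is the surplus of length. *)
Lemma coded_mle len1 len2 (T1 : finType) (e1 : rel T1) S1 q1
    (T2 : finType) (e2 : rel T2) S2 q2 :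
  symmetric e2 -> coded len1 e1 S1 q1 -> coded len2 e2 S2 q2 ->
  (forall i, len1 i <= len2 i) -> mle e1 S1 e2 S2.
Proof.
move=> es2 [_ cov1 inj1 adj1 _] [in2 _ inj2 _ jda2] le.
pose d i := len2 i - len1 i.
have dle i j : j <= len2 i -> j - d i <= len1 i by rewrite /d; have := le i; lia.
have ldE i j : j <= len1 i -> j + d i <= len2 i by rewrite /d; have := le i; lia.
pose B x := [set y | [exists i in K, [exists j : 'I_(len2 i).+1,
                (y == q2 i j) && (x == q1 i (j - d i))]]].
have BP i j y : i \in K -> j <= len1 i ->
    y \in B (q1 i j) <-> exists j', [/\ j' <= len2 i, j' - d i = j & y = q2 i j'].
  move=> Ki ji; split.
    rewrite inE => /exists_inP [i' Ki' /existsP [j' /andP [/eqP -> /eqP E1]]].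
    have lj' : j' <= len2 i' by rewrite -ltnS.
    have [ii jj] := inj1 _ _ _ _ Ki Ki' ji (dle _ _ lj') E1.
    by exists (nat_of_ord j'); rewrite ii jj.
  move=> [j' [lj' <- ->]]; rewrite inE; apply/exists_inP; exists i => //.
  have lj'' : j' < (len2 i).+1 by [].
  by apply/existsP; exists (Ordinal lj''); rewrite /= !eqxx.
exists B; split.
- move=> x /cov1 [i [j [Ki ji ->]]]; case: j ji => [|j] ji.
    rewrite (_ : B _ = [set y | [exists j : 'I_(d i).+1, y == q2 i j]]).
      apply: conn_chain => // j jd; apply: jda2 => //; last by constructor 1.
        by rewrite /d in jd; lia.
      by rewrite /d in jd; lia.
    apply/setP => y; rewrite [RHS]inE; apply/idP/existsP.
      case/(BP _ _ _ Ki ji) => j [lj j0 ->].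
      have jd : j < (d i).+1 by lia.
      by exists (Ordinal jd).
    case=> j /eqP ->; apply/(BP _ _ _ Ki ji); exists j; split=> //.
      by have := ltn_ord j; rewrite /d; lia.
    by have := ltn_ord j; lia.
  rewrite (_ : B _ = [set q2 i (j.+1 + d i)]); first exact: conn1.
  apply/setP => y; apply/idP/set1P.
    case/(BP _ _ _ Ki ji) => j' [lj j0 ->].
    by congr q2; lia.
  by move->; apply/(BP _ _ _ Ki ji); exists (j.+1 + d i); rewrite addnK ldE.
- move=> x /cov1 [i [j [Ki ji ->]]]; apply/subsetP => y.
  by case/(BP _ _ _ Ki ji) => j' [lj _ ->]; apply: in2.
- move=> x x' /cov1 [i [j [Ki ji ->]]] /cov1 [i' [j' [Ki' ji' ->]]] nxx.
  apply/disjointP => y /(BP _ _ _ Ki ji) [k [lk Ek ->]] /(BP _ _ _ Ki' ji') [k' [lk' Ek' E1]].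
  have [ii kk] := inj2 _ _ _ _ Ki Ki' lk lk' E1.
  by case/eqP: nxx; rewrite -Ek -Ek' ii kk.
move=> x x' /cov1 [i [j [Ki ji ->]]] /cov1 [i' [j' [Ki' ji' ->]]] _.
have rep a b : a \in K -> b <= len1 a -> q2 a (b + d a) \in B (q1 a b).
  by move=> Ka lb; apply/BP => //; exists (b + d a); rewrite addnK ldE.
have rep0 a : a \in K -> q2 a 0 \in B (q1 a 0).
  by move=> Ka; apply/BP => //; exists 0.
have lnk a b a' b' : a \in K -> a' \in K -> b <= len1 a -> b' <= len1 a' ->
    code_adj len1 a b a' b' -> link e2 (B (q1 a b)) (B (q1 a' b')).
  move=> Ka Ka' lb lb' [[Ea Eb]|[ar Eb Eb' Ea]|[Eb Eb' EE]].
  - exists (q2 a (b + d a)), (q2 a' (b' + d a')); rewrite !rep //; split=> //.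
    by subst a' b'; apply: jda2; rewrite ?ldE //; constructor 1.
  - exists (q2 a (b + d a)), (q2 a' 0); rewrite rep // Eb' rep0 //; split=> //.
    apply: jda2; rewrite ?ldE //; constructor 2; split=> //.
    by rewrite Eb /d; have := le a; lia.
  exists (q2 a 0), (q2 a' 0); rewrite Eb Eb' !rep0 //; split=> //.
  by apply: jda2 => //; constructor 3.
case/(adj1 _ _ _ _ Ki Ki' ji ji') => /lnk; first by apply.
case=> // y [z [By Bz yz]]; exists z, y; split=> //; by rewrite es2.
Qed.

End Codes.

(** * Connected graphs without large star minors are subdivided small graphs *)

Lemma card_bigcup_le (I T : finType) (A : {set I}) (F : I -> {set T}) k :
  (forall i, i \in A -> #|F i| <= k) -> #|\bigcup_(i in A) F i| <= #|A| * k.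
Proof.
move=> le; rewrite -sum_nat_const.
apply: (@leq_trans (\sum_(i in A) #|F i|)); last exact: leq_sum.
elim/big_rec2: _ => [|i y X _ IH]; first by rewrite cards0.
by rewrite cardsU; apply: leq_trans (leq_subr _ _) _; rewrite leq_add2l.
Qed.

Section Tree.
Variables (d : nat) (T : finType) (e : rel T) (S : {set T}) (r : T).
Hypotheses (es : symmetric e) (ei : irreflexive e).
Hypotheses (cS : conn e S) (sf : starfree d e S) (Sr : r \in S).

Lemma exists_levels : exists lv : T -> nat, [/\ lv r = 0,
  forall x, x \in S -> x != r -> exists y, [/\ y \in S, e x y & lv x = (lv y).+1] &
  forall x y, x \in S -> y \in S -> e x y -> lv y <= (lv x).+1].
Proof.
pose reach := fix reach n x := if n is n'.+1
  then exists y, [/\ reach n' y, y \in S, x \in S & e x y] else x = r.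
have rS n x : reach n x -> x \in S by case: n => [->|n] //= [y []].
have ex x : x \in S -> exists n, `[< reach n x >].
  case: cS => _ conS; have /subsetP h : S \subset [set x | `[< exists n, reach n x >]].
    apply: conS; first by exists r; rewrite // inE; apply/asboolP; exists 0.
    move=> u v Su Sv uv; rewrite !inE => /asboolP [n rn]; apply/asboolP.
    by exists n.+1, u; split=> //; rewrite es.
  by move=> /h; rewrite inE => /asboolP [n rn]; exists n; apply/asboolP.
have /choice [lv lvP] : forall x, exists n, x \in S ->
    reach n x /\ forall m, reach m x -> n <= m.
  move=> x; case: (boolP (x \in S)) => [Sx|_]; last by exists 0.
  case: (ex_minnP (ex x Sx)) => n /asboolP rn mn; exists n => _; split=> // m rm.
  by apply: mn; apply/asboolP.
exists lv; split.
- by apply/eqP; rewrite -leqn0; apply: (lvP r Sr).2.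
- move=> x Sx xr; have [rx mx] := lvP x Sx.
  case E: (lv x) rx => [|n] /=; first by move=> xr'; rewrite xr' eqxx in xr.
  move=> [y [ry Sy _ xy]]; exists y; split=> //; have [ry' my] := lvP y Sy.
  apply/eqP; rewrite eqn_leq -{1}E ltnS my // andbT.
  by apply: mx; exists y.
move=> x y Sx Sy xy; apply: (lvP y Sy).2; exists x; split=> //; last by rewrite es.
by case: (lvP x Sx).
Qed.

Section Parent.
Variables (pa : T -> T) (w : T -> nat).
Hypothesis paP : forall x, x \in S -> x != r ->
  [/\ pa x \in S, e x (pa x) & w (pa x) < w x].

Definition children x := [set y in S :\ r | pa y == x].
Definition leaves := [set x in S :\ r | children x == set0].

(** Every vertex reaches [r] by iterating [pa], along which [w] decreases. *)
Lemma conn_up_closed (X : {set T}) : X \subset S -> r \in X ->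
  (forall x, x \in X -> x != r -> pa x \in X) -> conn e X.
Proof.
move=> /subsetP XS Xr up; split; first by exists r.
move=> A [x0 Xx0 Ax0] clA; have Ar : r \in A.
  have [n] := ubnP (w x0); elim: n x0 Xx0 Ax0 => // n IH x Xx Ax lt.
  case: (eqVneq x r) => [<- //|xr]; have [Sp xp lw] := paP (XS x Xx) xr.
  by apply: (IH (pa x)); [apply: up | apply: (clA x) => //; apply: up | apply: leq_trans lw _].
apply/subsetP => x; have [n] := ubnP (w x); elim: n x => // n IH x lt Xx.
case: (eqVneq x r) => [-> //|xr]; have [Sp xp lw] := paP (XS x Xx) xr.
have Xp := up x Xx xr; apply: (clA (pa x)) => //; first by rewrite es.
by apply: IH => //; apply: leq_trans lw _.
Qed.

(** The vertices that are not leaves form a connected set, and each leaf is a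
    neighbour of it. *)
Lemma card_leaves : #|leaves| < d.
Proof.
have h (x : T) : x \in S -> x != r -> pa x \notin leaves.
  move=> Sx xr; rewrite inE negb_and; apply/orP; right; apply/set0Pn; exists x.
  by rewrite !inE xr Sx eqxx.
have rl : r \notin leaves by rewrite !inE eqxx.
apply: leq_ltn_trans (sf (X := S :\: leaves) _ _); last 2 first.
- exact: subsetDl.
- apply: conn_up_closed; [exact: subsetDl | by rewrite inE rl |].
  by move=> x /setDP [Sx _] xr; rewrite inE h //; case: (paP Sx xr).
apply/subset_leq_card/subsetP => x lx; have := lx; rewrite inE => /andP [/setD1P [xr Sx] _].
have [Sp xp _] := paP Sx xr; apply/nbrsP; split=> //; first by rewrite inE lx.
by exists (pa x); [rewrite inE h | rewrite es].
Qed.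

Lemma sum_children : \sum_(x in S) #|children x| + 1 = #|S|.
Proof.
rewrite (cardsD1 r S) Sr addnC; congr (_ + _); rewrite -[RHS]sum1_card.
rewrite [RHS](partition_big pa (mem S)) /=.
  by apply: eq_bigr => x Sx; rewrite -sum1_card; apply: eq_bigl => y; rewrite inE.
by move=> x /setD1P [xr Sx]; case: (paP Sx xr).
Qed.

Definition branching := [set x in S | 1 < #|children x|].

(** The numbers of children add up to one less than the number of vertices. *)
Lemma card_branching : #|branching| <= #|leaves|.
Proof.
have le : \sum_(x in S) (1 + (x \in branching)) <=
    \sum_(x in S) (#|children x| + (#|children x| == 0)).
  by apply: leq_sum => x Sx; rewrite inE Sx /=; case: #|_| => [|[|k]].
rewrite !big_split /= sum1_card in le.
have E1 : \sum_(x in S) (x \in branching) = #|branching|.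
  rewrite -sum1_card [LHS](eq_bigr (fun x => if x \in branching then 1 else 0)).
    by rewrite -big_mkcondr /=; apply: eq_bigl => x; rewrite !inE; case: (x \in S).
  by move=> x _; case: (_ \in branching).
have E2 : \sum_(x in S) (#|children x| == 0) <= #|leaves| + 1.
  have -> : \sum_(x in S) (#|children x| == 0) =
      \sum_(x in S) (if #|children x| == 0 then 1 else 0).
    by apply: eq_bigr => x _; case: eqP.
  rewrite -big_mkcondr /= sum1dep_card addn1 -(_ : #|r |: leaves| = _.+1); last first.
    by rewrite cardsU1 !inE eqxx.
  apply/subset_leq_card/subsetP => x; rewrite !inE cards_eq0 => /andP [Sx ->].
  by rewrite Sx; case: (x == r).
have := sum_children; lia.
Qed.

End Parent.

Variable lv : T -> nat.
Hypothesis lvr : lv r = 0.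
Variable pa : T -> T.
Hypothesis paP : forall x, x \in S -> x != r ->
  [/\ pa x \in S, e x (pa x) & lv x = (lv (pa x)).+1].
Hypothesis lvP : forall x y, x \in S -> y \in S -> e x y -> lv y <= (lv x).+1.

Let paP' x : x \in S -> x != r -> [/\ pa x \in S, e x (pa x) & lv (pa x) < lv x].
Proof. by move=> Sx xr; have [? ? ->] := paP Sx xr. Qed.

(** The levels below a given one form a connected set. *)
Lemma card_level i : #|[set x in S | lv x == i]| <= d.
Proof.
case: i => [|i].
  rewrite (_ : [set x in S | _] = [set r]).
    rewrite cards1; apply: leq_trans (card_leaves paP'); by [].
  apply/setP => x; rewrite !inE; apply/andP/eqP => [[Sx /eqP lx]|->]; last by rewrite Sr lvr.
  by apply: contrapT => /eqP xr; have [_ _] := paP Sx xr; rewrite lx.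
apply: ltnW; apply: leq_ltn_trans (sf (X := [set x in S | lv x <= i]) _ _).
- apply/subset_leq_card/subsetP => x; rewrite inE => /andP [Sx /eqP lx].
  have xr : x != r by apply: contra_eqN lx => /eqP->; rewrite lvr.
  have [Sp xp lp] := paP Sx xr; apply/nbrsP; split=> //; first by rewrite inE lx ltnn andbF.
  exists (pa x); last by rewrite es.
  by rewrite inE Sp /=; move: lp; rewrite lx => -[->].
- by apply/subsetP => x; rewrite inE => /andP [].
apply: (conn_up_closed paP'); first by apply/subsetP => x; rewrite inE => /andP [].
  by rewrite inE Sr lvr.
move=> x; rewrite !inE => /andP [Sx lx] xr; have [-> _ lp] := paP Sx xr.
by apply: leq_trans lx; rewrite lp.
Qed.

Lemma card_nbr x : x \in S -> #|[set y in S | e x y]| <= d.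
Proof.
move=> Sx; apply: ltnW; apply: leq_ltn_trans (sf (X := [set x]) _ _); last 2 first.
- by rewrite sub1set.
- exact: conn1.
apply/subset_leq_card/subsetP => y; rewrite inE => /andP [Sy xy]; apply/nbrsP; split=> //.
  by rewrite inE; apply/negP => /eqP E; rewrite E ei in xy.
by exists x; rewrite ?inE.
Qed.

Lemma level0 x : x \in S -> lv x = 0 -> x = r.
Proof.
by move=> Sx lx; apply: contrapT => /eqP xr; have [_ _] := paP Sx xr; rewrite lx.
Qed.

(** Apart from the edges to parents, every edge has an endpoint in [multi],
    namely one that is not on the lower of the two levels. *)
Definition multi := [set x in S :\ r |
  [exists y in S, [&& y != pa x, e x y & lv y <= lv x]]].

Lemma rank_lt (m n : nat) (b c : bool) : m < n \/ m = n /\ b < c -> m.*2 + b < n.*2 + c.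
Proof. by case: b; case: c; lia. Qed.

(** Each [x] of [multi] can be hung from another neighbour, which turns the
    parent of [x] into a leaf when [x] was its only child. If this is done for
    one vertex on each level of a given parity, the changes do not interfere,
    so the number of leaves bounds the number of levels. *)
Lemma card_multi_nonbranching b :
  #|[set x in multi | (pa x \notin branching pa) && (odd (lv x) == b)]| <= d * d.
Proof.
set M := [set x in multi | _].
pose rep x := [pick y in M | lv y == lv x].
pose C := [set x in M | rep x == Some x].
have MP x : x \in M -> [/\ x \in S, x != r, pa x \notin branching pa, odd (lv x) = b &
    exists y, [/\ y \in S, y != pa x, e x y & lv y <= lv x]].
  rewrite !inE => /andP [/andP [/andP [-> ->] /exists_inP [y Sy /and3P [? ? ?]]]].
  by move=> /andP [-> /eqP ->]; split=> //; exists y.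
have CM x : x \in C -> x \in M by rewrite inE => /andP [].
have Cinj x y : x \in C -> y \in C -> lv x = lv y -> x = y.
  rewrite !inE => /andP [_ /eqP rx] /andP [_ /eqP ry] lxy.
  by move: rx; rewrite /rep lxy -/(rep y) ry => -[].
have MC : M \subset \bigcup_(c in C) [set x in S | lv x == lv c].
  apply/subsetP => x Mx; rewrite /C.
  have [c [Mc /eqP lc Ec]] : exists c, [/\ c \in M, lv c == lv x & rep x = Some c].
    by rewrite /rep; case: pickP => [c /andP [Mc lc]|/(_ x)]; [exists c | rewrite Mx eqxx].
  apply/bigcupP; exists c; last by rewrite inE lc eqxx andbT; case: (MP x Mx).
  by rewrite inE Mc /= /rep lc -/(rep x) Ec.
have /choice [alt altP] : forall x, exists y, x \in M ->
    [/\ y \in S, y != pa x, e x y & lv y <= lv x].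
  move=> x; case: (boolP (x \in M)) => [/MP [_ _ _ _ [y ?]]|_]; last by exists x.
  by exists y.
pose pb x := if x \in C then alt x else pa x.
have pbP x : x \in S -> x != r -> [/\ pb x \in S, e x (pb x) &
    (lv (pb x)).*2 + (pb x \in C) < (lv x).*2 + (x \in C)].
  move=> Sx xr; rewrite /pb; case: (boolP (x \in C)) => Cx; last first.
    by have [-> -> ->] := paP Sx xr; split=> //; apply: rank_lt; left.
  have [Sy ny xy ly] := altP x (CM x Cx); split=> //.
  apply: rank_lt; move: ly; rewrite leq_eqVlt => /predU1P [lyx|]; [right|by left].
  split=> //; case: (boolP (_ \in C)) => // Cy.
  by have E := Cinj _ _ Cy Cx lyx; rewrite E ei in xy.
have leaf x : x \in C -> pa x \in r |: leaves pb.
  move=> Cx; have [Sx xr nb odx _] := MP x (CM x Cx); have [Sp xp lp] := paP Sx xr.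
  rewrite !inE; case: (eqVneq (pa x) r) => //= pr; rewrite Sp /=.
  apply/eqP/setP => y; rewrite inE in_set0; apply/negP => /andP [/setD1P [yr Sy]].
  have only : y != x -> pa y != pa x.
    move=> yx; apply: contra nb => /eqP pyx; rewrite inE Sp /=.
    apply: (@leq_trans #|[set x; y]|); first by rewrite cards2 eq_sym yx.
    by apply/subset_leq_card/subsetP => z /set2P [->|->]; rewrite !inE ?xr ?Sx ?yr ?Sy ?pyx eqxx.
  rewrite /pb; case: (boolP (y \in C)) => Cy; last first.
    by apply/negP/only; apply: contraNneq Cy => ->.
  have [_ _ _ ody _] := MP y (CM y Cy); have [_ nay yay lay] := altP y (CM y Cy).
  move/eqP=> E; rewrite E in nay yay lay.
  have lypx : lv y <= (lv (pa x)).+1 by apply: lvP => //; rewrite es.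
  case: (eqVneq y x) => [yx|yx]; first by rewrite yx eqxx in nay.
  have lyx : lv y = lv x.
    rewrite lp; apply/eqP; rewrite eqn_leq lypx ltn_neqAle lay andbT.
    by apply/negP => /eqP El; move: odx; rewrite lp /= El ody; case: (b).
  by rewrite (Cinj _ _ Cy Cx lyx) eqxx in yx.
have cC : #|C| <= d.
  have <- : #|pa @: C| = #|C|.
    apply: card_in_imset => x y Cx Cy E; apply: Cinj => //.
    have [Sx xr _ _ _] := MP x (CM x Cx); have [Sy yr _ _ _] := MP y (CM y Cy).
    by have [_ _ ->] := paP Sx xr; have [_ _ ->] := paP Sy yr; rewrite E.
  apply: (@leq_trans #|r |: leaves pb|).
    by apply/subset_leq_card/subsetP => _ /imsetP [x Cx ->]; apply: leaf.
  by rewrite cardsU1; apply: leq_trans (card_leaves pbP); rewrite -add1n leq_add2r leq_b1.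
apply: leq_trans (subset_leq_card MC) _; apply: leq_trans (card_bigcup_le _) _.
  by move=> c _; apply: card_level.
by rewrite leq_mul2r cC orbT.
Qed.

Lemma card_multi : #|multi| <= 3 * (d * d).
Proof.
pose F b := [set x in multi | (pa x \notin branching pa) && (odd (lv x) == b)].
have sub : multi \subset (F true :|: F false) :|:
    \bigcup_(c in branching pa) [set y in S | e c y].
  apply/subsetP => x Mx; rewrite !in_setU ![x \in F _]inE Mx /=.
  have := Mx; rewrite inE => /andP [/setD1P [xr Sx] _].
  case: (boolP (pa x \in _)) => Bp /=; last by case: (odd _).
  apply/bigcupP; exists (pa x) => //; rewrite inE Sx.
  by have [_ xp _] := paP Sx xr; rewrite es.
apply: leq_trans (subset_leq_card sub) _.
have h1 := card_multi_nonbranching true; have h2 := card_multi_nonbranching false.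
have h3 : #|\bigcup_(c in branching pa) [set y in S | e c y]| <= d * d.
  apply: leq_trans (card_bigcup_le _) _ => [c|].
    by rewrite inE => /andP [Sc _]; apply: card_nbr.
  rewrite leq_mul2r; apply/orP; right; apply: leq_trans (card_branching paP') _.
  exact/ltnW/(card_leaves paP').
apply: leq_trans (leq_card_setU _ _).1 _; apply: leq_trans (leq_add (leq_card_setU _ _).1 h3) _.
by rewrite !mulSn mul0n addn0 addnA !leq_add.
Qed.

(** Outside this set, a vertex has one child, one parent, and no other
    neighbour. *)
Definition kernel := [set r] :|: branching pa :|: leaves pa :|: multi :|:
  \bigcup_(m in multi) [set y in S | e m y].

Lemma card_kernel : #|kernel| <= 1 + d + d + 3 * (d * d) + 3 * (d * d) * d.
Proof.
have hl := card_leaves paP'; have hb := card_branching paP'; have hm := card_multi.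
have hn : #|\bigcup_(m in multi) [set y in S | e m y]| <= 3 * (d * d) * d.
  apply: leq_trans (card_bigcup_le (k := d) _) _ => [m|].
    by rewrite inE => /andP [/setD1P [_ Sm] _]; apply: card_nbr.
  by rewrite leq_mul2r hm orbT.
have cU (A B : {set T}) a b : #|A| <= a -> #|B| <= b -> #|A :|: B| <= a + b.
  by move=> la lb; apply: leq_trans (leq_card_setU A B) (leq_add la lb).
do 3! [apply: (cU) => //]; first by apply: (cU); [rewrite cards1 | exact: leq_trans hb (ltnW hl)].
exact: ltnW.
Qed.

Lemma kernel_edge x y : x \in S -> y \in S -> e x y -> lv y <= lv x -> y != pa x ->
  x \in kernel /\ y \in kernel.
Proof.
move=> Sx Sy xy lyx nyp; have Mx : x \in multi.
  rewrite !inE Sx andbT; apply/andP; split; last by apply/exists_inP; exists y => //; apply/and3P.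
  apply: contraTneq xy => xr; rewrite xr lvr leqn0 in lyx.
  by rewrite (level0 Sy (eqP lyx)) xr ei.
split; first by rewrite !in_setU Mx !orbT.
rewrite in_setU; apply/orP; right; apply/bigcupP; exists x => //.
by rewrite inE Sy xy.
Qed.

Lemma kernel_sub : kernel \subset S.
Proof.
rewrite !subUset sub1set Sr -!andbA /=; apply/and4P; split.
- by apply/subsetP => x; rewrite inE => /andP [].
- by apply/subsetP => x; rewrite inE => /andP [/setD1P []].
- by apply/subsetP => x; rewrite inE => /andP [/setD1P []].
by apply/bigcupsP => m _; apply/subsetP => x; rewrite inE => /andP [].
Qed.

End Tree.

(** * Star-free graphs are well-quasi-ordered by the minor relation *)

Section CodeExists.
Variables (d : nat) (T : finType) (e : rel T) (S : {set T}) (r : T).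
Hypotheses (es : symmetric e) (ei : irreflexive e).
Hypotheses (cS : conn e S) (sf : starfree d e S) (Sr : r \in S).

Definition kernel_bound := 1 + d + d + 3 * (d * d) + 3 * (d * d) * d.

(** Outside the kernel every vertex has exactly one child and no edge besides
    those to its child and its parent; going up from a kernel vertex to the
    first kernel vertex above it cuts the graph into paths. *)
Lemma code_exists : exists (c : code kernel_bound.+1) len q, coded c len e S q.
Proof.
have [lv [lvr lvpa lvP]] := exists_levels es cS Sr.
have /choice [pa0 pa0P] : forall x, exists y, x \in S -> x != r ->
    [/\ y \in S, e x y & lv x = (lv y).+1].
  move=> x; case: (boolP (x \in S)) => Sx; last by exists x.
  case: (eqVneq x r) => xr; first by exists x.
  by have [y yP] := lvpa x Sx xr; exists y.
pose pa x := if x == r then r else pa0 x.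
have paP x : x \in S -> x != r -> [/\ pa x \in S, e x (pa x) & lv x = (lv (pa x)).+1].
  by move=> Sx xr; rewrite /pa (negbTE xr); apply: pa0P.
have par : pa r = r by rewrite /pa eqxx.
have paS x : x \in S -> pa x \in S.
  by move=> Sx; case: (eqVneq x r) => [->|xr]; [rewrite par | case: (paP x Sx xr)].
pose B := kernel e S r lv pa.
have cB : #|B| <= kernel_bound := card_kernel es ei sf Sr lvr paP lvP.
have BS : B \subset S := kernel_sub e Sr lv pa.
have Br : r \in B by rewrite /B /kernel !inE eqxx.
have nB x : x \in S -> x \notin B ->
    #|children S r pa x| <= 1 /\ exists2 y, y \in S :\ r & pa y = x.
  move=> Sx; rewrite /B /kernel !in_setU !negb_or => /andP [/andP [/andP [/andP [xr nb] nl] _] _].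
  split; first by move: nb; rewrite inE Sx -leqNgt.
  move: nl; rewrite inE !inE Sx; rewrite in_set1 in xr; rewrite xr /= => /set0Pn [y].
  by rewrite inE => /andP [Sy /eqP]; exists y.
have inch y x : y \in S -> y != r -> pa y = x -> y \in children S r pa x.
  by move=> Sy yr <-; rewrite inE in_setD1 yr Sy eqxx.
have iterS j x : x \in S -> iter j pa x \in S by move=> Sx; elim: j => //= j; apply: paS.
have iter_r x : x \in S -> iter (lv x) pa x = r.
  move=> Sx; move E : (lv x) => n; elim: n x Sx E => [|n IH] x Sx E.
    exact: (level0 paP).
  have xr : x != r by apply: contra_eqN E => /eqP ->; rewrite lvr.
  have [Sp _ lp] := paP x Sx xr; rewrite iterSr IH //.
  by move: lp; rewrite E => -[].
have /choice [m mP] : forall b, exists m, b \in B ->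
    [/\ 0 < m, iter m pa b \in B & forall j, 0 < j -> j < m -> iter j pa b \notin B].
  move=> b; case: (boolP (b \in B)) => [Bb|_]; last by exists 0.
  have ex : exists j, (0 < j) && (iter j pa b \in B).
    by exists (lv b).+1; rewrite /= iter_r ?par // (subsetP BS).
  case: (ex_minnP ex) => n /andP [n0 Bn] mn; exists n => _; split=> // j j0 jn.
  by apply: contraL jn => Bj; rewrite -leqNgt; apply: mn; rewrite j0.
pose c0 (i : 'I_kernel_bound.+1) := nth r (enum B) i.
pose idx b : 'I_kernel_bound.+1 := inord (index b (enum B)).
have idxE b : b \in B -> idx b = index b (enum B) :> nat.
  move=> Bb; rewrite /idx inordK // ltnS; apply: leq_trans cB.
  by rewrite cardE; apply: index_size.
have c0K b : b \in B -> c0 (idx b) = b.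
  by move=> Bb; rewrite /c0 idxE // nth_index ?mem_enum.
pose K := [set i : 'I_kernel_bound.+1 | i < #|B|].
have idxK b : b \in B -> idx b \in K.
  by move=> Bb; rewrite inE idxE // cardE index_mem mem_enum.
have c0B i : i \in K -> c0 i \in B by rewrite inE cardE => lt; rewrite -mem_enum mem_nth.
have c0I i j : i \in K -> j \in K -> c0 i = c0 j -> i = j.
  rewrite !inE cardE => li lj /eqP; rewrite nth_uniq ?enum_uniq //.
  by move/eqP/val_inj.
pose len i := (m (c0 i)).-1.
pose q i j := iter j pa (c0 i).
pose t := [ffun i => idx (iter (m (c0 i)) pa (c0 i))].
pose E := [ffun ij : 'I_kernel_bound.+1 * 'I_kernel_bound.+1 => (e (c0 ij.1) (c0 ij.2) : bool)].
have inS i j : i \in K -> q i j \in S by move=> Ki; apply/iterS/(subsetP BS)/c0B.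
have mlen i : i \in K -> m (c0 i) = (len i).+1.
  by move=> /c0B /mP [m0 _ _]; rewrite /len prednK.
have qB i j : i \in K -> 0 < j -> j <= len i -> q i j \notin B.
  by move=> Ki j0 jl; have [_ _] := mP _ (c0B i Ki); apply; rewrite ?mlen.
have qt i : i \in K -> pa (q i (len i)) = q (t i) 0 /\ t i \in K.
  move=> Ki; have [_ Bm _] := mP _ (c0B i Ki).
  have tE : t i = idx (iter (m (c0 i)) pa (c0 i)) by rewrite ffunE.
  split; last by rewrite tE; apply: idxK.
  by rewrite tE /q [iter 0 _ _]/= c0K // mlen.
have qr i j : i \in K -> j <= len i -> q i j = r -> j = 0 /\ i = idx r.
  move=> Ki jl Eq; have j0 : j = 0.
    by case: j jl Eq => // j jl Eq; have := qB i j.+1 Ki isT jl; rewrite Eq Br.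
  by split=> //; apply: c0I; rewrite ?idxK // c0K // -Eq j0.
have len_r : len (idx r) = 0.
  apply/eqP; rewrite -leqn0 leqNgt; apply/negP => l0.
  by have := qB (idx r) 1 (idxK r Br) isT l0; rewrite /q /= c0K // par Br.
have qnr i j : i \in K -> j < len i -> q i j != r.
  move=> Ki jl; apply/eqP => Eq; have [_ Ei] := qr i j Ki (ltnW jl) Eq.
  by rewrite Ei len_r in jl.
have qI i j i' j' : i \in K -> i' \in K -> j <= len i -> j' <= len i' ->
    q i j = q i' j' -> i = i' /\ j = j'.
  move=> Ki Ki'; elim: j j' => [|j IH] [|j'] jl jl' Eq.
  - by split=> //; apply: c0I.
  - by have := qB i' j'.+1 Ki' isT jl'; rewrite -Eq (c0B i Ki).
  - by have := qB i j.+1 Ki isT jl; rewrite Eq (c0B i' Ki').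
  have nBq := qB i j.+1 Ki isT jl.
  have [/card_le1_eqP one _] := nB _ (inS i j.+1 Ki) nBq.
  have Eq' : q i j = q i' j'.
    by apply: one; apply: inch; rewrite ?qnr ?inS //; apply: esym.
  by have [-> ->] := IH j' (ltnW jl) (ltnW jl') Eq'.
have cov x : x \in S -> exists i j, [/\ i \in K, j <= len i & x = q i j].
  pose M := \max_(y in S) lv y.
  have [n] := ubnP (M - lv x); elim: n x => // n IH x lt Sx.
  case: (boolP (x \in B)) => [Bx|nBx].
    by exists (idx x), 0; rewrite idxK // /q /= c0K.
  have [_ [y /setD1P [yr Sy] pyx]] := nB x Sx nBx.
  have [_ _ ly] := paP y Sy yr; rewrite pyx in ly.
  have lM : lv y <= M by rewrite /M; apply: leq_bigmax_cond.
  have [||i [j [Ki jl Ey]]] := IH y => //.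
    by move: lt lM; rewrite ly; clear; lia.
  exists i, j.+1; split=> //; last by rewrite /q /= -/(q i j) -Ey.
  rewrite ltn_neqAle jl andbT; apply: contraNneq nBx => jE.
  by rewrite -pyx Ey jE (qt i Ki).1 /q /= c0B // (qt i Ki).2.
exists (K, idx r, E, t), len, q; split=> //.
- by move=> i j Ki _; apply: inS.
- have half i j i' j' : i \in K -> i' \in K -> j <= len i -> j' <= len i' ->
      e (q i j) (q i' j') -> lv (q i' j') <= lv (q i j) ->
      code_adj (K, idx r, E, t) len i j i' j'.
    move=> Ki Ki' jl jl' ee ll.
    have [Sx Sy] := (inS i j Ki, inS i' j' Ki').
    case: (eqVneq (q i' j') (pa (q i j))) => [Ep|np].
      move: jl; rewrite leq_eqVlt => /predU1P [jE|jl].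
        rewrite jE (qt i Ki).1 in Ep.
        have [-> ->] := qI _ _ _ _ Ki' (qt i Ki).2 jl' (leq0n _) Ep.
        constructor 2; split=> //=; apply: contraTneq ee => Ei.
        have jz : j = 0 by rewrite jE Ei len_r.
        have xr : q i j = r by rewrite jz /q /= Ei c0K.
        move: ll; rewrite xr lvr leqn0 => /eqP /(level0 paP Sy) ->.
        by rewrite ei.
      have [-> ->] := qI i' j' i j.+1 Ki' Ki jl' jl Ep.
      by constructor 1.
    have [Bx By] := kernel_edge ei lvr paP Sx Sy ee ll np.
    have z a b : a \in K -> b <= len a -> q a b \in B -> b = 0.
      by move=> Ka lb Bq; case: b lb Bq => // b lb; rewrite (negbTE (qB a b.+1 Ka isT lb)).
    have jz := z i j Ki jl Bx; have jz' := z i' j' Ki' jl' By.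
    by constructor 3; split=> //=; rewrite ffunE /=; move: ee; rewrite jz jz'.
  move=> i j i' j' Ki Ki' jl jl' ee; case: (leqP (lv (q i' j')) (lv (q i j))) => ll.
    by left; apply: half.
  by right; apply: half => //; [rewrite es | apply: ltnW].
move=> i j i' j' Ki Ki' jl jl' [[Ei Ej]|[/= nr Ej Ej' Ei]|[/= Ej Ej']].
- subst i' j'; have [_ + _] := paP _ (inS i j Ki) (qnr i j Ki jl').
  by [].
- rewrite Ej Ej' Ei -(qt i Ki).1.
  have nqr : q i (len i) != r.
    by apply: contra_neqN nr => /eqP Eq; have [_] := qr i (len i) Ki (leqnn _) Eq.
  by have [_] := paP _ (inS i (len i) Ki) nqr.
by rewrite ffunE Ej Ej'.
Qed.

End CodeExists.

(** The induced subgraph is kept implicit, so that removing a component changes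
    only the set of vertices. *)
Record gset := GSet { gset_graph : sgraph; gset_set : {set gset_graph} }.

Definition gle (a b : gset) :=
  mle (@edge (gset_graph a)) (gset_set a) (@edge (gset_graph b)) (gset_set b).

Definition gstarfree d (a : gset) := starfree d (@edge (gset_graph a)) (gset_set a).

(** There are finitely many codes, and for a fixed code the lengths of the
    paths are compared by Dickson's lemma. *)
Lemma asc_connected d (f : nat -> gset) :
  (forall i, conn (@edge (gset_graph (f i))) (gset_set (f i))) ->
  (forall i, gstarfree d (f i)) ->
  exists2 phi : nat -> nat, (forall i j, i < j -> phi i < phi j) &
    (forall i j, i < j -> gle (f (phi i)) (f (phi j))).
Proof.
move=> cf sf.
have /choice [cl clP] : forall i, exists cl : code (kernel_bound d).+1 * ('I_(kernel_bound d).+1 -> nat),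
    exists q, coded cl.1 cl.2 (@edge (gset_graph (f i))) (gset_set (f i)) q.
  move=> i; have [[r Sr] _] := cf i.
  have [c [len [q h]]] :=
    code_exists (@edge_sym _) (@edge_irrefl _) (cf i) (sf i) Sr.
  by exists (c, len), q.
have asc_cl := asc_and (asc_map fst (@asc_fin (code (kernel_bound d).+1)))
  (asc_map snd (@asc_ffun 'I_(kernel_bound d).+1)).
have [phi incr phiP] := asc_cl cl.
exists phi => // i j ij; have [Ec le] := phiP i j ij.
have [q1 h1] := clP (phi i); have [q2 h2] := clP (phi j).
rewrite -Ec in h2; exact: coded_mle (@edge_sym _) h1 h2 le.
Qed.

Lemma mle_setU (U : finType) (p : rel U) (S C : {set U})
    (T : finType) (e : rel T) (D E : {set T}) : symmetric p ->
  C \subset S -> (forall x y, x \in C -> y \in S :\: C -> ~~ p x y) -> E \subset D ->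
  mle p C e E -> mle p (S :\: C) e (D :\: E) -> mle p S e D.
Proof.
move=> ps /subsetP CS noe ED [B [cB sB dB lB]] [B' [cB' sB' dB' lB']].
have inD h : h \in S -> h \notin C -> h \in S :\: C by rewrite inE => -> ->.
have dBB h k : h \in C -> k \in S :\: C -> [disjoint B h & B' k].
  move=> Ch Sk; apply/disjointP => x /(subsetP (sB h Ch)) Ex /(subsetP (sB' k Sk)).
  by rewrite inE Ex.
exists (fun h => if h \in C then B h else B' h); split.
- by move=> h Sh; case: (boolP (h \in C)) => [/cB //|Ch]; apply/cB'/inD.
- move=> h Sh; case: (boolP (h \in C)) => [/sB s|Ch]; first exact: subset_trans s ED.
  by apply: subset_trans (sB' h (inD h Sh Ch)) (subsetDl _ _).
- move=> h k Sh Sk hk; case: (boolP (h \in C)) => Ch; case: (boolP (k \in C)) => Ck.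
  + exact: dB.
  + by apply: dBB => //; apply: inD.
  + by rewrite disjoint_sym; apply: dBB => //; apply: inD.
  + by apply: dB' => //; apply: inD.
move=> h k Sh Sk hk hpk; case: (boolP (h \in C)) => Ch; case: (boolP (k \in C)) => Ck.
- exact: lB.
- by have := noe h k Ch (inD k Sk Ck); rewrite hpk.
- by have := noe k h Ck (inD h Sh Ch); rewrite ps hpk.
- by apply: lB' => //; apply: inD.
Qed.

(** A largest connected subset has no edge to the rest. *)
Lemma exists_component (T : finType) (e : rel T) (S : {set T}) : symmetric e ->
  S != set0 -> exists C : {set T}, [/\ C \subset S, conn e C & forall x y, x \in C -> y \in S :\: C -> ~~ e x y].
Proof.
move=> es /set0Pn [x0 Sx0].
pose P (C : {set T}) := `[< C \subset S /\ conn e C >].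
have P0 : P [set x0] by apply/asboolP; rewrite sub1set; split=> //; apply: conn1.
have [C /asboolP [CS cC] mC] : exists2 C, P C & forall D, P D -> #|D| <= #|C|.
  by case: (arg_maxnP (fun C : {set T} => #|C|) P0) => C PC mC; exists C.
exists C; split=> // x y Cx /setDP [Sy nCy]; apply/negP => xy.
suff /mC : P (y |: C) by rewrite cardsU1 nCy add1n ltnn.
apply/asboolP; rewrite subUset sub1set Sy; split=> //.
apply: connU (conn1 e y) cC _ => //.
by exists y, x; rewrite inE eqxx es.
Qed.

(** The minimal bad sequence argument: the first components of a minimal bad
    sequence ascend along a subsequence, and the remainders, being smaller,
    cannot form a bad sequence. *)
Lemma starfree_wqo d (f : nat -> gset) : (forall i, gstarfree d (f i)) ->
  exists i j, i < j /\ gle (f i) (f j).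
Proof.
pose bad (g : nat -> gset) := (forall i, gstarfree d (g i)) /\
  forall i j, i < j -> ~ gle (g i) (g j).
move=> sf; apply: contrapT => nogood.
have badf : bad f.
  by split=> // i j ij le; apply: nogood; exists i, j.
pose sz (a : gset) := #|gset_set a|.
(* Among the bad sequences with the same first [p.1] terms, one with a
   smallest next term is chosen. *)
have min_step : forall p : nat * (nat -> gset), exists g', bad p.2 ->
    [/\ bad g', (forall i, i < p.1 -> g' i = p.2 i) &
     forall h, bad h -> (forall i, i < p.1 -> h i = p.2 i) -> sz (g' p.1) <= sz (h p.1)].
  move=> [n g] /=; case: (pselect (bad g)) => [bg|?]; last by exists g.
  pose Q s := `[< exists h, [/\ bad h, (forall i, i < n -> h i = g i) & sz (h n) = s] >].
  have ex : exists s, Q s by exists (sz (g n)); apply/asboolP; exists g.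
  case: (ex_minnP ex) => s /asboolP [h [bh hg <-]] mn; exists h => _; split=> // k bk kg.
  by apply: mn; apply/asboolP; exists k.
have [next nextP] := choice min_step.
pose F := fix F n := if n is n'.+1 then next (n', F n') else f.
have badF n : bad (F n) by elim: n => //= n IH; have [] := nextP (n, F n) IH.
have FE n k i : i < n -> F (n + k) i = F n i.
  move=> lt; elim: k => [|k IH]; first by rewrite addn0.
  rewrite addnS /= -IH; have [_ h _] := nextP (n + k, F (n + k)) (badF _).
  by apply: h => /=; apply: ltn_addr.
pose m n := F n.+1 n.
have mE n i : i < n -> F n i = m i.
  by move=> lt; rewrite -(subnKC lt) FE.
have badm i j : i < j -> ~ gle (m i) (m j).
  move=> ij; rewrite -(mE j.+1 i (ltnW _)) ?ltnS // /m.
  by have [_] := badF j.+1; apply.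
have sfm i : gstarfree d (m i) by have [h _] := badF i.+1; apply: h.
have m0 i : gset_set (m i) != set0.
  apply/negP => /eqP E0; apply: (badm i i.+1 (ltnSn i)).
  by exists (fun=> finset.set0); split=> h; rewrite E0 inE.
have compo i : {C : {set gset_graph (m i)} |
    [/\ C \subset gset_set (m i), conn (@edge _) C &
     forall x y, x \in C -> y \in gset_set (m i) :\: C -> ~~ (x -- y)]}.
  by apply: cid; apply: exists_component (@edge_sym _) (m0 i).
pose C i := sval (compo i); have CP i := svalP (compo i); rewrite -!/(C _) in CP.
pose Cm i := GSet (C i); pose Em i := GSet (gset_set (m i) :\: C i).
have sfE i : gstarfree d (Em i) by apply: starfree_sub (sfm i); apply: subsetDl.
have [phi incr phiP] : exists2 phi : nat -> nat, (forall i j, i < j -> phi i < phi j) &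
    (forall i j, i < j -> gle (Cm (phi i)) (Cm (phi j))).
  apply: (@asc_connected d) => i; first by case: (CP i).
  by apply: starfree_sub (sfm i); case: (CP i).
have lm i j : i < j -> gle (Em (phi i)) (Em (phi j)) -> False.
  move=> ij leE; apply: (badm (phi i) (phi j)); first exact: incr.
  have [C1 _ C2] := CP (phi i); have [C3 _ _] := CP (phi j).
  exact: mle_setU (@edge_sym _) C1 C2 C3 (phiP i j ij) leE.
have phi_ge i : phi 0 <= phi i by case: i => // i; apply/ltnW/incr.
(* The remainders, preceded by the first terms of the minimal sequence, form a
   bad sequence that agrees with it up to a smaller term. *)
pose n := phi 0; pose h i := if i < n then m i else Em (phi (i - n)).
have badh : bad h.
  split=> [i|i j ij]; first by rewrite /h; case: ifP.
  rewrite /h; case: ltnP => i_n; case: ltnP => j_n.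
  - exact: badm.
  - move=> le; apply: (badm i (phi (j - n))); first exact: leq_trans i_n (phi_ge _).
    by apply: mle_mono le => //; apply: subsetDl.
  - by have := leq_trans ij (leq_trans (ltnW j_n) i_n); rewrite ltnn.
  - by apply: lm; apply: ltn_sub2r => //; apply: leq_ltn_trans i_n ij.
have agree i : i < n -> h i = F n i by move=> lt; rewrite /h lt mE.
have [_ _ /(_ h badh agree)] := nextP (n, F n) (badF n).
rewrite /= -/(m n) /h ltnn subnn /sz /= leqNgt => /negP; apply.
apply: proper_card; apply/properP; split; first exact: subsetDl.
have [C1 [[x Cx] _] _] := CP n; exists x; first exact: (subsetP C1).
by rewrite inE Cx.
Qed.

(** Otherwise, one could choose successively members of [P] that are above no
    member of [P] of at most the sizes chosen before: a bad sequence. *)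
Lemma starfree_basis (P : gset -> Prop) d : exists t, forall a, P a -> gstarfree d a ->
  exists b, [/\ P b, #|gset_set b| <= t & gle b a].
Proof.
apply: contrapT => no.
have ex t : exists a, [/\ P a, gstarfree d a &
    forall b, P b -> #|gset_set b| <= t -> ~ gle b a].
  apply: contrapT => noa; apply: no; exists t => a Pa sfa.
  apply: contrapT => nob; apply: noa; exists a; split=> // b Pb bt ba.
  by apply: nob; exists b.
have [F FP] := choice ex.
pose t := fix t n := if n is n'.+1 then maxn (t n') #|gset_set (F (t n'))| else 0.
have tm i j : i <= j -> t i <= t j.
  elim: j => [|j IH]; first by rewrite leqn0 => /eqP->.
  rewrite leq_eqVlt => /predU1P [-> //|/IH le].
  exact: leq_trans le (leq_maxl _ _).
have [|i [j [ij le]]] := @starfree_wqo d (F \o t).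
  by move=> i; case: (FP (t i)).
have [_ _ nle] := FP (t j); have [Pi _ _] := FP (t i).
by apply: (nle _ Pi _ le); apply: leq_trans (tm _ _ ij); apply: leq_maxr.
Qed.

(** * The Perron vector of a graph *)

Local Open Scope ring_scope.

Section SymmetricForms.
Variables (R : realType) (n : nat).
Implicit Types (M A : 'M[R]_n) (u v w : 'rV[R]_n).

Definition bform M u v : R := (u *m M *m v^T) 0 0.
Definition dotv u v : R := (u *m v^T) 0 0.

Lemma bform_sum M u v : bform M u v = \sum_i \sum_j M i j * (u 0 i * v 0 j).
Proof.
rewrite /bform mxE exchange_big /=; apply: eq_bigr => j _.
rewrite !mxE mulr_suml; apply: eq_bigr => i _; rewrite mulrCA mulrA; congr (_ * _).
Qed.

Lemma dotv_sum u v : dotv u v = \sum_i u 0 i * v 0 i.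
Proof. by rewrite /dotv mxE; apply: eq_bigr => i _; rewrite mxE. Qed.

Lemma dotv_ge0 u : 0 <= dotv u u.
Proof. by rewrite dotv_sum sumr_ge0 // => i _; rewrite -expr2 sqr_ge0. Qed.

Lemma dotv_gt0 u : u != 0 -> 0 < dotv u u.
Proof.
move=> u0; rewrite lt_neqAle dotv_ge0 andbT eq_sym; apply: contraNneq u0 => E.
apply/eqP/rowP => i; rewrite mxE; apply/eqP; rewrite -sqrf_eq0 expr2.
have := E; rewrite dotv_sum => /eqP; rewrite psumr_eq0; last first.
  by move=> j _; rewrite -expr2 sqr_ge0.
by move/allP/(_ i (mem_index_enum _)).
Qed.

Lemma sqr_le_dotv u i : u 0 i ^+ 2 <= dotv u u.
Proof.
rewrite dotv_sum (bigD1 i) //= expr2 lerDl sumr_ge0 // => j _.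
by rewrite -expr2 sqr_ge0.
Qed.

Lemma bform_bound M u : bform M u u <= (\sum_i \sum_j `|M i j|) * dotv u u.
Proof.
rewrite bform_sum mulr_suml; apply: ler_sum => i _.
rewrite mulr_suml; apply: ler_sum => j _.
apply: le_trans (ler_norm _) _; rewrite normrM ler_wpM2l //.
have hi := sqr_le_dotv u i; have hj := sqr_le_dotv u j.
have := sqr_ge0 (u 0 i - u 0 j); have := sqr_ge0 (u 0 i + u 0 j).
by rewrite ler_norml; nra.
Qed.

Section PSD.
Variable M : 'M[R]_n.
Hypotheses (Ms : M^T = M) (Mp : forall u, 0 <= bform M u u).

Lemma bformC u v : bform M u v = bform M v u.
Proof.
rewrite /bform -[in RHS]Ms.
have -> : v *m M^T *m u^T = (u *m M *m v^T)^T by rewrite !trmx_mul trmxK mulmxA.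
by rewrite [RHS]mxE.
Qed.

Lemma bform_expand u v (t : R) :
  bform M (u + t *: v) (u + t *: v) =
  bform M u u + t * bform M u v *+ 2 + t ^+ 2 * bform M v v.
Proof.
have -> : bform M (u + t *: v) (u + t *: v) =
    bform M u u + t * bform M u v + t * bform M v u + t ^+ 2 * bform M v v.
  rewrite !bform_sum !mulr_sumr -!big_split /=; apply: eq_bigr => i _.
  rewrite !mulr_sumr -!big_split /=; apply: eq_bigr => j _; rewrite !mxE; ring.
by rewrite (bformC v u); ring.
Qed.

Lemma bform_cauchy u v : bform M u v ^+ 2 <= bform M u u * bform M v v.
Proof.
have h t : 0 <= bform M u u + t * bform M u v *+ 2 + t ^+ 2 * bform M v v.
  by rewrite -bform_expand.
have := Mp v; rewrite le0r => /predU1P [E|vp].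
  rewrite E mulr0; case: (eqVneq (bform M u v) 0) => [-> |nz]; first by rewrite expr0n.
  have := h (- (bform M u u + 1) / (bform M u v *+ 2)); rewrite E mulr0 addr0.
  have -> : - (bform M u u + 1) / (bform M u v *+ 2) * bform M u v *+ 2 = - (bform M u u + 1).
    by field; rewrite nz.
  by lra.
have := h (- bform M u v / bform M v v).
have -> : bform M u u + - bform M u v / bform M v v * bform M u v *+ 2 +
   (- bform M u v / bform M v v) ^+ 2 * bform M v v =
   (bform M u u * bform M v v - bform M u v ^+ 2) / bform M v v.
  by field; rewrite gt_eqF.
by rewrite pmulr_lge0 ?invr_gt0 // subr_ge0.
Qed.

End PSD.

(** The least [l] such that [l - A] is positive semidefinite is an eigenvalue:
    if [l - A] were invertible, the Cauchy-Schwarz inequality for its form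
    would bound the form from below by a positive multiple of [dotv]. *)
Lemma largest_eigenvalue A : (0 < n)%N -> A^T = A ->
  exists l, eigenvalue A l /\ forall u, bform A u u <= l * dotv u u.
Proof.
move=> n0 As; pose E := [set l : R | forall u, bform A u u <= l * dotv u u]%classic.
pose i0 : 'I_n := Ordinal n0.
pose d0 : 'rV[R]_n := delta_mx 0 i0.
have d0_gt0 : 0 < dotv d0 d0.
  apply/dotv_gt0/eqP => /rowP /(_ i0); rewrite !mxE !eqxx /=.
  by move/eqP; rewrite oner_eq0.
have lbE u : 0 < dotv u u -> lbound E (bform A u u / dotv u u).
  by move=> up l /(_ u); rewrite ler_pdivrMr.
have E0 : (E !=set0)%classic by exists (\sum_i \sum_j `|A i j|) => u; apply: bform_bound.
pose l := inf E.
have lP u : bform A u u <= l * dotv u u.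
  case: (eqVneq u 0) => [->|u0].
    by rewrite /bform /dotv !mul0mx !mxE mulr0.
  by rewrite -ler_pdivrMr ?dotv_gt0 //; apply: lb_le_inf => //; apply/lbE/dotv_gt0.
pose M := l%:M - A.
have Ms : M^T = M by rewrite /M linearB /= tr_scalar_mx As.
have ME u v : bform M u v = l * dotv u v - bform A u v.
  by rewrite /bform /dotv /M mulmxBr mulmxBl mul_mx_scalar -scalemxAl !mxE.
have Mp u : 0 <= bform M u u by rewrite ME subr_ge0.
exists l; split=> //.
have : M \notin unitmx.
  apply/negP => uM; pose N := invmx M; pose k := \sum_i \sum_j `|N^T i j| + 1.
  have k0 : 0 < k.
    by rewrite ltr_wpDl // sumr_ge0 // => i _; apply: sumr_ge0.
  suff : E (l - k^-1).
    move=> El; have := ge_inf (ex_intro _ _ (lbE d0 d0_gt0)) El.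
    by rewrite -/l; have := invr_gt0 k; rewrite k0; lra.
  move=> y; case: (eqVneq y 0) => [->|y0].
    by rewrite /bform /dotv !mul0mx !mxE mulr0.
  have yp := dotv_gt0 y0.
  have h := bform_cauchy Ms Mp (y *m N) y.
  have h1 : bform M (y *m N) y = dotv y y by rewrite /bform -(mulmxA y) mulVmx // mulmx1.
  have h2 : bform M (y *m N) (y *m N) <= k * dotv y y.
    have -> : bform M (y *m N) (y *m N) = bform N^T y y.
      by rewrite /bform -(mulmxA y N) mulVmx // mulmx1 trmx_mul mulmxA.
    apply: le_trans (bform_bound _ _) _; rewrite ler_wpM2r ?dotv_ge0 //.
    by rewrite lerDl.
  have h3 : dotv y y <= k * bform M y y.
    have : dotv y y * dotv y y <= k * dotv y y * bform M y y.
      by rewrite -expr2 -h1; apply: le_trans h _; rewrite h1 ler_wpM2r.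
    by rewrite mulrAC [in X in X -> _]mulrC ler_pM2r // mulrC.
  have : k^-1 * dotv y y <= bform M y y by rewrite mulrC ler_pdivrMr // mulrC.
  by rewrite ME; lra.
rewrite unitmxE unitfE negbK => /det0P [v v0 vM].
apply/eigenvalueP; exists v => //; apply/eqP; rewrite -subr_eq0 -oppr_eq0 opprB.
by rewrite -mul_mx_scalar -mulmxBr -/M vM.
Qed.

End SymmetricForms.

Definition qform (R : realType) (T : finType) (e : rel T) (y : T -> R) : R :=
  \sum_u \sum_v (e u v)%:R * (y u * y v).

Lemma sum_enum_val (R : realType) (G : finType) (F : G -> R) :
  \sum_(i < #|G|) F (enum_val i) = \sum_v F v.
Proof. by rewrite [RHS](big_enum_val (A := G)). Qed.

(** Taking absolute values does not decrease the form of a matrix with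
    nonnegative entries, so it turns an extremal vector into a nonnegative
    extremal vector, which is again an eigenvector. *)
Lemma perron (R : realType) (G : sgraph) : (0 < #|G|)%N -> exists x : G -> R,
  [/\ forall v, 0 <= x v <= 1, exists v, x v = 1,
      forall v, spectral_radius R G * x v = \sum_w (v -- w)%:R * x w &
      forall y : G -> R,
        qform (@edge G) y <= spectral_radius R G * \sum_v y v ^+ 2].
Proof.
move=> n0; pose A := adjacency R G.
have As : A^T = A by apply/matrixP => i j; rewrite !mxE edge_sym.
have [l [eigl lP]] := largest_eigenvalue n0 As.
have -> : spectral_radius R G = l.
  rewrite /spectral_radius; case: xgetP => [a _ [ea ua]|/(_ l) no].
    apply/eqP; rewrite eq_le; apply/andP; split; last exact: ua.
    have [v va v0] := eigenvalueP ea.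
    have := lP v; rewrite /bform -/A va -scalemxAl mxE.
    by rewrite -/(dotv v v) ler_pM2r ?dotv_gt0.
  case: no; split=> // a /eigenvalueP [v va v0].
  have := lP v; rewrite /bform -/A va -scalemxAl mxE.
  by rewrite -/(dotv v v) ler_pM2r ?dotv_gt0.
pose row (y : G -> R) : 'rV[R]_#|G| := \row_i y (enum_val i).
have rowA y : bform A (row y) (row y) = qform (@edge G) y.
  rewrite bform_sum /qform -(sum_enum_val (fun u => \sum_v (u -- v)%:R * (y u * y v))).
  apply: eq_bigr => i _; rewrite -(sum_enum_val (fun v => (_ -- v)%:R * (_ * y v))).
  by apply: eq_bigr => j _; rewrite !mxE.
have rowd y : dotv (row y) (row y) = \sum_v y v ^+ 2.
  rewrite dotv_sum -(sum_enum_val (fun v => y v ^+ 2)).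
  by apply: eq_bigr => j _; rewrite !mxE expr2.
have [v va v0] := eigenvalueP eigl.
pose M := l%:M - A.
have ME u w : bform M u w = l * dotv u w - bform A u w.
  by rewrite /bform /dotv /M mulmxBr mulmxBl mul_mx_scalar -scalemxAl !mxE.
have Ms : M^T = M by rewrite /M linearB /= tr_scalar_mx As.
have Mp u : 0 <= bform M u u by rewrite ME subr_ge0.
pose w : 'rV[R]_#|G| := \row_i `|v 0 i|.
have Mw : bform M w w = 0.
  apply/eqP; rewrite eq_le Mp andbT ME subr_le0.
  have -> : dotv w w = dotv v v.
    by rewrite !dotv_sum; apply: eq_bigr => i _; rewrite !mxE -!expr2 real_normK ?num_real.
  have -> : l * dotv v v = bform A v v by rewrite /bform -/A va -scalemxAl mxE.
  rewrite !bform_sum; apply: ler_sum => i _; apply: ler_sum => j _.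
  by rewrite !mxE -normrM ler_wpM2l ?ler0n // ler_norm.
have Mw0 u : bform M u w = 0.
  apply/eqP; rewrite -sqrf_eq0 eq_le sqr_ge0 andbT.
  by apply: le_trans (bform_cauchy Ms Mp u w) _; rewrite Mw mulr0.
have eqw i : l * w 0 i = \sum_j A i j * w 0 j.
  have := Mw0 (delta_mx 0 i); rewrite ME => /eqP; rewrite subr_eq0 => /eqP.
  rewrite dotv_sum (bigD1 i) //= big1 => [|j /negbTE ji]; last first.
    by rewrite !mxE eqxx ji mul0r.
  rewrite addr0 [delta_mx _ _ _ _]mxE !eqxx mul1r => ->.
  rewrite bform_sum (bigD1 i) //= [X in _ + X]big1 => [|j /negbTE ji]; last first.
    by apply: big1 => k _; rewrite [delta_mx _ _ _ _]mxE eqxx ji mul0r mulr0.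
  by rewrite addr0; apply: eq_bigr => j _; rewrite [delta_mx _ _ _ _]mxE !eqxx mul1r.
have [m mP] : exists m, forall i, w 0 i <= w 0 m.
  pose i0 : 'I_#|G| := Ordinal n0.
  by case: (arg_maxP (fun i => w 0 i) (i0 := i0) (P := predT)) => // m _ h; exists m => i; apply: h.
have wm : 0 < w 0 m.
  rewrite lt_neqAle mxE normr_ge0 andbT eq_sym normr_eq0; apply: contraNneq v0 => vm.
  apply/eqP/rowP => i; apply/eqP; rewrite mxE -normr_eq0 eq_le normr_ge0 andbT.
  by have := mP i; rewrite !mxE vm normr0.
exists (fun u => w 0 (enum_rank u) / w 0 m); split.
- move=> u; apply/andP; split; last by rewrite ler_pdivrMr // mul1r.
  by apply: divr_ge0 (ltW wm); rewrite mxE.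
- by exists (enum_val m); rewrite enum_valK divff // gt_eqF.
- move=> u; rewrite mulrA eqw mulr_suml -(sum_enum_val (fun z => (u -- z)%:R * (w 0 (enum_rank z) / w 0 m))).
  by apply: eq_bigr => j _; rewrite enum_valK mulrA mxE enum_rankK.
by move=> y; rewrite -rowA -rowd.
Qed.

(** * The hubs of a sparse graph with large spectral radius *)

Section Hubs.
Variables (R : realType) (T : finType) (e : rel T).
Hypothesis es : symmetric e.
Variables (g M a : nat) (c h lam : R) (x : T -> R).

Let E u v : R := (e u v)%:R.
Let n : R := #|T|%:R.
Let dg v : R := \sum_u E v u.
Let Nb v : {set T} := [set u | e v u].

Definition common (A : {set T}) : {set T} := [set u | [forall v in A, e v u]].

Hypothesis g_gt0 : (0 < g)%N.
Hypothesis c_ge1 : 1 <= c.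
Hypothesis sparse : forall D : {set T}, \sum_(u in D) \sum_(v in D) E u v <= c * #|D|%:R.
Hypothesis no_biclique : forall A : {set T}, #|A| = g.+1 -> (#|common A| < M)%N.
Hypothesis x01 : forall v, 0 <= x v <= 1.
Hypothesis lam_ge0 : 0 <= lam.
Hypothesis eig : forall v, lam * x v = \sum_w E v w * x w.
Hypothesis lam_large : g%:R * (n - g%:R) <= lam ^+ 2.
Hypothesis h_gt0 : 0 < h.
Hypothesis h_small : 28%:R * (g%:R + 1) * h * c <= 1.
Hypothesis a_large : 4%:R * c ^+ 2 / h <= a%:R.
Let ep : R := h / (8%:R * c).
Hypothesis n_large1 : 2%:R * g%:R <= n.
Hypothesis n_large2 : 2%:R * c ^+ 2 / ep ^+ 4 <= n.
Hypothesis n_large3 : g%:R ^+ 2 <= h * c * n.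
Hypothesis n_large4 : (2 ^ a * M * a)%:R <= h * c * n.
Hypothesis n_large5 : M%:R <= h * c * n.

Let x_ge0 v : 0 <= x v. Proof. by case/andP: (x01 v). Qed.
Let x_le1 v : x v <= 1. Proof. by case/andP: (x01 v). Qed.
Let E_ge0 u v : 0 <= E u v. Proof. exact: ler0n. Qed.
Let g_ge1 : 1 <= g%:R :> R. Proof. by rewrite ler1n. Qed.
Let c_gt0 : 0 < c. Proof. exact: lt_le_trans ltr01 c_ge1. Qed.
Let ep_gt0 : 0 < ep. Proof. by rewrite divr_gt0 // mulr_gt0. Qed.
Let n_gt0 : 0 < n.
Proof. by apply: lt_le_trans n_large1; rewrite mulr_gt0 // ltr0n. Qed.

Let hc_gt0 : 0 < h * c. Proof. exact: mulr_gt0. Qed.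

Lemma card_sumR (A : {set T}) : #|A|%:R = \sum_(u in A) 1 :> R.
Proof. by rewrite sumr_const. Qed.

Lemma sumE_card (A : {set T}) v : \sum_(u in A) E v u = #|A :&: Nb v|%:R.
Proof.
rewrite card_sumR [RHS](eq_bigl (fun u => (u \in A) && e v u)) => [|u].
  by rewrite big_mkcondr /=; apply: eq_bigr => u _; rewrite /E; case: (e v u).
by rewrite !inE.
Qed.

Lemma dg_card v : dg v = #|Nb v|%:R.
Proof.
by rewrite -[Nb v]setTI -sumE_card /dg; apply: eq_bigl => u; rewrite inE.
Qed.

Lemma dg_ge0 v : 0 <= dg v. Proof. by apply: sumr_ge0. Qed.

Lemma dg_le v : dg v <= n. Proof. by rewrite dg_card ler_nat max_card. Qed.

Lemma sum_dg : \sum_u dg u <= c * n.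
Proof.
have := sparse setT; rewrite cardsT -/n; apply: le_trans.
rewrite le_eqVlt; apply/orP; left; apply/eqP.
by apply: eq_big => u; rewrite ?inE // => _; apply: eq_bigl => v; rewrite inE.
Qed.

Lemma sum_dg_sub (A : {set T}) : \sum_(u in A) dg u <= c * n.
Proof.
apply: le_trans sum_dg; rewrite [X in _ <= X](bigID (mem A)) /= lerDl.
by apply: sumr_ge0 => u _; apply: dg_ge0.
Qed.

Lemma lam_half : n / 2%:R <= lam ^+ 2.
Proof. by apply: le_trans lam_large; have := n_large1; have := g_ge1; nra. Qed.

Lemma walk2 v : lam ^+ 2 * x v = \sum_u E v u * \sum_w E u w * x w.
Proof.
rewrite expr2 -mulrA eig mulr_sumr; apply: eq_bigr => u _.
by rewrite mulrCA eig.
Qed.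

Let lg (t : R) : {set T} := [set v | t <= x v].

(** The entries below [t] contribute at most [t] for each of the walks with two
    edges from [v], whose number is bounded by the sum of all degrees. *)
Lemma walk2_split t v : 0 <= t ->
  lam ^+ 2 * x v <= \sum_u E v u * \sum_(w in lg t) E u w * x w + t * c * n.
Proof.
move=> t0; rewrite walk2.
have -> : t * c * n = t * (c * n) by rewrite mulrA.
apply: le_trans (lerD (lexx _) (ler_wpM2l t0 sum_dg)).
rewrite mulr_sumr -big_split /=; apply: ler_sum => u _.
rewrite (bigID (mem (lg t))) /= mulrDr lerD2l.
apply: (@le_trans _ _ (\sum_(w | w \notin lg t) E u w * x w)).
  by rewrite ler_piMl ?sumr_ge0 // => [w _|]; rewrite ?mulr_ge0 // /E; case: (e v u).
apply: (@le_trans _ _ (\sum_(w | w \notin lg t) t * E u w)).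
  by apply: ler_sum => w; rewrite inE -ltNge => /ltW lt; rewrite mulrC ler_wpM2r.
rewrite -mulr_sumr ler_wpM2l // /dg [X in _ <= X](bigID (mem (lg t))) /= lerDr.
exact: sumr_ge0.
Qed.

Lemma card_lg_ep : #|lg ep|%:R <= ep * n.
Proof.
have h1 : lam * (ep * #|lg ep|%:R) <= c * n.
  apply: le_trans (sum_dg_sub (lg ep)).
  rewrite card_sumR mulr_sumr mulr_sumr; apply: ler_sum => v; rewrite inE mulr1 => ev.
  apply: (@le_trans _ _ (lam * x v)); first by rewrite ler_wpM2l.
  by rewrite eig; apply: ler_sum => w _; rewrite ler_piMr.
rewrite leNgt; apply/negP => lt.
have h2 : lam ^+ 2 * (ep ^+ 2 * n) ^+ 2 < (c * n) ^+ 2.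
  rewrite -exprMn; apply: (@lt_le_trans _ _ ((lam * (ep * #|lg ep|%:R)) ^+ 2)).
    have lam0 : 0 < lam.
      by rewrite lt_neqAle lam_ge0 andbT; apply: contraTneq lam_half => <-;
        rewrite expr0n /= -ltNge divr_gt0.
    have en_ge0 : 0 <= ep ^+ 2 * n by rewrite mulr_ge0 ?sqr_ge0 // ltW.
    have ec_ge0 : 0 <= ep * #|lg ep|%:R by rewrite mulr_ge0 // ltW.
    rewrite ltr_pXn2r ?nnegrE; [|by []|exact: mulr_ge0|exact: mulr_ge0].
    by rewrite ltr_pM2l // expr2 -mulrA ltr_pM2l.
  have cn_ge0 : 0 <= c * n by rewrite mulr_ge0 // ltW.
  by rewrite ler_pXn2r ?nnegrE // mulr_ge0 // mulr_ge0 // ltW.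
have h3 : n / 2%:R * (ep ^+ 2 * n) ^+ 2 < (c * n) ^+ 2.
  by apply: le_lt_trans h2; rewrite ler_wpM2r ?sqr_ge0 ?lam_half.
have : n * ep ^+ 4 < 2%:R * c ^+ 2.
  rewrite -(ltr_pM2r (exprn_gt0 2 n_gt0)).
  have -> : n * ep ^+ 4 * n ^+ 2 = 2%:R * (n / 2%:R * (ep ^+ 2 * n) ^+ 2) by field.
  have -> : 2%:R * c ^+ 2 * n ^+ 2 = 2%:R * (c * n) ^+ 2 by ring.
  by rewrite ltr_pM2l.
by apply/negP; rewrite -leNgt -ler_pdivrMr ?exprn_gt0.
Qed.

(** Edges from the neighbourhood of [v] to the vertices with a large entry are
    few by sparsity, so a large entry forces a linear degree. *)
Lemma dg_lg v : v \in lg h -> n * h / (4%:R * c) <= dg v.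
Proof.
rewrite inE => hv.
have h1 := walk2_split v (ltW ep_gt0).
have h2 : \sum_u E v u * (\sum_(w in lg ep) E u w * x w) <= c * (dg v + #|lg ep|%:R).
  apply: (@le_trans _ _ (c * #|Nb v :|: lg ep|%:R)); last first.
    by rewrite ler_pM2l // dg_card -natrD ler_nat leq_card_setU.
  apply: le_trans (sparse _).
  apply: (@le_trans _ _ (\sum_(u in Nb v) \sum_(w in lg ep) E u w)).
    rewrite [X in _ <= X]big_mkcond /=; apply: ler_sum => u _.
    rewrite inE /E; case: (e v u); rewrite ?mul1r ?mul0r //.
    by apply: ler_sum => w _; rewrite ler_piMr.
  rewrite [X in X <= _]big_mkcond [X in _ <= X]big_mkcond /=; apply: ler_sum => u _.
  rewrite in_setU; case: (u \in Nb v) => /=; last first.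
    by case: ifP => // _; apply: sumr_ge0.
  rewrite [X in X <= _]big_mkcond [X in _ <= X]big_mkcond /=; apply: ler_sum => w _.
  by rewrite in_setU; case: (w \in lg ep); rewrite ?orbT ?orbF //; case: ifP.
have h3 := card_lg_ep.
have h4 : n * h / 2%:R <= lam ^+ 2 * x v.
  apply: (@le_trans _ _ (n / 2%:R * x v)); last by rewrite ler_wpM2r ?lam_half.
  by rewrite mulrAC ler_pM2l // divr_gt0.
have h5 : c * ep * n = n * h / 8%:R by rewrite /ep; field; rewrite gt_eqF.
have h6 : c * #|lg ep|%:R <= c * ep * n by rewrite -mulrA ler_pM2l.
rewrite ler_pdivrMr ?mulr_gt0 //; lra.
Qed.

(** Large entries force linear degrees, and the sum of the degrees is linear:
    the number of large entries is bounded independently of [n]. *)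
Lemma card_lg : (#|lg h| <= a)%N.
Proof.
rewrite -(ler_nat R); apply: le_trans a_large.
have h1 : #|lg h|%:R * (n * h / (4%:R * c)) <= c * n.
  apply: le_trans (sum_dg_sub (lg h)); rewrite card_sumR mulr_suml.
  by apply: ler_sum => v lv; rewrite mul1r dg_lg.
rewrite -(ler_pM2r (_ : 0 < n * h / (4%:R * c))); last by rewrite divr_gt0 ?mulr_gt0.
apply: le_trans h1 _; rewrite le_eqVlt; apply/orP; left; apply/eqP.
by field; rewrite !gt_eqF.
Qed.

Let crowded : {set T} := [set u | (g < #|lg h :&: Nb u|)%N].

(** Any [g + 1] vertices have fewer than [M] common neighbours, and there are
    boundedly many choices of [g + 1] vertices with large entries. *)
Lemma card_crowded : (#|crowded| <= 2 ^ a * M)%N.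
Proof.
pose P := [set A in powerset (lg h) | #|A| == g.+1].
have sub : crowded \subset \bigcup_(A in P) common A.
  apply/subsetP => u; rewrite inE => lt.
  have [A /subsetP sA cA] := subset_of_card lt.
  apply/bigcupP; exists A.
    rewrite !inE cA eqxx andbT; apply/subsetP => w /sA.
    by rewrite !inE => /andP [].
  rewrite inE; apply/forall_inP => w /sA; rewrite !inE => /andP [_].
  by rewrite es.
apply: leq_trans (subset_leq_card sub) _.
apply: leq_trans (card_bigcup_le (k := M) _) _ => [A|].
  by rewrite !inE => /andP [_ /eqP cA]; apply/ltnW/no_biclique.
rewrite leq_mul2r; apply/orP; right.
apply: leq_trans (_ : #|powerset (lg h)| <= _)%N.
  by apply/subset_leq_card/subsetP => A; rewrite inE => /andP [].
by rewrite card_powerset leq_exp2l // card_lg.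
Qed.

(** The boundedly many crowded vertices, and the small entries, contribute the
    error term. *)
Lemma walk2_bound v b : 0 <= b ->
  (forall u, e v u -> u \notin crowded -> \sum_(w in lg h) E u w * x w <= b) ->
  lam ^+ 2 * x v <= dg v * b + 2%:R * (h * c * n).
Proof.
move=> b0 bP; have h1 := walk2_split v (ltW h_gt0).
suff : \sum_u E v u * (\sum_(w in lg h) E u w * x w) <= dg v * b + h * c * n by lra.
have fa u : \sum_(w in lg h) E u w * x w <= a%:R.
  apply: (@le_trans _ _ #|lg h|%:R); last by rewrite ler_nat card_lg.
  rewrite card_sumR; apply: ler_sum => w _.
  by rewrite mulr_ile1 // /E; case: (e u w).
apply: (@le_trans _ _ (\sum_u (E v u * b + (u \in crowded)%:R * a%:R))).
  apply: ler_sum => u _; case: (boolP (u \in crowded)) => uc.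
    apply: (@le_trans _ _ a%:R); last by rewrite mul1r lerDr mulr_ge0.
    apply: le_trans (fa u); rewrite ler_piMl //.
      by apply: sumr_ge0 => w _; apply: mulr_ge0.
    by rewrite /E; case: (e v u).
  rewrite mul0r addr0 /E; case: (boolP (e v u)) => evu; last by rewrite !mul0r.
  by rewrite !mul1r bP.
rewrite big_split /= -mulr_suml lerD2l -mulr_suml.
apply: le_trans n_large4; rewrite natrM ler_wpM2r //.
rewrite -natr_sum ler_nat; apply: leq_trans card_crowded.
rewrite -sum1_card [X in (_ <= X)%N]big_mkcond /=; apply: leq_sum => u _.
by case: (u \in crowded).
Qed.

Lemma sum_nbrs_le u (b : T -> R) : (forall w, w \in lg h -> x w <= b w) ->
  \sum_(w in lg h) E u w * x w <= \sum_(w in lg h :&: Nb u) b w.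
Proof.
move=> bP; rewrite [X in X <= _]big_mkcond [X in _ <= X]big_mkcond /=.
apply: ler_sum => w _; rewrite in_setI; case: (boolP (w \in lg h)) => //= lw.
by rewrite inE /E; case: (e u w); rewrite ?mul1r ?mul0r // bP.
Qed.

(** An uncrowded neighbour of [v] sees [v] and at most [g - 1] other large
    entries. *)
Lemma walk2_lg v : v \in lg h ->
  lam ^+ 2 * x v <= dg v * (x v + g%:R - 1) + 2%:R * (h * c * n).
Proof.
move=> lv; apply: walk2_bound => [|u evu uc].
  by have := x_ge0 v; have := g_ge1; lra.
apply: (le_trans (sum_nbrs_le u (b := fun w => if w == v then x v else 1) _)).
  by move=> w _; case: eqP => [->|].
have vI : v \in lg h :&: Nb u by rewrite !inE es evu andbT; rewrite inE in lv.
rewrite (bigD1 v) //= eqxx -addrA lerD2l.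
rewrite (eq_bigr (fun=> 1)) => [|w /andP [_ /negbTE ->]] //.
have : (#|(lg h :&: Nb u) :\ v|.+1 <= g)%N.
  by move: uc; rewrite inE -leqNgt (cardsD1 v) vI.
rewrite -(ler_nat R) -natr1 => le.
rewrite lerBrDr; apply: le_trans le; rewrite lerD2r card_sumR.
rewrite le_eqVlt; apply/orP; left; apply/eqP; apply: eq_bigl => w.
by rewrite in_setD1 andbC.
Qed.

Let dl : R := 4%:R * h * c.
Let hub : {set T} := lg (1 - dl).

Let dl_small : 7%:R * dl * (g%:R + 1) <= 1.
Proof. by rewrite /dl; have := h_small; lra. Qed.

Let dl_gt0 : 0 < dl.
Proof. by rewrite /dl mulr_gt0 // mulr_gt0. Qed.

Let hub_lg : hub \subset lg h.
Proof.
apply/subsetP => v; rewrite !inE; apply: le_trans.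
have := dl_small; have := dl_gt0; have := g_ge1; have : h <= h * c by rewrite ler_peMr // ltW.
rewrite /dl; nra.
Qed.

(** Were there fewer than [g] hubs, every uncrowded vertex would see a weight
    of at most [g - dl] among the large entries. *)
Lemma card_hub_ge : (exists v, x v = 1) -> (g <= #|hub|)%N.
Proof.
move=> [v xv]; rewrite leqNgt; apply/negP => lt.
have dl1 : dl <= 1 by have := dl_small; have := dl_gt0; have := g_ge1; nra.
have : lam ^+ 2 * x v <= dg v * (g%:R - dl) + 2%:R * (h * c * n).
  apply: walk2_bound => [|u _ uc]; first by have := g_ge1; lra.
  apply: (le_trans (sum_nbrs_le u (b := fun w => if w \in hub then 1 else 1 - dl) _)).
    by move=> w _; rewrite [w \in hub]inE; case: ifP => // /negbT; rewrite -ltNge => /ltW.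
  have le : (#|lg h :&: Nb u| <= g)%N by move: uc; rewrite inE -leqNgt.
  case: (ltnP #|lg h :&: Nb u| g) => [lt1|ge].
    apply: (@le_trans _ _ #|lg h :&: Nb u|%:R).
      by rewrite card_sumR; apply: ler_sum => w _; case: ifP => // _; have := dl_gt0; lra.
    by move: lt1; rewrite -(ler_nat R) -natr1 => lt1; lra.
  have [w wI wh] : exists2 w, w \in lg h :&: Nb u & w \notin hub.
    apply/subsetPn; apply/negP => /subset_leq_card le'.
    by have := leq_trans ge le'; rewrite leqNgt lt.
  rewrite (bigD1 w) //= (negbTE wh).
  have cE : (#|(lg h :&: Nb u) :\ w|.+1)%:R <= g%:R :> R.
    by rewrite ler_nat; move: le; rewrite (cardsD1 w) wI.
  rewrite -natr1 in cE.
  suff : \sum_(i in lg h :&: Nb u | i != w) (if i \in hub then 1 else 1 - dl) <=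
      #|(lg h :&: Nb u) :\ w|%:R by lra.
  rewrite card_sumR [X in _ <= X](eq_bigl (fun i => (i \in lg h :&: Nb u) && (i != w))).
    by apply: ler_sum => z _; case: ifP => // _; have := dl_gt0; lra.
  by move=> z; rewrite in_setD1 andbC.
rewrite xv mulr1.
have h1 : dg v * (g%:R - dl) <= n * (g%:R - dl).
  by rewrite ler_wpM2r ?dg_le //; have := g_ge1; lra.
have h2 := lam_large; have h3 := n_large3; have h4 : 0 < h * c * n by rewrite mulr_gt0.
rewrite /dl in h1 *; nra.
Qed.

(** The walks with two edges from a hub have a total weight of at least about
    [g * n], to which each neighbour of the hub contributes at most about [g]. *)
Lemma codeg_hub v : v \in hub -> n - dg v <= 7%:R * (h * c * n).
Proof.
move=> hv; have h1 := walk2_lg (subsetP hub_lg v hv).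
rewrite inE in hv.
have h2 : dg v * (x v + g%:R - 1) <= dg v * g%:R.
  by rewrite ler_wpM2l ?dg_ge0 //; have := x_le1 v; lra.
have h3 : g%:R * (n - g%:R) * (1 - dl) <= lam ^+ 2 * x v.
  have n_g : 0 <= g%:R * (n - g%:R) by have := n_large1; have := g_ge1; nra.
  apply: (@le_trans _ _ (g%:R * (n - g%:R) * x v)); first by rewrite ler_wpM2l.
  by rewrite ler_wpM2r.
have h4 := n_large3; have k0 : 0 < h * c * n by rewrite mulr_gt0.
rewrite -(ler_pM2l (_ : 0 < g%:R)) ?ltr0n //.
have h5 : g%:R * (n - dg v) <= g%:R ^+ 2 + g%:R * (4%:R * (h * c * n)) + 2%:R * (h * c * n).
  have h6 : 0 <= g%:R ^+ 2 * dl by rewrite mulr_ge0 ?sqr_ge0 // ltW.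
  have h7 : g%:R * (n - g%:R) * (1 - dl) =
     g%:R * n - g%:R ^+ 2 - g%:R * (4%:R * (h * c * n)) + g%:R ^+ 2 * dl.
    by rewrite /dl; ring.
  lra.
apply: le_trans h5 _.
have h8 : h * c * n <= g%:R * (h * c * n) by rewrite ler_peMl // ltW.
lra.
Qed.

Lemma card_common (A : {set T}) : A \subset hub ->
  n - #|A|%:R * (7%:R * (h * c * n)) <= #|common A|%:R.
Proof.
move=> /subsetP AH; rewrite lerBlDr -lerBlDl.
apply: (@le_trans _ _ (\sum_(v in A) (n - dg v))); last first.
  by rewrite card_sumR mulr_suml; apply: ler_sum => v Av; rewrite mul1r codeg_hub // AH.
have -> : \sum_(v in A) (n - dg v) = (\sum_(v in A) #|~: Nb v|)%:R.
  rewrite natr_sum; apply: eq_bigr => v _; rewrite dg_card /n -(cardsC (Nb v)) natrD.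
  by rewrite addrAC subrr add0r.
rewrite lerBlDr /n -natrD ler_nat -(cardsC (common A)) addnC leq_add2r.
have sub : ~: common A \subset \bigcup_(v in A) ~: Nb v.
  apply/subsetP => u; rewrite !inE negb_forall_in => /exists_inP [v Av nvu].
  by apply/bigcupP; exists v => //; rewrite !inE.
apply: leq_trans (subset_leq_card sub) _.
elim/big_rec2: _ => [|v y X _ IH]; first by rewrite cards0.
by rewrite cardsU; apply: leq_trans (leq_subr _ _) _; rewrite leq_add2l.
Qed.

(** With [g + 1] hubs there would be [n / 2] common neighbours of [g + 1]
    vertices. A vertex outside the [g] hubs has fewer than [M] neighbours
    among their common neighbours, so its degree, and hence its entry, is
    small. *)
Lemma hub_structure : (exists v, x v = 1) -> exists L : {set T},
  [/\ #|L| = g, forall v, v \in L -> 1 - 4%:R * h * c <= x v,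
      forall v, v \notin L -> x v <= 20%:R * g%:R * h * c &
      n <= 2%:R * #|common L|%:R].
Proof.
move=> ex1; have hge := card_hub_ge ex1.
have k0 : 0 < h * c * n by rewrite mulr_gt0.
have k_small : 28%:R * (g%:R + 1) * (h * c * n) <= n.
  have -> : 28%:R * (g%:R + 1) * (h * c * n) = 28%:R * (g%:R + 1) * h * c * n by ring.
  by rewrite ler_piMl // ltW.
have gk0 : 0 <= g%:R * (h * c * n) by rewrite mulr_ge0 // ltW.
have chub : #|hub| = g.
  apply/eqP; rewrite eqn_leq hge andbT leqNgt; apply/negP => lt.
  have [A sA cA] := subset_of_card lt.
  have := card_common sA; have := no_biclique cA.
  rewrite -(ltr_nat R) cA -natr1 => h1 h2.
  by have h3 := n_large5; lra.
have hcom := card_common (subxx hub); rewrite chub in hcom.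
exists hub; split=> //.
- by move=> v; rewrite inE.
- move=> v vh; case: (ltP (x v) h) => [lt|ge].
    apply: le_trans (ltW lt) _.
    have hch : h <= h * c by rewrite ler_peMr // ltW.
    by have := g_ge1; nra.
  have lv : v \in lg h by rewrite inE.
  have h1 := walk2_lg lv.
  have cA : #|v |: hub| = g.+1 by rewrite cardsU1 vh chub.
  have dv : dg v <= M%:R + g%:R * (7%:R * (h * c * n)).
    have : dg v <= #|common (v |: hub)|%:R + #|~: common hub|%:R.
      rewrite dg_card -natrD ler_nat -(cardsID (common hub) (Nb v)) leq_add //.
        apply/subset_leq_card/subsetP => u; rewrite !inE => /andP [evu /forall_inP cu].
        by apply/forall_inP => w /setU1P [->|/cu].
      by apply/subset_leq_card/subsetP => u; rewrite !inE => /andP [].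
    have := no_biclique cA; rewrite -(ltr_nat R).
    have : #|common hub|%:R + #|~: common hub|%:R = n by rewrite -natrD cardsC.
    lra.
  have h2 : dg v * (x v + g%:R - 1) <= dg v * g%:R.
    by rewrite ler_wpM2l ?dg_ge0 //; have := x_le1 v; lra.
  have h3 : g%:R * (n - g%:R) * x v <= lam ^+ 2 * x v by rewrite ler_wpM2r.
  have h4 := n_large5.
  have h5 : dg v * g%:R <= (h * c * n + g%:R * (7%:R * (h * c * n))) * g%:R.
    by rewrite ler_wpM2r //; lra.
  have h6 : g%:R * ((n - g%:R) * x v) <= g%:R * (10%:R * g%:R * (h * c * n)).
    have h7 : h * c * n <= g%:R * g%:R * (h * c * n).
      by rewrite ler_peMl ?(ltW k0) //; have := g_ge1; nra.
    have h8 : g%:R * (h * c * n) <= g%:R * g%:R * (h * c * n).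
      by rewrite ler_wpM2r ?(ltW k0) // ler_peMl.
    lra.
  rewrite ler_pM2l ?ltr0n // in h6.
  have h9 : n / 2%:R * x v <= (n - g%:R) * x v.
    by rewrite ler_wpM2r //; have := n_large1; lra.
  rewrite -(ler_pM2l n_gt0); lra.
by lra.
Qed.

End Hubs.

(** * Comparison with the join of a clique *)

Section Comparison.
Variables (R : realType) (T : finType) (e : rel T).
Hypotheses (es : symmetric e) (ei : irreflexive e).
Variables (L Z : {set T}) (m : nat) (c d t lam : R) (x : T -> R).

Let E u v : R := (e u v)%:R.
Let W := common e L.
Let Q := ~: (L :|: W).
Let A := W :\: Z.
Let s : R := \sum_(u in L) x u.

Hypothesis ZW : Z \subset W.
Hypothesis c_ge0 : 0 <= c.
Hypothesis sparse : forall D : {set T}, \sum_(u in D) \sum_(v in D) E u v <= c * #|D|%:R.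
Hypothesis nbrs_out : forall v, v \in Q -> \sum_(w in W) E v w <= m%:R.
Hypothesis deg_Z : forall z, z \in Z -> \sum_w E z w <= d.
Hypothesis x01 : forall v, 0 <= x v <= 1.
Hypothesis xL : forall v, v \in L -> 1 - t <= x v.
Hypothesis xnL : forall v, v \notin L -> x v <= t.
Hypothesis lam_ge1 : 1 <= lam.
Hypothesis eig : forall v, lam * x v = \sum_w E v w * x w.
Hypothesis t_ge0 : 0 <= t.
Hypothesis t_small1 : t * (1 + m%:R + 2%:R * c) <= 1 / 2%:R.
Hypothesis t_small2 : 16%:R * #|Z|%:R * (#|L|%:R + d) * d * t <= 1.
Hypothesis L_gt0 : (0 < #|L|)%N.

Let x_ge0 v : 0 <= x v. Proof. by case/andP: (x01 v). Qed.
Let x_le1 v : x v <= 1. Proof. by case/andP: (x01 v). Qed.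
Let E_ge0 u v : 0 <= E u v. Proof. exact: ler0n. Qed.
Let Exx_ge0 u v : 0 <= E u v * (x u * x v).
Proof. by rewrite mulr_ge0 // mulr_ge0. Qed.
Let lam_gt0 : 0 < lam. Proof. exact: lt_le_trans ltr01 lam_ge1. Qed.

Let WL w : w \in W -> w \notin L.
Proof.
by rewrite inE => /forall_inP cw; apply/negP => /cw; rewrite ei.
Qed.

Let QP v : (v \in Q) = (v \notin L) && (v \notin W).
Proof. by rewrite !inE negb_or. Qed.

(** Sparse graphs are degenerate: vertices are removed one by one, each
    having few neighbours among the remaining ones. *)
Lemma sum_inside_le (D : {set T}) : [disjoint D & L] ->
  \sum_(u in D) \sum_(v in D) E u v * (x u * x v) <= 2%:R * c * t * \sum_(u in D) x u.
Proof.
have [n] := ubnP #|D|; elim: n D => // n IH D lt DL.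
have [->|D0] := eqVneq D finset.set0; first by rewrite !big_set0 mulr0.
have [v Dv dv] : exists2 v, v \in D & \sum_(w in D) E v w <= c.
  apply: contrapT => no; have := sparse D; apply/negP; rewrite -ltNge.
  have -> : c * #|D|%:R = \sum_(u in D) c by rewrite sumr_const mulr_natr.
  apply: ltr_sum => [|v Dv]; last by rewrite ltNge; apply/negP => le; apply: no; exists v.
  by have [v Dv] := set0Pn _ D0; apply/hasP; exists v; rewrite ?mem_index_enum.
rewrite (big_setD1 v) //= [X in _ + X](eq_bigr (fun u =>
  E u v * (x u * x v) + \sum_(w in D :\ v) E u w * (x u * x w))); last first.
  by move=> u _; rewrite (big_setD1 v).
rewrite big_split /= [X in _ <= _ * X](big_setD1 v) //= mulrDr addrA lerD //; last first.
  apply: IH; last by apply: disjointWl DL; apply: subsetDl.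
  by move: lt; rewrite (cardsD1 v) Dv.
have h : \sum_(w in D) E v w * (x v * x w) <= c * t * x v.
  apply: (@le_trans _ _ (\sum_(w in D) E v w * (t * x v))); last first.
    by rewrite -mulr_suml -mulrA ler_wpM2r // mulr_ge0.
  apply: ler_sum => w Dw; rewrite ler_wpM2l // mulrC ler_wpM2r // xnL //.
  by have /disjointP/(_ w Dw)/negP := DL.
have : \sum_(w in D :\ v) E w v * (x w * x v) <= \sum_(w in D) E v w * (x v * x w).
  rewrite [X in _ <= X](big_setD1 v) //= ler_wpDl //.
  rewrite le_eqVlt; apply/orP; left; apply/eqP; apply: eq_bigr => w _.
  by rewrite /E es [x w * _]mulrC.
lra.
Qed.

Let SQ : R := \sum_(u in Q) x u.
Let QR : R := \sum_(u in Q) \sum_(v in ~: Q) E u v * (x u * x v).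
Let p : R := s - (1 - t) + m%:R * t + 2%:R * c * t.

Lemma s_ge : 1 - t <= s.
Proof.
have [u Lu] := card_gt0P L_gt0; rewrite /s (bigD1 u) //=.
by apply: le_trans (xL Lu) _; rewrite lerDl sumr_ge0.
Qed.

(** A vertex of [Q] misses a vertex of [L], whose entry is at least [1 - t]. *)
Lemma cross_le : QR <= (p - 2%:R * c * t) * SQ.
Proof.
rewrite /QR mulr_sumr; apply: ler_sum => v Qv; have := Qv; rewrite QP => /andP [nL nW].
have -> : p - 2%:R * c * t = s - (1 - t) + m%:R * t by rewrite /p; ring.
have -> : \sum_(w in ~: Q) E v w * (x v * x w) = x v * \sum_(w in ~: Q) E v w * x w.
  by rewrite mulr_sumr; apply: eq_bigr => w _; rewrite mulrCA.
rewrite [X in _ <= X]mulrC ler_wpM2l // setCK.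
have -> : \sum_(w in L :|: W) E v w * x w = \sum_(w in L) E v w * x w + \sum_(w in W) E v w * x w.
  rewrite -bigU //=; last by apply/disjointP => w Lw /WL; rewrite Lw.
  by apply: eq_bigl => w; rewrite !inE.
apply: lerD.
  have [u Lu neu] : exists2 u, u \in L & ~~ e v u.
    by move: nW; rewrite inE negb_forall_in => /exists_inP [u Lu]; rewrite es; exists u.
  rewrite /s (bigD1 u) //= [X in _ <= X - _](bigD1 u) //= /E (negbTE neu) mul0r add0r.
  have := xL Lu; suff : \sum_(i in L | i != u) (e v i)%:R * x i <= \sum_(i in L | i != u) x i by lra.
  by apply: ler_sum => w _; rewrite ler_piMl //; case: (e v w).
apply: (@le_trans _ _ (\sum_(w in W) E v w * t)); last first.
  by rewrite -mulr_suml ler_wpM2r // nbrs_out.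
by apply: ler_sum => w Ww; rewrite ler_wpM2l // xnL // WL.
Qed.

(** The eigenvalue equation bounds the sum of [lam * x v ^+ 2] over [Q] by
    [p * SQ], and [2 * p * x v <= lam * x v ^+ 2 + p ^+ 2 / lam] turns this into
    a bound on [SQ] by the number of vertices. *)
Lemma cross_le_card : QR <= #|Q|%:R * (p ^+ 2 / lam).
Proof.
have SQ0 : 0 <= SQ by apply: sumr_ge0.
have ct0 : 0 <= 2%:R * c * t by rewrite !mulr_ge0.
have h1 : QR <= p * SQ.
  by apply: le_trans cross_le _; rewrite ler_wpM2r // lerBlDr lerDl.
have QL : [disjoint Q & L] by apply/disjointP => v; rewrite QP => /andP [/negP].
have h2 : \sum_(v in Q) lam * x v ^+ 2 <= p * SQ.
  have -> : \sum_(v in Q) lam * x v ^+ 2 =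
      QR + \sum_(u in Q) \sum_(v in Q) E u v * (x u * x v).
    rewrite /QR -big_split /=; apply: eq_bigr => v _.
    rewrite expr2 mulrCA eig mulr_sumr (bigID (mem Q)) /= addrC; congr (_ + _).
      by apply: eq_big => w; rewrite ?inE // => _; rewrite mulrCA.
    by apply: eq_bigr => w _; rewrite mulrCA.
  apply: le_trans (lerD cross_le (sum_inside_le QL)) _.
  by rewrite -mulrDl -/SQ subrK.
have h3 : \sum_(v in Q) (2%:R * p * x v) <= \sum_(v in Q) (lam * x v ^+ 2 + p ^+ 2 / lam).
  apply: ler_sum => v _; rewrite -subr_ge0.
  have -> : lam * x v ^+ 2 + p ^+ 2 / lam - 2%:R * p * x v = (lam * x v - p) ^+ 2 / lam.
    by field; rewrite gt_eqF.
  by rewrite divr_ge0 ?sqr_ge0 // ltW.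
rewrite -mulr_sumr big_split /= sumr_const -mulr_natl -/SQ in h3.
lra.
Qed.

Let ZZ : R := \sum_(u in Z) \sum_(v in W) E u v * (x u * x v).

Lemma s_le : s <= #|L|%:R.
Proof. by rewrite /s -sum1_card natr_sum; apply: ler_sum => v _. Qed.

Let t_le1 : t <= 1 / 2%:R.
Proof.
apply: le_trans t_small1; rewrite ler_peMr // -addrA lerDl.
by rewrite addr_ge0 // mulr_ge0.
Qed.

(** A vertex of [Z] has bounded degree, so its entry is of order [1 / lam]. *)
Lemma lost_le : 2%:R * ZZ <= 1 / 8%:R / lam.
Proof.
rewrite ler_pdivlMr //.
have zz : ZZ * lam <= \sum_(z in Z) (#|L|%:R + d) * (d * t).
  rewrite /ZZ mulr_suml; apply: ler_sum => z Zz.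
  have Wz := subsetP ZW z Zz.
  have h1 : lam * x z <= #|L|%:R + d.
    rewrite eig (bigID (mem L)) /=; apply: lerD.
      apply: le_trans s_le; apply: ler_sum => w _; rewrite ler_piMl //.
      by rewrite /E; case: (e z w).
    apply: le_trans (deg_Z Zz); rewrite [X in _ <= X](bigID (mem L)) /=.
    by rewrite ler_wpDl ?sumr_ge0 //; apply: ler_sum => w _; rewrite ler_piMr.
  have h2 : \sum_(v in W) E z v * x v <= d * t.
    apply: (@le_trans _ _ (\sum_(v in W) E z v * t)).
      by apply: ler_sum => w Ww; rewrite ler_wpM2l // xnL // WL.
    rewrite -mulr_suml ler_wpM2r //; apply: le_trans (deg_Z Zz).
    by rewrite [X in _ <= X](bigID (mem W)) /= lerDl sumr_ge0.
  have -> : (\sum_(v in W) E z v * (x z * x v)) * lam = (lam * x z) * \sum_(v in W) E z v * x v.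
    rewrite mulr_suml mulr_sumr; apply: eq_bigr => v _; ring.
  apply: ler_pM => //; first by rewrite mulr_ge0 // ltW.
  by apply: sumr_ge0 => v _; rewrite mulr_ge0.
rewrite sumr_const -mulr_natl in zz.
rewrite -mulrA; have := t_small2; lra.
Qed.

Let NL : R := \sum_(u in L) \sum_(v in L) ((u != v) && ~~ e u v)%:R * (x u * x v).

Lemma sum_indicator (B D : {set T}) (F : T -> T -> R) :
  \sum_u \sum_v (u \in B)%:R * (v \in D)%:R * F u v = \sum_(u in B) \sum_(v in D) F u v.
Proof.
rewrite [RHS]big_mkcond /=; apply: eq_bigr => u _.
case: (u \in B); last by rewrite big1 // => v _; rewrite !mul0r.
rewrite [RHS]big_mkcond /=; apply: eq_bigr => v _.
by case: (v \in D); rewrite ?mul1r ?mulr1 ?mul0r.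
Qed.

(** The test vector agrees with the Perron vector of [e] outside [Q]; the
    vertices of [Q] receive the entry that vertices joined exactly to [L]
    would have. *)
Lemma join_form_ge : exists y : T -> R,
  NL - 2%:R * ZZ + #|Q|%:R * ((s ^+ 2 - p ^+ 2) / lam) <=
  qform (join_rel e L A) y - lam * \sum_v y v ^+ 2.
Proof.
pose b := s / lam.
have s0 : 0 <= s by apply: sumr_ge0.
have b0 : 0 <= b by rewrite divr_ge0 // ltW.
pose y v := if v \in Q then b else x v.
have y0 v : 0 <= y v by rewrite /y; case: ifP.
exists y.
have -> : \sum_v y v ^+ 2 = \sum_(v in Q) b ^+ 2 + \sum_(v in ~: Q) x v ^+ 2.
  rewrite (bigID (mem Q)) /=; congr (_ + _).
    by apply: eq_bigr => v Qv; rewrite /y Qv.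
  by apply: eq_big => [v|v /negbTE Qv]; [exact/esym/in_setC | rewrite /y Qv].
pose i (B : {set T}) v : R := (v \in B)%:R.
pose F u v := i (~: Q) u * i (~: Q) v * (E u v * (x u * x v))
  + i L u * i L v * (((u != v) && ~~ e u v)%:R * (x u * x v))
  - i Z u * i W v * (E u v * (x u * x v)) - i W u * i Z v * (E u v * (x u * x v))
  + i L u * i Q v * (x u * b) + i Q u * i L v * (b * x v).
(* The comparison is made entry by entry, according to which of the sets [L],
   [W] and [Z] contain the two vertices. *)
have FE u v : F u v <= (join_rel e L A u v)%:R * (y u * y v).
  have sZ w : w \in Z -> w \in W := subsetP ZW w.
  have nQ w : (w \in ~: Q) = (w \notin Q) by rewrite in_setC.
  have AE w : (w \in A) = (w \notin Z) && (w \in W) by rewrite in_setD.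
  rewrite /F /i /join_rel /y !nQ !AE !QP.
  have hu := @WL u; have hv := @WL v; have zu := sZ u; have zv := sZ v.
  have Eu : E u v = (e u v)%:R by [].
  have cu : u \in L -> v \in W -> e u v by move=> Lu; rewrite inE => /forall_inP; apply.
  have cv : v \in L -> u \in W -> e u v by move=> Lu; rewrite inE es => /forall_inP; apply.
  have xx := mulr_ge0 (x_ge0 u) (x_ge0 v).
  have xb := mulr_ge0 (x_ge0 u) b0.
  have bx := mulr_ge0 b0 (x_ge0 v).
  have bb := mulr_ge0 b0 b0.
  have ne : u = v -> e u v = false by move=> ->; apply: ei.
  move: hu hv zu zv cu cv ne; rewrite Eu.
  case: (eqVneq u v) => [<-|nuv].
    move=> hu _ zu _ _ _ /(_ erefl) ->.
    by case: (u \in L) hu zu; case: (u \in W); case: (u \in Z) => //= hu zu;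
      try (by have := hu isT); try (by have := zu isT); lra.
  by case: (u \in L); case: (u \in W); case: (u \in Z);
     case: (v \in L); case: (v \in W); case: (v \in Z); case: (e u v) => //= hu hv zu zv cu cv _;
     try (by have := hu isT); try (by have := hv isT); try (by have := zu isT);
     try (by have := zv isT); try (by have := cu isT isT); try (by have := cv isT isT); lra.
have SF : \sum_u \sum_v F u v <= qform (join_rel e L A) y.
  by apply: ler_sum => u _; apply: ler_sum => v _.
have SE : \sum_u \sum_v F u v = (\sum_(u in ~: Q) \sum_(v in ~: Q) E u v * (x u * x v))
    + NL - ZZ - ZZ + #|Q|%:R * (s * b) + #|Q|%:R * (s * b).
  rewrite /F; under eq_bigr do rewrite !big_split /= !sumrN.
  rewrite !big_split /= !sumrN !sum_indicator -/NL -/ZZ.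
  have -> : \sum_(u in W) \sum_(v in Z) E u v * (x u * x v) = ZZ.
    rewrite exchange_big /=; apply: eq_bigr => u _; apply: eq_bigr => v _.
    by rewrite /E es [x v * _]mulrC.
  have B1 : \sum_(u in L) \sum_(v in Q) x u * b = #|Q|%:R * (s * b).
    rewrite /s mulr_suml mulr_sumr.
    by apply: eq_bigr => u _; rewrite sumr_const mulr_natl.
  have -> : \sum_(u in Q) \sum_(v in L) b * x v = #|Q|%:R * (s * b).
    by rewrite -B1 exchange_big /=; apply: eq_bigr => u _; apply: eq_bigr => v _; rewrite mulrC.
  by rewrite B1.
have off : \sum_(u in ~: Q) \sum_(v in ~: Q) E u v * (x u * x v) + QR =
    lam * \sum_(v in ~: Q) x v ^+ 2.
  have -> : QR = \sum_(u in ~: Q) \sum_(v in Q) E v u * (x v * x u).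
    by rewrite /QR exchange_big.
  rewrite -big_split mulr_sumr /=; apply: eq_bigr => u _.
  rewrite expr2 mulrCA eig mulr_sumr [RHS](bigID (mem Q)) /= addrC; congr (_ + _).
    by apply: eq_bigr => v _; rewrite /E es; ring.
  by apply: eq_big => v; rewrite ?inE // => _; ring.
have hQR := cross_le_card.
rewrite SE in SF.
have -> : \sum_(v in Q) b ^+ 2 = #|Q|%:R * b ^+ 2 by rewrite sumr_const mulr_natl.
have h4 : lam * (#|Q|%:R * b ^+ 2) = #|Q|%:R * (s * b).
  by rewrite /b; field; rewrite gt_eqF.
have h5 : #|Q|%:R * (s * b) = #|Q|%:R * (s ^+ 2 / lam) by rewrite /b; field; rewrite gt_eqF.
rewrite mulrDr h4 h5 mulrBl mulrBr -off; rewrite h5 in SF; lra.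
Qed.

(** Each vertex of [Q] gains at least [1 / (4 * lam)], a missing edge inside
    [L] gains at least [1 / 4], and the deleted edges at [Z] lose at most
    [1 / (8 * lam)]. *)
Lemma join_beats : (Q != finset.set0) \/ (exists u v, [/\ u \in L, v \in L, u != v & ~~ e u v]) ->
  exists y : T -> R, lam * \sum_v y v ^+ 2 < qform (join_rel e L A) y.
Proof.
move=> gain; have [y hy] := join_form_ge; exists y; rewrite -subr_gt0.
apply: lt_le_trans hy; have h1 := lost_le; have hs := s_ge.
have il0 : 0 < lam^-1 by rewrite invr_gt0.
have ct0 : 0 <= 2%:R * c * t by rewrite !mulr_ge0.
have p0 : 0 <= p.
  have : 0 <= m%:R * t by rewrite mulr_ge0.
  by rewrite /p; lra.
have sp : 1 / 4%:R <= s ^+ 2 - p ^+ 2.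
  have h2 : 1 / 2%:R <= s - p by rewrite /p; have := t_small1; lra.
  have h3 : 1 / 2%:R <= s + p by have := t_le1; lra.
  have -> : s ^+ 2 - p ^+ 2 = (s - p) * (s + p) by ring.
  have -> : 1 / 4%:R = (1 / 2%:R) * (1 / 2%:R) :> R by field.
  by apply: ler_pM => //; lra.
have NL0 : 0 <= NL by apply: sumr_ge0 => u _; apply: sumr_ge0 => v _; rewrite mulr_ge0 ?mulr_ge0.
have h8 : 1 / 8%:R / lam < 1 / 4%:R / lam by rewrite ltr_pM2r //; lra.
case: gain => [Q0|[u [v [Lu Lv nuv neuv]]]].
  have h6 : 1 / 4%:R / lam <= (s ^+ 2 - p ^+ 2) / lam by rewrite ler_pM2r.
  have h7 : (s ^+ 2 - p ^+ 2) / lam <= #|Q|%:R * ((s ^+ 2 - p ^+ 2) / lam).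
    rewrite ler_peMl //; first by apply: le_trans h6; apply: mulr_ge0; [lra | exact: ltW].
    by rewrite ler1n card_gt0.
  lra.
have h6 : 0 <= #|Q|%:R * ((s ^+ 2 - p ^+ 2) / lam).
  by apply: mulr_ge0 => //; apply: mulr_ge0; [apply: le_trans sp; lra | exact: ltW].
have h7 : 1 / 4%:R <= NL.
  rewrite /NL (bigD1 u) //= (bigD1 v) //=.
  have -> : ((u != v) && ~~ e u v)%:R * (x u * x v) = x u * x v by rewrite nuv neuv mul1r.
  have h9 : 1 / 4%:R <= x u * x v.
    have -> : 1 / 4%:R = (1 / 2%:R) * (1 / 2%:R) :> R by field.
    by have := xL Lu; have := xL Lv; have := t_le1 => *; apply: ler_pM; lra.
  apply: le_trans h9 _; rewrite -addrA lerDl addr_ge0 //.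
    by apply: sumr_ge0 => w _; rewrite mulr_ge0 ?mulr_ge0.
  by apply: sumr_ge0 => z _; apply: sumr_ge0 => w _; rewrite mulr_ge0 ?mulr_ge0.
have h10 : 1 / 4%:R / lam <= 1 / 4%:R.
  by rewrite ler_piMr ?invf_le1 //; lra.
lra.
Qed.

End Comparison.

Definition join_graph (G : sgraph) (L A : {set G}) : sgraph :=
  SGraph (join_sym L (@edge_sym G) A) (join_irrefl (@edge G) L A).

(** The test vector is that of a complete bipartite graph: constant on the two
    sides, with squares in the inverse ratio of their sizes. *)
Lemma join_empty_radius (R : realType) (G : sgraph) (L : {set G}) : (0 < #|G|)%N ->
  #|L|%:R * (#|G|%:R - #|L|%:R) <= spectral_radius R (join_graph L finset.set0) ^+ 2.
Proof.
move=> G0; set G' := join_graph _ _; set rho := spectral_radius R G'.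
have [x [_ _ _ rhoP]] := @perron R G' G0.
pose g : R := #|L|%:R; pose k : R := #|~: L|%:R.
have kE : #|G|%:R - g = k by rewrite /g /k -(cardsC L) natrD addrC addKr.
rewrite -/g kE.
have g0 : 0 <= g by []; have k0 : 0 <= k by [].
have [gk0|gk] := eqVneq (g * k) 0; first by rewrite gk0 sqr_ge0.
pose y v := if v \in L then Num.sqrt k else Num.sqrt g.
have sk : Num.sqrt k ^+ 2 = k by rewrite sqr_sqrtr.
have sg : Num.sqrt g ^+ 2 = g by rewrite sqr_sqrtr.
have sk0 := sqrtr_ge0 k; have sg0 := sqrtr_ge0 g.
have y0 v : 0 <= y v by rewrite /y; case: ifP.
have yy : \sum_v y v ^+ 2 = 2%:R * (g * k).
  rewrite (bigID (mem L)) /= (eq_bigr (fun=> k)) => [|v Lv]; last by rewrite /y Lv.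
  rewrite [X in _ + X](eq_bigr (fun=> g)) => [|v /negbTE Lv]; last by rewrite /y Lv.
  rewrite sumr_const [X in _ + X](eq_bigl (fun v => v \in ~: L)) => [|v]; last by rewrite in_setC.
  by rewrite sumr_const -[k *+ _]mulr_natl -[g *+ _]mulr_natl -/g -/k; ring.
have qy : 2%:R * (g * k) * (Num.sqrt k * Num.sqrt g) <= qform (@edge G') y.
  have S1 (A B : {set G}) (b : R) : \sum_(u in A) \sum_(v in B) b = #|A|%:R * #|B|%:R * b.
    by rewrite !sumr_const -mulrnA mulnC -natrM mulr_natl.
  have -> : 2%:R * (g * k) * (Num.sqrt k * Num.sqrt g) =
      \sum_u \sum_v (u \in L)%:R * (v \in ~: L)%:R * (Num.sqrt k * Num.sqrt g) +
      \sum_u \sum_v (u \in ~: L)%:R * (v \in L)%:R * (Num.sqrt k * Num.sqrt g).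
    by rewrite !sum_indicator !S1 -/g -/k; ring.
  rewrite -big_split /=; apply: ler_sum => u _; rewrite -big_split /=; apply: ler_sum => v _.
  rewrite /join_rel !in_setC /y; have kg := mulr_ge0 sk0 sg0.
  case: (eqVneq u v) => [->|_] /=; first by case: (v \in L) => /=; lra.
  case: (u \in L); case: (v \in L) => //=; rewrite ?mul1r ?mul0r ?mulr0 ?addr0 ?add0r ?mulr1 //.
  - by rewrite mulr_ge0.
  - by rewrite mulrC.
  by rewrite !inE mul0r.
have := le_trans qy (rhoP y); rewrite yy -/rho [rho * _]mulrC ler_pM2l; last first.
  by rewrite mulr_gt0 // lt_neqAle eq_sym gk mulr_ge0.
move=> le; have -> : g * k = (Num.sqrt k * Num.sqrt g) ^+ 2 by rewrite exprMn sk sg mulrC.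
have m0 := mulr_ge0 sk0 sg0.
by rewrite ler_pXn2r ?nnegrE //; apply: le_trans m0 le.
Qed.

(** * Irreducible induced subgraphs *)

Definition edge_count (K : sgraph) : nat := #|[pred xy : K * K | xy.1 -- xy.2]|.

(** Among the induced subgraphs of the same order that embed into the given
    one, a member with the fewest edges is irreducible. *)
Lemma Gamma_star_below (H : sgraph) (S : {set H}) :
  exists2 K, Gamma_star #|S| H K & mle (@edge K) setT (@edge H) S.
Proof.
pose P (S' : {set H}) := `[< #|S'| = #|S| /\ exists f : induced S' -> induced S,
  injective f /\ forall x y, x -- y -> f x -- f y >].
have PS : P S by apply/asboolP; split=> //; exists id; split=> // ? ?.
have [S' /asboolP [cS' [f [fI fh]]] mS'] : exists2 S', P S' &
    forall D, P D -> (edge_count (induced S') <= edge_count (induced D))%N.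
  by case: (arg_minnP (fun D => edge_count (induced D)) PS) => D PD mD; exists D.
exists (induced S'); last first.
  by apply: mle_trans (induced_mle S); apply: (@mle_embed _ _ _ _ _ _ f) => // x y _ _; [apply: fI | apply: fh].
split; first by exists S'.
move=> J [S2 cS2 ->] [k [kI kh miss]].
have cJ : #|induced S2| = #|induced S'| by rewrite !card_induced cS2 cS'.
have kbij : bijective k by apply: inj_card_bij; rewrite // cJ.
case: miss => [[z zP]|[x [y [kxy nxy]]]].
  by have [k' _ kK] := kbij; have := zP (k' z); rewrite kK eqxx.
have /mS' : P S2.
  apply/asboolP; split=> //; exists (f \o k); split; first exact: inj_comp.
  by move=> a b ab; apply/fh/kh.
rewrite leqNgt => /negP; apply; rewrite /edge_count.
pose kk (ab : induced S2 * induced S2) := (k ab.1, k ab.2).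
have kkI : injective kk by move=> [a b] [a' b'] [/kI -> /kI ->].
rewrite -(card_image kkI); apply: proper_card; apply/properP; split.
  by apply/subsetP => _ /imageP [[a b] ab ->]; rewrite inE; apply: kh.
exists (k x, k y); first by rewrite inE.
apply/negP => /imageP [[a b]]; rewrite inE /= => ab [/kI E1 /kI E2].
by case/negP: nxy; rewrite E1 E2; exact: ab.
Qed.

Lemma exists_natr_ge (R : realType) (r : R) : exists n : nat, r <= n%:R.
Proof.
exists (Num.bound `|r|); apply: le_trans (ler_norm r) _.
by apply/ltW/archi_boundP.
Qed.

(** * Dominating vertices of extremal graphs *)

Lemma spectral_radius_ge0 (R : realType) (G : sgraph) : (0 < #|G|)%N -> 0 <= spectral_radius R G.
Proof.
move=> G0; have [x [x01 [v xv] eig _]] := @perron R G G0.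
rewrite -[spectral_radius R G]mulr1 -xv eig; apply: sumr_ge0 => w _.
by rewrite mulr_ge0 //; case/andP: (x01 w).
Qed.

Lemma exists_constants (R : realType) (g M k : nat) (c : R) : 1 <= c ->
  exists t h : R, [/\ 0 <= t, t * (1 + M%:R + 2%:R * c) <= 1 / 2%:R,
    16%:R * k%:R * (g%:R + 4%:R * c) * (4%:R * c) * t <= 1, 0 < h &
    [/\ 28%:R * (g%:R + 1) * h * c <= 1, 20%:R * g%:R * h * c <= t & 4%:R * h * c <= t]].
Proof.
move=> c1; pose A := 1 + M%:R + 2%:R * c.
pose B := 16%:R * k%:R * (g%:R + 4%:R * c) * (4%:R * c).
have g0 : 0 <= g%:R :> R by []; have M0 : 0 <= M%:R :> R by [].
have A1 : 1 <= A by rewrite /A; lra.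
have B0 : 0 <= B by rewrite /B !mulr_ge0 ?addr_ge0 ?mulr_ge0 //; lra.
(* This choice gives [t * A <= 1 / 2] and [t * B <= 1] at the same time. *)
pose t := (2%:R * A + B)^-1.
have AB : 0 < 2%:R * A + B by lra.
have t0 : 0 < t by rewrite invr_gt0.
have tE : t * (2%:R * A + B) = 1 by rewrite mulVf // gt_eqF.
have tA : 0 <= t * A by rewrite mulr_ge0 ?(ltW t0) //; lra.
have tB : 0 <= t * B by rewrite mulr_ge0 ?(ltW t0).
have gc0 : 0 < 28%:R * (g%:R + 1) * c by rewrite !mulr_gt0 //; lra.
pose h := t / (28%:R * (g%:R + 1) * c).
have hE : h * (28%:R * (g%:R + 1) * c) = t by rewrite /h mulfVK // gt_eqF.
have h0 : 0 < h by rewrite divr_gt0.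
have hc0 : 0 <= h * c by rewrite mulr_ge0 ?(ltW h0) //; lra.
have ghc0 : 0 <= g%:R * (h * c) by rewrite mulr_ge0.
have t1 : t <= 1.
  have : t * 1 <= t * A by rewrite ler_wpM2l // ltW.
  by lra.
exists t, h; split; [exact: ltW | rewrite -/A; lra | rewrite -/B; lra | exact: h0 |].
split; lra.
Qed.

Lemma exists_large (R : realType) (s : seq R) :
  exists n0 : nat, forall n : nat, (n0 <= n)%N -> all (fun r => r <= n%:R) s.
Proof.
elim: s => [|r s [n0 IH]]; first by exists 0%N.
have [n1 rn] := exists_natr_ge r; exists (maxn n0 n1) => n; rewrite geq_max => /andP [h0 h1].
by rewrite /= IH // andbT; apply: le_trans rn _; rewrite ler_nat.
Qed.

(** At most a quarter of the vertices can have a degree above [4 * c]. *)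
Lemma low_degree_subset (R : realType) (T : finType) (e : rel T) (c : R) (k : nat)
    (W : {set T}) : 0 < c ->
  \sum_u \sum_v (e u v)%:R <= c * #|T|%:R ->
  #|T|%:R <= 2%:R * #|W|%:R :> R -> 4%:R * k%:R <= #|T|%:R :> R ->
  exists Z : {set T}, [/\ Z \subset W, #|Z| = k &
    forall z, z \in Z -> \sum_v (e z v)%:R <= 4%:R * c].
Proof.
move=> c0 sum_le cW ck; pose D := [set z in W | \sum_v (e z v)%:R <= 4%:R * c].
have DW : D \subset W by apply/subsetP => z; rewrite inE => /andP [].
have : #|W :\: D|%:R * (4%:R * c) <= c * #|T|%:R.
  apply: le_trans sum_le; rewrite card_sumR mulr_suml.
  rewrite [X in _ <= X](bigID (mem (W :\: D))) /= ler_wpDr //.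
    by apply: sumr_ge0 => u _; apply: sumr_ge0.
  apply: ler_sum => z /setDP [Wz]; rewrite mul1r inE Wz /= -ltNge; exact: ltW.
have -> : #|W :\: D|%:R * (4%:R * c) = c * (4%:R * #|W :\: D|%:R) by ring.
rewrite ler_pM2l // => h.
have cD : #|W|%:R = #|W :\: D|%:R + #|D|%:R :> R.
  by rewrite -natrD addnC -{1}(setIidPr DW) cardsID.
have kD : (k <= #|D|)%N by rewrite -(ler_nat R); lra.
have [Z ZD cZ] := subset_of_card kD; exists Z; split=> //.
  exact: subset_trans ZD DW.
by move=> z /(subsetP ZD); rewrite inE => /andP [].
Qed.

Section Extremal.
Variables (R : realType) (HH : graph_family).
Hypothesis HH_nonempty : exists H, HH H.
Hypothesis HH_min_degree : forall H, HH H -> (1 <= min_degree H)%N.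
Hypothesis HH_not_star : forall H, HH H -> forall k : nat, ~ graph_iso H (star k).

Let g := gamma_family HH.

Lemma alpha_gamma_family H : HH H -> (alpha H + g < #|H|)%N.
Proof.
move=> HHH; have [_ /(_ H HHH) le] := gamma_familyP HH_nonempty.
have [_ E] := gamma_alpha (alpha_lt (HH_min_degree HHH) (HH_not_star HHH)).
by rewrite -[X in (_ < X)%N]E addn1 ltnS leq_add2l.
Qed.

Lemma gamma_family_witness : exists (H : sgraph) (I : {set H}),
  [/\ HH H, independent I, #|~: I| = g.+1 & (0 < g)%N].
Proof.
have [[H HHH gH] _] := gamma_familyP HH_nonempty.
have [g0 E] := gamma_alpha (alpha_lt (HH_min_degree HHH) (HH_not_star HHH)).
have [I indI cI] := alpha_witness H.
exists H, I; split=> //; last by rewrite /g -gH.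
by apply/eqP; rewrite -(eqn_add2l #|I|) cardsC cI -E gH -/g addn1 addnS.
Qed.

Definition minorless (T : finType) (e : rel T) :=
  forall H, HH H -> ~ mle (@edge H) setT e setT.

Lemma minor_free_minorless (G : sgraph) : minor_free HH G <-> minorless (@edge G).
Proof.
by split=> mf H HHH h; apply: (mf H HHH); [apply: mle_minor | apply: minor_mle].
Qed.

(** [mle_star_join] with a single vertex of [A] as the connected set. *)
Lemma minorless_biclique (H : sgraph) (I : {set H}) (T : finType) (e : rel T) (A : {set T}) :
  HH H -> independent I -> #|~: I| = g.+1 -> symmetric e -> irreflexive e ->
  minorless e -> #|A| = g.+1 -> (#|common e A| < #|H|)%N.
Proof.
move=> HHH indI cI es ei ml cA; rewrite ltnNge; apply/negP => le; apply: (ml H HHH).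
have [v Av] : exists v, v \in A by apply/set0Pn; rewrite -card_gt0 cA.
have com a y : a \in A -> y \in common e A -> e a y by move=> Aa; rewrite inE => /forall_inP; apply.
have nA a : a \in A -> a \in common e A -> False by move=> Aa /(com a a Aa); rewrite ei.
apply: (mle_star_join (L := A :\ v) (X := [set v]) (Y := common e A) es indI) => //.
- by rewrite cI -cA (cardsD1 v A) Av.
- exact: conn1.
- by apply/disjointP => x /set1P ->; rewrite !inE eqxx.
- by apply/disjointP => x Yx /setD1P [_ Ax]; apply: nA Yx.
- by apply/disjointP => x /set1P -> Yv; apply: nA Yv.
- by move=> l y /setD1P [_ Al]; apply: com.
by move=> y Yy; exists v; rewrite ?inE // com.
Qed.

Lemma minorless_sparse (H : sgraph) (T : finType) (e : rel T) (D : {set T}) :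
  HH H -> symmetric e -> irreflexive e -> minorless e ->
  \sum_(u in D) \sum_(v in D) (e u v)%:R <= (2 ^ #|H|)%:R * #|D|%:R :> R.
Proof.
move=> HHH es ei ml.
have : ~ mle (@edge H) setT e D.
  by move=> h; apply: (ml H HHH); apply: mle_mono h => //; apply: subsetT.
move/(sparse_of_not_mle es ei); rewrite -(ler_nat R) natrM natr_sum; apply: le_trans.
apply: ler_sum => u Du; rewrite sumE_card /deg ler_nat subset_leq_card //.
by apply/subsetP => v; rewrite !inE.
Qed.

(** The join of a clique on [g] vertices with an edgeless graph is a competitor. *)
Lemma extremal_radius n (G : sgraph) : SPEX R n HH G -> (0 < #|G|)%N -> (g <= #|G|)%N ->
  g%:R * (#|G|%:R - g%:R) <= spectral_radius R G ^+ 2.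
Proof.
move=> [cG mf ext] G0 gG; have [|L _ cL] := @subset_of_card G setT g.
  by rewrite cardsT.
have h := @join_empty_radius R G L G0; rewrite cL in h; apply: le_trans h _.
have le : spectral_radius R (join_graph L finset.set0) <= spectral_radius R G.
  apply: ext => //; apply/minor_free_minorless => H HHH.
  by apply: empty_join_not_minor; rewrite cL alpha_gamma_family.
have h0 := @spectral_radius_ge0 R (join_graph L finset.set0) G0.
by rewrite ler_pXn2r ?nnegrE //; apply: le_trans le.
Qed.

(** The induced subgraphs of members of [HH] that are left when [g] branch
    sets are dropped *)
Let truncated (a : gset) := exists (H : sgraph) (S : {set H}),
  [/\ HH H, #|S| = (#|H| - g)%N & a = GSet S].

(** After restriction to the complement of [L], a minor of the join becomes a
    star-free truncated member, so a bounded truncated member is below it, and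
    the isolated vertices of the bounded member fit into [Z]. *)
Lemma join_minorless (H : sgraph) (I : {set H}) (T : finType) (e : rel T) t (L Z : {set T}) :
  HH H -> independent I -> #|~: I| = g.+1 -> symmetric e -> irreflexive e -> minorless e ->
  (forall a, truncated a -> gstarfree #|H| a ->
     exists b, [/\ truncated b, (#|gset_set b| <= t)%N & gle b a]) ->
  #|L| = g -> Z \subset common e L -> #|Z| = (t + g)%N ->
  minorless (join_rel e L (common e L :\: Z)).
Proof.
move=> HHH indI cI es ei ml basis cL ZW cZ K HK /(mle_restrict L) [S [cS leS]].
have eW l w : l \in L -> w \in common e L -> e l w by move=> Ll; rewrite inE => /forall_inP; apply.
have WL : [disjoint common e L & L].
  by apply/disjointP => w Ww Lw; have := eW w w Lw Ww; rewrite ei.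
have sf : starfree #|H| (join_rel e L (common e L :\: Z)) (~: L).
  by apply: (starfree_join es eW (I := I)) => //; [apply: subsetDl | rewrite cL | apply: ml].
have [] := basis (GSet S).
- by exists K, S; rewrite -cL.
- exact: starfree_mle leS sf.
move=> b [[K2 [S2 [HK2 cS2 ->]]] /= tS2 le2]; apply: (ml K2 HK2).
have gK2 : (g <= #|K2|)%N by have := alpha_gamma_family HK2; lia.
apply: (join_reroute es WL eW (S := S2) (A := common e L :\: Z) (Z := Z)) => //.
- exact: subsetDl.
- by apply/disjointP => x /setDP [_ /negP].
- by rewrite cL -(leq_add2l #|S2|) cardsC cS2 subnK.
- by rewrite cZ -(subnK gK2) -cS2 leq_add2r.
exact: mle_trans le2 leS.
Qed.

(** The join of a clique on the hubs [L] with the graph induced by their common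
    neighbours outside [Z] is a competitor, and it has a larger spectral radius
    unless all hubs are dominating. A further dominating vertex would give
    [g + 1] vertices with too many common neighbours. *)
Lemma dominating_hubs : exists n0 : nat, forall n : nat, (n0 <= n)%N ->
  forall G : sgraph, SPEX R n HH G -> #|dominating_set G| = g.
Proof.
have [H0 [I [HH0 indI cI g0]]] := gamma_family_witness.
have [t basis] := starfree_basis truncated #|H0|.
pose M := #|H0|; pose c : R := (2 ^ M)%:R.
have c1 : 1 <= c by rewrite ler1n expn_gt0.
have c0 : 0 < c by apply: lt_le_trans c1.
have [tau [h [tau0 tau1 tau2 h0 [h1 h2 h3]]]] := @exists_constants R g M (t + g) c c1.
have [a aP] := exists_natr_ge (4%:R * c ^+ 2 / h).
have [n0 n0P] := @exists_large R [:: 2%:R * g%:R; 2%:R * c ^+ 2 / (h / (8%:R * c)) ^+ 4;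
  g%:R ^+ 2 / (h * c); (2 ^ a * M * a)%:R / (h * c); M%:R / (h * c);
  4%:R * (t + g)%:R; M%:R + g%:R + 1; 2%:R].
exists n0 => n n0n G spexG; have [cG mf ext] := spexG.
have := n0P n n0n; rewrite -cG /= andbT => /andP [b1 /andP [b2 /andP [b3 /andP [b4]]]].
move=> /andP [b5 /andP [b6 /andP [b7 b8]]].
have hc0 : 0 < h * c by rewrite mulr_gt0.
rewrite ler_pdivrMr // mulrC in b3; rewrite ler_pdivrMr // mulrC in b4.
rewrite ler_pdivrMr // mulrC in b5.
have es : symmetric (@edge G) := @edge_sym G.
have ei : irreflexive (@edge G) := @edge_irrefl G.
have /minor_free_minorless ml := mf.
have sparse D := minorless_sparse D HH0 es ei ml.
have nobi (A : {set G}) (cA : #|A| = g.+1) := minorless_biclique HH0 indI cI es ei ml cA.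
have G0 : (0 < #|G|)%N by rewrite -(ltr_nat R); apply: lt_le_trans b8.
have gG : (g <= #|G|)%N.
  by rewrite -(ler_nat R); apply: le_trans b1; rewrite ler_peMl // ler1n.
have [x [x01 x1 eig qP]] := @perron R G G0.
have lam0 := @spectral_radius_ge0 R G G0.
have lam2 := extremal_radius spexG G0 gG.
have [L [cL xL xnL comL]] := hub_structure es g0 c1 sparse nobi x01 lam0 eig lam2 h0 h1
  aP b1 b2 b3 b4 b5 x1.
have {}xL v : v \in L -> 1 - tau <= x v by move=> /xL; lra.
have {}xnL v : v \notin L -> x v <= tau by move=> /xnL; lra.
have sum_dg : \sum_u \sum_v (@edge G u v)%:R <= c * #|G|%:R.
  apply: le_trans (sum_dg_sub sparse setT); rewrite [X in _ <= X](eq_bigl xpredT) // => u.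
  by rewrite in_setT.
have [Z [ZW cZ dZ]] := low_degree_subset c0 sum_dg comL b6.
have nobi1 v : v \notin L -> (#|common (@edge G) (v |: L)| < M)%N.
  by move=> Lv; apply: nobi; rewrite cardsU1 Lv cL.
have nbrs_out v : v \in ~: (L :|: common (@edge G) L) ->
    \sum_(w in common (@edge G) L) (@edge G v w)%:R <= M%:R :> R.
  rewrite in_setC in_setU negb_or => /andP [Lv _].
  rewrite sumE_card ler_nat; apply: leq_trans (ltnW (nobi1 v Lv)).
  apply/subset_leq_card/subsetP => w; rewrite in_setI => /andP [].
  move=> Ww; rewrite inE => vw; move: Ww; rewrite !inE => /forall_inP cw.
  by apply/forall_inP => u /setU1P [->|/cw].
have lam1 : 1 <= spectral_radius R G.
  have g1 : 1 <= g%:R :> R by rewrite ler1n.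
  have : 1 <= spectral_radius R G ^+ 2 by apply: le_trans lam2; nra.
  by rewrite -[X in X <= _ ^+ 2](expr1n R 2) ler_pXn2r ?nnegrE.
(* Neither a vertex outside [L] and its common neighbours nor a missing edge
   inside [L] can exist. *)
have nogain : ~ ((~: (L :|: common (@edge G) L) != finset.set0) \/
    (exists u v, [/\ u \in L, v \in L, u != v & ~~ u -- v])).
  move=> gain; have cZ' : 16%:R * #|Z|%:R * (#|L|%:R + 4%:R * c) * (4%:R * c) * tau <= 1.
    by rewrite cZ cL.
  have L0 : (0 < #|L|)%N by rewrite cL.
  have [y yP] := join_beats es ei ZW (ltW c0) sparse nbrs_out dZ x01 xL xnL lam1 eig tau0
     tau1 cZ' L0 gain.
  have [z [_ _ _ zP]] := @perron R (join_graph L (common (@edge G) L :\: Z)) G0.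
  have := lt_le_trans yP (zP y); apply/negP; rewrite -leNgt.
  apply: ler_wpM2r; first by apply: sumr_ge0 => v _; apply: sqr_ge0.
  apply: ext => //; apply/minor_free_minorless.
  exact: join_minorless HH0 indI cI es ei ml basis cL ZW cZ.
have cover v : v \notin L -> v \in common (@edge G) L.
  move=> Lv; apply: contrapT => /negP Wv; apply: nogain; left.
  by apply/set0Pn; exists v; rewrite in_setC in_setU negb_or Lv.
suff -> : dominating_set G = L by [].
apply/setP => v; rewrite inE; apply/idP/idP => [dom|Lv].
  apply: contrapT => /negP Lv; have := nobi1 v Lv; apply/negP; rewrite -leqNgt.
  have sub : ~: (v |: L) \subset common (@edge G) (v |: L).
    apply/subsetP => w; rewrite in_setC in_setU1 negb_or => /andP [wv Lw].
    rewrite inE; apply/forall_inP => u /setU1P [->|Lu].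
      by have /forallP/(_ w)/implyP := dom; apply.
    by have := cover w Lw; rewrite inE => /forall_inP; apply.
  apply: leq_trans (subset_leq_card sub).
  rewrite -(leq_add2l #|v |: L|) cardsC cardsU1 Lv cL -(ler_nat R) !natrD /=; lra.
apply/forallP => w; apply/implyP => wv; case: (boolP (w \in L)) => Lw.
  by apply: contrapT => /negP nvw; apply: nogain; right; exists v, w; rewrite eq_sym.
by have := cover w Lw; rewrite inE => /forall_inP; apply.
Qed.

End Extremal.

(** * Saturation *)

(** The entry of [l] is positive since [l] is adjacent to a vertex of entry [1]
    or has this entry itself; all other vertices are adjacent to [l]. *)
Lemma perron_gt0 (R : realType) (G : sgraph) (l : G) (x : G -> R) :
  dominating l -> (forall v, 0 <= x v <= 1) -> (exists v, x v = 1) ->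
  (forall v, spectral_radius R G * x v = \sum_w (v -- w)%:R * x w) ->
  forall v, 0 < x v.
Proof.
move=> /forallP dom x01 [v1 xv1] eig.
have step v w : v -- w -> 0 < x w -> 0 < x v.
  move=> vw xw; have [x0 _] := andP (x01 v); rewrite lt_neqAle x0 andbT eq_sym.
  apply: contraTneq xw => xv; have := eig v; rewrite xv mulr0 (bigD1 w) //= vw mul1r.
  rewrite -leNgt => /esym/eqP; rewrite paddr_eq0; first by case/andP => /eqP ->.
    by case/andP: (x01 w).
  by apply: sumr_ge0 => u _; rewrite mulr_ge0 //; case/andP: (x01 u).
have xl : 0 < x l.
  case: (eqVneq v1 l) => [<-|nl]; first by rewrite xv1.
  by apply: (step l v1); [have /implyP := dom v1; apply | rewrite xv1].
move=> v; case: (eqVneq v l) => [-> //|nl].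
by apply: (step v l) => //; rewrite edge_sym; have /implyP := dom v; apply.
Qed.

(** The Perron vector is positive in the presence of a dominating vertex, so
    a new edge strictly increases the Rayleigh quotient. *)
Lemma add_edge_radius (R : realType) (G : sgraph) (l u v : G) :
  dominating l -> u != v -> ~~ u -- v ->
  spectral_radius R G < spectral_radius R (add_edge u v).
Proof.
move=> dom nuv neuv; have G0 : (0 < #|G|)%N by apply/card_gt0P; exists l.
have [x [x01 x1 eig _]] := @perron R G G0.
have xp := perron_gt0 dom x01 x1 eig.
have [z [_ _ _ qP]] := @perron R (add_edge u v) G0.
have s0 : 0 < \sum_w x w ^+ 2.
  rewrite (bigD1 l) //= ltr_wpDr ?exprn_gt0 //.
  by apply: sumr_ge0 => w _; apply: sqr_ge0.
rewrite -(ltr_pM2r s0); apply: lt_le_trans (qP x).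
have -> : spectral_radius R G * \sum_w x w ^+ 2 = qform (@edge G) x.
  rewrite mulr_sumr; apply: eq_bigr => w _; rewrite expr2 mulrA eig mulr_suml.
  by apply: eq_bigr => w' _; rewrite [x w * _]mulrC mulrA.
have ee a b : (a -- b)%:R * (x a * x b) <= (@edge (add_edge u v) a b)%:R * (x a * x b).
  rewrite ler_wpM2r ?mulr_ge0 ?(ltW (xp _)) // ler_nat /= /add_edge_rel /=.
  case: (boolP (a -- b)) => //= ab; rewrite ?andbT //.
  by rewrite (contraTneq _ ab) // => ->; rewrite edge_irrefl.
rewrite /qform (bigD1 u) //= [X in _ < X](bigD1 u) //= ltr_leD //; last first.
  by apply: ler_sum => a _; apply: ler_sum => b _; apply: ee.
rewrite (bigD1 v) //= [X in _ < X](bigD1 v) //= ltr_leD //; last first.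
  by apply: ler_sum => b _; apply: ee.
have new : @edge (add_edge u v) u v by rewrite /= /add_edge_rel /same_pair /= nuv !eqxx orbT.
rewrite (negbTE neuv) mul0r; change (0 < (@edge (add_edge u v) u v)%:R * (x u * x v)).
by rewrite new mul1r mulr_gt0.
Qed.

(** Dominating vertices form a cone over the remaining graph. *)
Lemma mle_dominated (H : sgraph) (S : {set H}) (G : sgraph) (L : {set G}) :
  {in L, forall l, dominating l} -> (#|~: S| <= #|L|)%N ->
  mle (@edge H) S (@edge G) (~: L) -> mle (@edge H) setT (@edge G) setT.
Proof.
move=> dom cS leS; have [S0|[h0 Sh0]] := set_0Vmem (~: S).
  have -> : [set: H] = S by rewrite -[S]setCK S0 setC0.
  by apply: mle_mono leS => //; apply: subsetT.
have [l0 _] : exists l0, l0 \in L.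
  by apply/card_gt0P; apply: leq_trans cS; apply/card_gt0P; exists h0.
have [l [lI lL]] := inj_of_card l0 cS.
have inS a : a \notin S -> a \in ~: S by rewrite inE.
have adj y z : y \in L -> z != y -> y -- z.
  by move=> /dom /forallP /(_ z) /implyP; apply.
apply: (@mle_cone _ _ S _ _ (~: L) (fun a => [set l a])) => //.
- exact: edge_sym.
- move=> a Sa; split; first exact: conn1.
  by apply/disjointP => z /set1P ->; rewrite inE (lL _ (inS _ Sa)).
- move=> a b Sa Sb ab; have nl : l b != l a.
    by apply: contraNneq ab => /(lI _ _ (inS _ Sb) (inS _ Sa)) ->.
  split; first by apply/disjointP => z /set1P -> /set1P E; rewrite E eqxx in nl.
  by exists (l a), (l b); split; rewrite ?set11 //; apply: adj => //; apply/lL/inS.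
move=> a z Sa; rewrite inE => Lz; exists (l a); first by rewrite inE.
by apply: adj; [apply/lL/inS | apply: contraNneq Lz => ->; apply/lL/inS].
Qed.

Lemma mle_add_edge (G : sgraph) (D : {set G}) (u v : induced D) :
  mle (add_edge_rel (val u) (val v)) D (@edge (add_edge u v)) setT.
Proof.
apply: mle_trans (@mle_induced (add_edge (val u) (val v)) D) _.
by apply: (@mle_embed _ _ _ _ _ _ id).
Qed.

Local Close Scope ring_scope.

Theorem theorem1p2 (R : realType) (HH : graph_family)
    (HH_nonempty : exists H, HH H)
    (HH_min_degree : forall H, HH H -> (1 <= min_degree H)%N)
    (HH_not_star : forall H, HH H -> forall k : nat, ~ graph_iso H (star k)) :
  exists n0 : nat, forall n : nat, (n0 <= n)%N ->
    forall G : sgraph, SPEX R n HH G ->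
      let L := dominating_set G in
      SAT (n - gamma_family HH)%N (Gamma_family HH) (induced (~: L)%SET) /\
      (forall H : sgraph, (forall K : sgraph, HH K <-> K = H) ->
         SAT (n - gamma H)%N (Gamma_star (alpha H + 1) H) (induced (~: L)%SET)).
Proof.
have [n0 n0P] := dominating_hubs R HH_nonempty HH_min_degree HH_not_star.
have alphag := alpha_gamma_family HH_nonempty HH_min_degree HH_not_star.
exists n0 => n n0n G spexG L; have cL : #|L| = gamma_family HH := n0P n n0n G spexG.
have [cG mf ext] := spexG.
have dom : {in L, forall l, dominating l} by move=> l; rewrite inE.
have sat : SAT (n - gamma_family HH) (Gamma_family HH) (induced (~: L)).
  split; first by rewrite card_induced -cG -cL -(cardsC L) addKn.
  split=> [K [H HHH [[S cS ->] _]] mK|u v nuv neuv].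
    apply: (mf H HHH); apply: mle_minor.
    apply: (mle_dominated (S := S) dom).
      rewrite cL -(leq_add2l #|S|) cardsC cS subnK //.
      by have := alphag H HHH; lia.
    apply: mle_trans (mle_induced S) _.
    exact: mle_trans (minor_mle mK) (induced_mle _).
  have [l Ll] : exists l, l \in L.
    apply/set0Pn; rewrite -card_gt0 cL.
    by have [H [I []]] := gamma_family_witness HH_nonempty HH_min_degree HH_not_star.
  have nuv' : val u != val v by [].
  have lt := add_edge_radius R (dom l Ll) nuv' neuv.
  have [H [HHH mH]] : exists H, HH H /\ minor H (add_edge (val u) (val v)).
    apply: contrapT => no.
    have mf' : minor_free HH (add_edge (val u) (val v)).
      by move=> H HHH mH; apply: no; exists H.
    by have := ext (add_edge (val u) (val v)) cG mf'; rewrite leNgt lt.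
  have [S [cS leS]] := mle_restrict L (minor_mle mH).
  have [K HK leK] := Gamma_star_below S.
  exists K; first by exists H => //; rewrite -cL -cS.
  by apply/mle_minor/(mle_trans leK)/(mle_trans leS)/mle_add_edge.
split=> // H HE; have HHH : HH H by apply/HE.
have gE : gamma_family HH = gamma H.
  by have [[K /HE KE gK] _] := gamma_familyP HH_nonempty; rewrite -gK KE.
have sE : #|H| - gamma H = alpha H + 1.
  by have := alphag H HHH; rewrite /gamma; lia.
have [cS [fr satur]] := sat; rewrite gE in cS; split=> //; split=> [K KH|u v nuv neuv].
  by apply: fr; exists H => //; rewrite gE sE.
have [K [H' /HE HE']] := satur u v nuv neuv; rewrite HE' gE sE => KH mK.
by exists K.
Qed.
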